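(* There exist absolute constants $0<c\le C<\infty$ such that for all $k\in\mathbb{N}=\{1,2,\dots\}$, $$c\,k\;\le\;\|R^k\|_{L^\infty\to BMO}\;\le\; C\,k\log(k+1).$$
   Context: Identify $\mathbb{R}^2\equiv\mathbb{C}$. $R=R_2+iR_1$, where $R_1,R_2$ are the classical scalar Riesz transforms on $\mathbb{R}^2$; equivalently (with $\hat f(\xi)=\int f(x)e^{-2\pi i x\cdot\xi}\,dx$) $R^k$ is the Fourier multiplier operator with symbol $(\bar\zeta/|\zeta|)^k$, i.e. the principal-value convolution singular integral with kernel $\Omega_k(z)=\frac{i^{k}k}{2\pi}\frac{(z/|z|)^{-k}}{|z|^2}$. $BMO=BMO(\mathbb{C})$ is the space (modulo constants) of functions of bounded mean oscillation on $\mathbb{C}\equiv\mathbb{R}^2$ with its usual seminorm, the dual of the atomic Hardy space $H^1(\mathbb{C})$. $R^k:L^\infty(\mathbb{C})\to BMO$ is the usual extension of this Calderón–Zygmund operator to $L^\infty$: for $f\in L^\infty$, $R^kf\in BMO$ is determined by $\int (R^kf)\,h=(-1)^k\int f\,R^kh$ for all finite linear combinations $h$ of $H^1$ atoms (note $\Omega_k(-z)=(-1)^k\Omega_k(z)$); it agrees modulo constants with $R^kf$ when $f\in L^2\cap L^\infty$. $\|R^k\|_{L^\infty\to BMO}$ is the operator norm. *)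

(* Defs.v *)
From mathcomp Require Import all_boot all_order all_algebra.
From mathcomp Require Import all_classical all_reals all_analysis.
From mathcomp Require Import complex ring.

Set Implicit Arguments.
Unset Strict Implicit.
Unset Printing Implicit Defensive.

Import Order.TTheory GRing.Theory Num.Theory.
Import numFieldNormedType.Exports.

Local Open Scope classical_set_scope.
Local Open Scope ring_scope.
Local Open Scope complex_scope.

(** The complex plane appears in two guises: the domain of a function is
    [plane R], which carries the two-dimensional Lebesgue measure [area R],
    and its values lie in the field [R[i]].  The identification is [toC]. *)

Notation plane R := (measurableTypeR R * measurableTypeR R)%type.

Notation area R := (@lebesgue_measure R \x @lebesgue_measure R)%E.

Definition toC (R : realType) (z : plane R) : R[i] :=
  (z.1 : R) +i* (z.2 : R).

(** The norm of [R[i]] takes its values in [R[i]]; [modulus] is its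
    [R]-valued version. *)
Notation modulus := Normc.normc.

Definition cmeasurable (R : realType) (f : plane R -> R[i]) : Prop :=
  measurable_fun setT (fun z => complex.Re (f z)) /\
  measurable_fun setT (fun z => complex.Im (f z)).

Definition cintegrable (R : realType) (D : set (plane R))
    (f : plane R -> R[i]) : Prop :=
  (area R).-integrable D (fun z => (complex.Re (f z))%:E) /\
  (area R).-integrable D (fun z => (complex.Im (f z))%:E).

Definition cintegral (R : realType) (D : set (plane R))
    (f : plane R -> R[i]) : R[i] :=
  Rintegral (area R) D (fun z => complex.Re (f z)) +i*
  Rintegral (area R) D (fun z => complex.Im (f z)).

Definition Linfty_norm (R : realType) (f : plane R -> R[i]) : \bar R :=
  Lnorm (area R) +oo%E (fun z => (modulus (f z))%:E).

Definition in_Linfty (R : realType) (f : plane R -> R[i]) : Prop :=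
  cmeasurable f /\ (Linfty_norm f < +oo)%E.

(** The closed square with lower left corner [a] and side [l]. *)
Definition square (R : realType) (a : plane R) (l : R) : set (plane R) :=
  `[a.1 : R, (a.1 : R) + l] `*` `[a.2 : R, (a.2 : R) + l].

Definition average (R : realType) (a : plane R) (l : R)
    (b : plane R -> R[i]) : R[i] :=
  (l ^- 2)%:C * cintegral (square a l) b.

Definition BMO_norm (R : realType) (b : plane R -> R[i]) : \bar R :=
  ereal_sup [set s | exists (a : plane R) (l : R), 0 < l /\
    s = ((l ^- 2)%:E *
         \int[area R]_(z in square a l)
            (modulus (b z - average a l b))%:E)%E].

Definition in_BMO (R : realType) (b : plane R -> R[i]) : Prop :=
  cmeasurable b /\
  (forall (a : plane R) (l : R), 0 < l -> cintegrable (square a l) b) /\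
  (BMO_norm b < +oo)%E.

(** Atoms of the Hardy space H^1. *)
Definition atom (R : realType) (h : plane R -> R[i]) : Prop :=
  cmeasurable h /\
  exists (a : plane R) (l : R), 0 < l /\
    (forall z, ~ square a l z -> h z = 0) /\
    (Linfty_norm h <= (l ^- 2)%:E)%E /\
    cintegral (square a l) h = 0.

Definition atomic_sum (R : realType) (h : plane R -> R[i]) : Prop :=
  exists (n : nat) (c : 'I_n -> R[i]) (g : 'I_n -> plane R -> R[i]),
    (forall j, atom (g j)) /\ h = (fun z => \sum_(j < n) c j * g j z).

(** The kernel of R^k, namely i^k k (w/|w|)^(-k) / (2 pi |w|^2); here [`|w|]
    is the modulus of [w] seen as an element of [R[i]]. *)
Definition Omega (R : realType) (k : nat) (w : R[i]) : R[i] :=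
  ('i%C ^+ k * k%:R / (2 * pi)%:C) * (w / `|w|) ^- k / `|w| ^+ 2.

Definition Rk_trunc (R : realType) (k : nat) (e : R) (h : plane R -> R[i])
    (z : plane R) : R[i] :=
  cintegral [set w | e < modulus (toC z - toC w)]
    (fun w => Omega k (toC z - toC w) * h w).

(** Principal value as e decreases to 0.  For an atomic sum [h] the limit
    exists at almost every point [z]; [lim] is arbitrary elsewhere. *)
Definition Rk (R : realType) (k : nat) (h : plane R -> R[i])
    (z : plane R) : R[i] :=
  lim (complex.Re (Rk_trunc k e h z) @[e --> 0^'+]) +i*
  lim (complex.Im (Rk_trunc k e h z) @[e --> 0^'+]).

(** [b] represents, modulo constants, the element R^k f of BMO, for a bounded
    [f]: since the atomic sums have mean zero and are dense in H^1, the
    identity below determines [b] up to a constant. *)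
Definition is_Rk (R : realType) (k : nat) (f b : plane R -> R[i]) : Prop :=
  in_BMO b /\
  forall h : plane R -> R[i], atomic_sum h ->
    cintegral setT (fun z => b z * h z) =
    (-1) ^+ k * cintegral setT (fun z => f z * Rk k h z).

(** The norm of R^k : L^oo -> BMO, as the least constant [M] such that R^k f
    is an element of BMO of norm at most [M] times that of [f], for all [f] in
    L^oo.  It is [+oo] if R^k f fails to exist for some [f]. *)
Definition Rk_opnorm (R : realType) (k : nat) : \bar R :=
  ereal_inf [set M%:E | M in [set M : R | 0 <= M /\
    forall f : plane R -> R[i], in_Linfty f ->
      exists b : plane R -> R[i], is_Rk k f b /\
        (BMO_norm b <= M%:E * Linfty_norm f)%E]].

(** For k = 1 the kernel is K_2 + i K_1, where K_j(x) = x_j / (2 pi |x|^3) is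
    the kernel of the j-th Riesz transform of the plane. *)
Lemma Omega1E (R : realType) (x y : R) :
  Omega 1 (x +i* y) =
  (y / (2 * pi * modulus (x +i* y) ^+ 3)) +i*
  (x / (2 * pi * modulus (x +i* y) ^+ 3)).
Proof.
have [n0|n0] := eqVneq (modulus (x +i* y)) 0.
  have w0 := Normc.eq0_normc n0.
  by rewrite /Omega n0 w0 normr0 !expr0n /= !mulr0 !invr0 !mulr0.
rewrite /Omega.
have nE : `|x +i* y| = (modulus (x +i* y))%:C by [].
have n2 : x ^+ 2 + y ^+ 2 = modulus (x +i* y) ^+ 2.
  by rewrite /= sqr_sqrtr// addr_ge0// sqr_ge0.
rewrite nE; move: (modulus _) n0 n2 => m m0 m2.
have p0 : (pi : R) != 0 by rewrite gt_eqF// pi_gt0.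
rewrite !expr1 mulr1 invf_div.
have -> : (x +i* y)^-1 = (x / m ^+ 2) +i* (- y / m ^+ 2).
  by rewrite -m2 mulNr.
rewrite -rmorphXn /= -!fmorphV /=.
simpc; move: (pi : R) p0 => q q0.
by congr Complex; field; rewrite m0 q0.
Qed.

Lemma OmegaN (R : realType) (k : nat) (w : R[i]) :
  Omega k (- w) = (-1) ^+ k * Omega k w.
Proof.
rewrite /Omega normrN mulNr -mulN1r exprMn invfM invr_sign; ring.
Qed.

(* Main.v *)
(** Upper bound.  The real and imaginary parts K of the kernel of R^k satisfy
    |K(z)| <= A/|z|^2 and |K(z-w) - K(z)| <= A k |w|/|z|^3 for 2|w| <= |z|, with
    A = O(k), and change sign under the rotation by pi/k.  Cut K into annular pieces
    K_i at the scales 8^i.  They have mean zero, so the kernel of T_i' T_j has L^1 norm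
    O(A^2 min(1, k 8^-|i-j|)): only O(log(k+1)) neighbouring pieces interact without
    decay, and a Cotlar-Stein argument bounds the truncations on L^2 by O(A log(k+1)).
    Cotlar's inequality and a Vitali covering give a weak type (2,2) estimate of the
    maximal truncation, whence the principal values exist almost everywhere.  On a
    square of side r, split a function bounded by F into the part near the square,
    handled by the L^2 bound, and the far part, whose principal value oscillates by at
    most a sum over dyadic annuli of A F min(1, k 2^-j), again O(A F log(k+1)).  For an
    unbounded support one removes from each far part its value at the origin.

    Lower bound.  Let h be the difference of the indicators of [1,2]x[0,1] and
    [-2,-1]x[0,1], and let z range over a square of side k at height 40k.  Seen from z,
    the two squares make angles of size 1/k on opposite sides of the direction of z, so
    for f(z) = i times the conjugate phase of the kernel at z the two contributions to
    Re(f(z) R^k h(z)) are both at least c/k.  Hence |int f R^k h| >= c k, whereas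
    |int b h| is at most a constant times the BMO norm of b. *)
From HB Require Import structures.
Require Import Defs.
From mathcomp Require Import all_boot all_order all_algebra.
From mathcomp Require Import all_classical all_reals all_analysis.
From mathcomp Require Import measurable_realfun ess_sup_inf complex ring lra zify.
Set Implicit Arguments.
Unset Strict Implicit.
Unset Printing Implicit Defensive.
Import Order.TTheory GRing.Theory Num.Theory.
Import numFieldNormedType.Exports.
Local Open Scope classical_set_scope.
Local Open Scope ring_scope.

(** * Measure-preserving maps of the plane *)

(** The Fourier multiplier of [R^k] is unimodular, so Plancherel would give norm one on [L^2]. The
    bound to be proved leaves room for [O(k log(k+1))], and this much follows from size, smoothness
    and cancellation of the kernel alone. All operators act first on bounded functions of bounded
    support, where integrability and Fubini are immediate; hence kernels are cut at both ends, and a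
    bounded [f] is cut to discs of radius [2^n] before a limit is taken. The logarithm enters twice
    through one sum, that of [min(1, k 2^-r)] over [r], whose first [log k] terms may be of size
    one: as a row sum in the Cotlar-Stein argument, and in the oscillation of the far part. The weak
    type estimate has an unspecified constant, since it serves only the existence of principal
    values; this existence being still unknown at that point, Cotlar's inequality compares a
    truncation with a finer truncation, not with the limit. Neither the [lim] in [Rk] nor an atom is
    controlled on null sets: measurable upper limits and bounded representatives replace them, and
    identities are carried over almost everywhere. *)

Section area_preserving.
Context {R : realType}.
Notation mu := (@lebesgue_measure R).
Implicit Types (phi : plane R -> plane R).

Lemma measurable_pairT d (T : measurableType d) (f g : T -> measurableTypeR R) :
  measurable_fun setT f -> measurable_fun setT g ->
  measurable_fun setT (fun x => (f x, g x) : plane R).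
Proof. by move=> mf mg; apply: measurable_fun_pair. Qed.

Lemma lebesgue_measure_shift (c : R) (A : set (measurableTypeR R)) :
  measurable A -> mu ((fun x : measurableTypeR R => x + c : measurableTypeR R) @^-1` A) = mu A.
Proof.
move=> mA.
have ms : measurable_fun setT (fun x : measurableTypeR R => (x : R) + c : measurableTypeR R).
  by apply: measurable_funD => //; exact: measurable_cst.
rewrite -[LHS]/(pushforward mu (fun x : measurableTypeR R => (x : R) + c : measurableTypeR R) A).
apply/esym/lebesgue_measure_unique => //= _ [[a b]] _ <-.
rewrite /pushforward.
have -> : (fun x : measurableTypeR R => (x : R) + c) @^-1` `]a, b]%classic = `]a - c, b - c]%classic.
  by apply/seteqP; split => x /=; rewrite !in_itv/= ltrBlDr lerBrDr.
rewrite !lebesgue_measure_itv/= !lte_fin ltrD2.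
by case: ifP => // _; rewrite -!EFinD; congr (_ %:E); ring.
Qed.

Definition area_preserving phi :=
  measurable_fun setT phi /\
  forall A, measurable A -> area R (phi @^-1` A) = area R A.

Lemma area_preserving_comp phi psi :
  area_preserving phi -> area_preserving psi -> area_preserving (phi \o psi).
Proof.
move=> [mphi phiA] [mpsi psiA]; split; first exact: measurableT_comp.
move=> A mA; rewrite comp_preimage psiA ?phiA//.
by rewrite -[X in measurable X]setTI; exact: mphi.
Qed.

(** The product measure integrates the lengths of the vertical sections, so it is enough that the
    map preserve the length of each of them. *)
Lemma area_preserving_fiber (psi : R -> R -> R) :
  measurable_fun setT (fun z : plane R => (z.1, psi z.1 z.2) : plane R) ->
  (forall x (A : set (measurableTypeR R)), measurable A -> mu (psi x @^-1` A) = mu A) ->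
  area_preserving (fun z => (z.1, psi z.1 z.2)).
Proof.
move=> mphi psiA; split; [exact: mphi|move=> A mA].
rewrite /product_measure1; apply: eq_integral => x _ /=.
rewrite -[RHS](psiA x); last exact: measurable_xsection.
by congr mu; apply/seteqP; split => y /set_mem /= Axy; exact: mem_set.
Qed.

Lemma area_preserving_swap : area_preserving (fun z => (z.2, z.1)).
Proof.
have ms : measurable_fun setT (fun z : plane R => (z.2, z.1) : plane R).
  exact: measurable_swap.
split; [exact: ms|move=> A mA].
rewrite -[LHS]/(pushforward (area R) (fun z : plane R => (z.2, z.1) : plane R) A).
apply/esym/product_measure_unique; [|exact: mA] => B C mB mC.
rewrite muleC -[RHS](product_measure1E _ _ mC mB) /pushforward; congr (area R _).
by apply/seteqP; split => -[x y] /= [].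
Qed.

Lemma area_preserving_shear (h : R -> R) : measurable_fun setT h ->
  area_preserving (fun z => (z.1, (z.2 : R) + h z.1)).
Proof.
move=> mh; apply: (@area_preserving_fiber (fun x y => y + h x)).
  apply: measurable_pairT => //; apply: measurable_funD => //.
  by apply: measurableT_comp.
by move=> x A mA; exact: lebesgue_measure_shift.
Qed.

Lemma area_preserving_shear1 (h : R -> R) : measurable_fun setT h ->
  area_preserving (fun z => ((z.1 : R) + h z.2, z.2)).
Proof.
move=> mh; have := area_preserving_comp area_preserving_swap
  (area_preserving_comp (area_preserving_shear mh) area_preserving_swap).
by [].
Qed.

Lemma area_preserving_add (a : plane R) : area_preserving (fun z => (z : R * R) + a).
Proof.
have m1 : measurable_fun setT (fun _ : R => (a.1 : R)) by exact: measurable_cst.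
have m2 : measurable_fun setT (fun _ : R => (a.2 : R)) by exact: measurable_cst.
exact: (area_preserving_comp (area_preserving_shear1 m1) (area_preserving_shear m2)).
Qed.

Lemma area_preserving_opp : area_preserving (fun z => - (z : R * R)).
Proof.
have H : area_preserving (fun z => (z.1, - (z.2 : R))).
  apply: (@area_preserving_fiber (fun x y => - y)).
    by apply: measurable_pairT => //; apply: measurable_funN.
  by move=> x A mA; exact: lebesgue_measureN.
have := area_preserving_comp area_preserving_swap
  (area_preserving_comp H (area_preserving_comp area_preserving_swap H)).
by [].
Qed.

Definition rot (c s : R) (z : plane R) : plane R :=
  (c * z.1 - s * z.2, s * z.1 + c * z.2).

(* A rotation is a product of three shears. *)
Lemma area_preserving_rot (c s : R) : s != 0 -> c ^+ 2 + s ^+ 2 = 1 ->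
  area_preserving (rot c s).
Proof.
move=> s0 cs.
(* For the angle [t] the slope [(c - 1) / s] is [- tan (t / 2)]: two horizontal shears of this slope
   surround a vertical one of slope [sin t]. *)
have m1 : measurable_fun setT (fun y : R => (c - 1) / s * y).
  by apply: measurable_funM => //; exact: measurable_cst.
have m2 : measurable_fun setT (fun y : R => s * y).
  by apply: measurable_funM => //; exact: measurable_cst.
have := area_preserving_comp (area_preserving_shear1 m1)
  (area_preserving_comp (area_preserving_shear m2) (area_preserving_shear1 m1)).
congr area_preserving; apply/funext => -[x y]; rewrite /rot/=.
have c2 : c ^+ 2 = 1 - s ^+ 2 by rewrite -cs; ring.
congr pair; last by field.
have -> : x + (c - 1) / s * y + (c - 1) / s * (y + s * (x + (c - 1) / s * y)) =
  c * x + ((c ^+ 2 - 1) / s) * y by field.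
by rewrite c2; field.
Qed.

Lemma integral_area_preserving phi (f : plane R -> \bar R) :
  area_preserving phi -> measurable_fun setT f ->
  (\int[area R]_z f (phi z) = \int[area R]_z f z)%E.
Proof.
move=> [mphi phiA] mf.
have ge0 (g : plane R -> \bar R) : measurable_fun setT g -> (forall z, 0 <= g z)%E ->
    (\int[area R]_z g (phi z) = \int[area R]_z g z)%E.
  move=> mg g0.
  have -> : (\int[area R]_z g (phi z) = \int[pushforward (area R) phi]_z g z)%E.
    apply/esym; apply: (ge0_integral_pushforward mphi (area R) measurableT mg).
    by move=> z _; exact: g0.
  by apply: (@eq_measure_integral _ _ _ setT (area R) (measure_function_pushforward__canonical__measure_function_Measure (area R) mphi) g) => A mA _; exact: phiA.
rewrite integralE [RHS]integralE; congr (_ - _)%E.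
  transitivity (\int[area R]_z f^\+ (phi z))%E.
    by apply: eq_integral => z _; rewrite !funeposE.
  by apply: (ge0 (f^\+)%E) => [|z]; [exact: measurable_funepos|exact: funepos_ge0].
transitivity (\int[area R]_z f^\- (phi z))%E.
  by apply: eq_integral => z _; rewrite !funenegE.
by apply: (ge0 (f^\-)%E) => [|z]; [exact: measurable_funeneg|exact: funeneg_ge0].
Qed.

End area_preserving.

(** * Euclidean norm and centred squares *)

Definition en {R : realType} (z : plane R) : R := modulus (toC z).

Section euclidean_norm.
Context {R : realType}.
Implicit Types z w : plane R.

Lemma enE z : en z = Num.sqrt (z.1 ^+ 2 + z.2 ^+ 2).
Proof. by []. Qed.

Lemma en_ge0 z : 0 <= en z.
Proof. exact: sqrtr_ge0. Qed.

Lemma en0 : en (0 : plane R) = 0.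
Proof. by rewrite enE/= expr0n/= addr0 sqrtr0. Qed.

Lemma enN z : en (- (z : R * R)) = en z.
Proof. by rewrite !enE/= !sqrrN. Qed.

Lemma enD z w : en ((z : R * R) + w) <= en z + en w.
Proof. exact: (@le_normcD _ (toC z) (toC w)). Qed.

Lemma enB z w : en ((z : R * R) - w) = en ((w : R * R) - z).
Proof. by rewrite -enN opprB. Qed.

Lemma en_subl z w : en z - en w <= en ((z : R * R) - w).
Proof. by rewrite lerBlDr; have := enD ((z : R * R) - w) w; rewrite subrK. Qed.

Lemma en_toC z w : modulus (toC z - toC w) = en ((z : R * R) - w).
Proof. by []. Qed.

Lemma sqr_en z : en z ^+ 2 = z.1 ^+ 2 + z.2 ^+ 2.
Proof. by rewrite enE sqr_sqrtr// addr_ge0// sqr_ge0. Qed.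

Lemma le_en1 z : `|z.1| <= en z.
Proof.
by rewrite -(@ler_pXn2r _ 2)// ?nnegrE ?en_ge0// sqr_en real_normK ?num_real// lerDl sqr_ge0.
Qed.

Lemma le_en2 z : `|z.2| <= en z.
Proof.
by rewrite -(@ler_pXn2r _ 2)// ?nnegrE ?en_ge0// sqr_en real_normK ?num_real// lerDr sqr_ge0.
Qed.

Lemma en_le z : en z <= `|z.1| + `|z.2|.
Proof.
rewrite -(@ler_pXn2r _ 2)// ?nnegrE ?en_ge0 ?addr_ge0// sqr_en sqrrD !real_normK ?num_real//.
by rewrite addrAC lerDl mulrn_wge0// mulr_ge0.
Qed.

Lemma measurable_sqrtr : measurable_fun setT (@Num.sqrt R).
Proof. by apply: continuous_measurable_fun => x; exact: sqrt_continuous. Qed.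

Lemma measurable_en : measurable_fun setT (@en R).
Proof.
apply: (measurableT_comp measurable_sqrtr).
by apply: measurable_funD; apply: measurable_funX.
Qed.

Lemma measurable_add d (T : measurableType d) (f g : T -> plane R) :
  measurable_fun setT f -> measurable_fun setT g ->
  measurable_fun setT (fun x => (f x : R * R) + g x : plane R).
Proof.
move=> mf mg; apply: measurable_pairT.
  by apply: measurable_funD; [exact: (measurableT_comp measurable_fst mf)|
                              exact: (measurableT_comp measurable_fst mg)].
by apply: measurable_funD; [exact: (measurableT_comp measurable_snd mf)|
                              exact: (measurableT_comp measurable_snd mg)].
Qed.

Lemma measurable_opp d (T : measurableType d) (f : T -> plane R) :
  measurable_fun setT f ->
  measurable_fun setT (fun x => - (f x : R * R) : plane R).
Proof.
move=> mf; apply: measurable_pairT.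
  by apply: measurable_funN; exact: (measurableT_comp measurable_fst mf).
by apply: measurable_funN; exact: (measurableT_comp measurable_snd mf).
Qed.

Lemma measurable_sub d (T : measurableType d) (f g : T -> plane R) :
  measurable_fun setT f -> measurable_fun setT g ->
  measurable_fun setT (fun x => (f x : R * R) - g x : plane R).
Proof. by move=> mf mg; apply: (measurable_add mf); exact: measurable_opp. Qed.

(** The closed ball of the maximum norm, that is [square] in centred form, with [r] half the side.
    By [en_sq] and [sq_en] it lies between the Euclidean discs of radii [r] and [2 * r]. *)
Definition sq (z : plane R) (r : R) : set (plane R) :=
  [set w | `|w.1 - z.1| <= r /\ `|w.2 - z.2| <= r].

Lemma sqE z r : sq z r = `[(z.1 : R) - r, (z.1 : R) + r] `*` `[(z.2 : R) - r, (z.2 : R) + r].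
Proof.
by apply/seteqP; split => w /=; rewrite /sq/= !in_itv/= !ler_distl => -[-> ->].
Qed.

Lemma area_rect (a b c d : R) : a <= b -> c <= d ->
  area R (`[a, b] `*` `[c, d]) = ((b - a) * (d - c))%:E.
Proof.
have E (x y : R) : x <= y -> @lebesgue_measure R `[x, y]%classic = (y - x)%:E.
  move=> xy; rewrite lebesgue_measure_itv/= lte_fin -EFinB.
  by move: xy; rewrite le_eqVlt => /predU1P[->|->//]; rewrite ltxx subrr.
move=> ab cd; rewrite product_measure1E; [|exact: measurable_itv|exact: measurable_itv].
by rewrite EFinM -(E _ _ ab) -(E _ _ cd).
Qed.

Lemma measurable_sq z r : measurable (sq z r).
Proof. by rewrite sqE; apply: measurableX. Qed.

Lemma area_sq z r : 0 <= r -> area R (sq z r) = ((2 * r) ^+ 2)%:E.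
Proof.
by move=> r0; rewrite sqE area_rect; [congr (_ %:E); ring|lra|lra].
Qed.

Lemma square_sq (a : plane R) l : square a l = sq ((a.1 : R) + l / 2, (a.2 : R) + l / 2) (l / 2).
Proof. by rewrite sqE/= /square !addrK -!addrA -!splitr. Qed.

Lemma en_sq z w r : en ((w : R * R) - z) <= r -> sq z r w.
Proof.
by move=> wr; split; apply: le_trans wr; [exact: (le_en1 ((w : R * R) - z))|exact: (le_en2 ((w : R * R) - z))].
Qed.

Lemma sq_en z w r : sq z r w -> en ((w : R * R) - z) <= 2 * r.
Proof. by move=> [] *; apply: (le_trans (en_le _)) => /=; lra. Qed.

End euclidean_norm.

(** * Bounded functions of bounded support *)

HB.lock Definition Int {R : realType} (f : plane R -> R) : R :=
  Rintegral (area R) setT f.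
Canonical Int_unlockable := Unlockable Int.unlock.

Section bcs.
Context {R : realType}.
Implicit Types (f g h : plane R -> R).
Notation Ig f := ((area R).-integrable setT (EFin \o f)).

(** A single constant bounds both the values and the radius of the support. The class [bcs] below is
    stable under products, translations and convolution, and every member is integrable. *)
Definition bcsM (M : R) f := forall z, `|f z| <= M /\ (M < en z -> f z = 0).

Definition bcs f := measurable_fun setT f /\ exists M, bcsM M f.

Lemma bcs_measurable f : bcs f -> measurable_fun setT f.
Proof. by case. Qed.

Lemma bcsMW M M' f : M <= M' -> bcsM M f -> bcsM M' f.
Proof.
move=> MM' fM z; have [f1 f2] := fM z; split; first exact: le_trans MM'.
by move=> Mz; apply: f2; exact: le_lt_trans Mz.
Qed.

Lemma bcsM_ge0 M f : bcsM M f -> 0 <= M.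
Proof. by move=> /(_ 0)[+ _]; exact: le_trans. Qed.

Lemma bcs_bound f : bcs f -> exists M, 0 < M /\ bcsM M f.
Proof.
move=> [_ [M fM]]; exists (M + 1); split.
  by have := bcsM_ge0 fM; lra.
by apply: bcsMW fM; lra.
Qed.

Lemma integrable_bounded_support f (A : set (plane R)) (M : R) :
  measurable_fun setT f -> measurable A -> (area R A < +oo)%E ->
  (forall z, `|f z| <= M) -> (forall z, ~ A z -> f z = 0) -> Ig f.
Proof.
move=> mf mA Afin fM f0.
have -> : EFin \o f = (EFin \o f) \_ A.
  apply/funext => z; rewrite /patch; case: ifPn => //; rewrite notin_setE => Az /=.
  by rewrite f0.
apply/(integrable_mkcond _ mA); apply: measurable_bounded_integrable => //.
  exact: measurable_funS mf.
exists M; split; first exact: num_real.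
by move=> x Mx z Az; exact: le_trans (ltW Mx).
Qed.

Lemma bcs_Ig f : bcs f -> Ig f.
Proof.
move=> bf; have [M [M0 fM]] := bcs_bound bf; have [mf _] := bf.
apply: (@integrable_bounded_support _ (sq 0 M) M) => //.
- exact: measurable_sq.
- by rewrite area_sq ?ltry// ltW.
- by move=> z; case: (fM z).
- move=> z Mz; apply: (fM z).2; rewrite ltNge; apply/negP => zM; apply: Mz.
  by apply: en_sq; rewrite subr0.
Qed.

Lemma bcs_cst0 : bcs (fun=> 0).
Proof.
split; first exact: measurable_cst.
by exists 0 => z; rewrite normr0.
Qed.

Lemma bcs_le f g (C : R) : measurable_fun setT f -> bcs g ->
  (forall z, `|f z| <= C * `|g z|) -> bcs f.
Proof.
move=> mf bg fg; split => //; have [M [M0 gM]] := bcs_bound bg.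
exists (M + `|C| * M) => z; have [g1 g2] := gM z.
have C0 := normr_ge0 C; split.
  apply: le_trans (fg z) _.
  apply: (le_trans (ler_wpM2r (normr_ge0 _) (ler_norm C))).
  apply: (le_trans (ler_wpM2l C0 g1)); lra.
move=> Mz; apply/eqP; rewrite -normr_eq0 eq_le normr_ge0 andbT.
by apply: (le_trans (fg z)); rewrite g2 ?normr0 ?mulr0//; apply: le_lt_trans Mz; nra.
Qed.

Lemma bcsD f g : bcs f -> bcs g -> bcs (fun z => f z + g z).
Proof.
move=> bf bg; have [M [M0 fM]] := bcs_bound bf; have [N [N0 gN]] := bcs_bound bg.
split; first by apply: measurable_funD; exact: bcs_measurable.
exists (M + N) => z; have [f1 f2] := fM z; have [g1 g2] := gN z; split.
  by apply: (le_trans (ler_normD _ _)); exact: lerD.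
by move=> MNz; rewrite f2 ?g2 ?addr0//; lra.
Qed.

Lemma bcsM_bd f g (C : R) : bcs f -> measurable_fun setT g ->
  (forall z, `|g z| <= C) -> bcs (fun z => f z * g z).
Proof.
move=> bf mg gC; apply: (@bcs_le _ f C) => //.
  by apply: measurable_funM => //; exact: bcs_measurable.
by move=> z; rewrite normrM mulrC ler_wpM2r.
Qed.

Lemma bcs_mul f g : bcs f -> bcs g -> bcs (fun z => f z * g z).
Proof.
move=> bf bg; have [M [_ gM]] := bcs_bound bg.
by apply: (@bcsM_bd _ _ M bf (bcs_measurable bg)) => z; case: (gM z).
Qed.

Lemma bcsZ c f : bcs f -> bcs (fun z => c * f z).
Proof.
move=> bf; apply: (@bcs_le _ f `|c|) => //.
  by apply: measurable_funM; [exact: measurable_cst|exact: bcs_measurable].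
by move=> z; rewrite normrM.
Qed.

Lemma bcsN f : bcs f -> bcs (fun z => - f z).
Proof.
move=> bf; apply: (@bcs_le _ f 1) => //.
  by apply: measurable_funN; exact: bcs_measurable.
by move=> z; rewrite normrN mul1r.
Qed.

Lemma bcsB f g : bcs f -> bcs g -> bcs (fun z => f z - g z).
Proof. by move=> bf bg; apply: bcsD => //; exact: bcsN. Qed.

Lemma bcs_norm f : bcs f -> bcs (fun z => `|f z|).
Proof.
move=> bf; apply: (@bcs_le _ f 1) => //.
  by apply: measurableT_comp => //; exact: bcs_measurable.
by move=> z; rewrite normr_id mul1r.
Qed.

Lemma bcs_sum (I : Type) (s : seq I) (F : I -> plane R -> R) :
  (forall i, bcs (F i)) -> bcs (fun z => \sum_(i <- s) F i z).
Proof.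
move=> bF; elim: s => [|i s ih].
  by under eq_fun do rewrite big_nil; exact: bcs_cst0.
by under eq_fun do rewrite big_cons; exact: bcsD.
Qed.

Lemma bcs_refl f (a : plane R) : bcs f -> bcs (fun z => f ((a : R * R) - z)).
Proof.
move=> bf; have [M [M0 fM]] := bcs_bound bf.
split.
  apply: (measurableT_comp (bcs_measurable bf)).
  by apply: measurable_sub => //; exact: measurable_cst.
exists (M + en a) => z; have [f1 f2] := fM ((a : R * R) - z); split.
  by apply: le_trans f1 _; rewrite lerDl en_ge0.
by move=> Maz; apply: f2; rewrite enB; have := en_subl z a; lra.
Qed.

Lemma bcs_opp f : bcs f -> bcs (fun z => f (- (z : R * R))).
Proof. by move=> /(bcs_refl 0); under eq_fun do rewrite sub0r. Qed.

Lemma bcs_shift f (a : plane R) : bcs f -> bcs (fun z => f ((z : R * R) - a)).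
Proof.
by move=> /bcs_opp/(bcs_refl a); under eq_fun do rewrite opprB.
Qed.

Lemma IntD f g : Ig f -> Ig g -> Int (fun z => f z + g z) = Int f + Int g.
Proof. by move=> *; rewrite unlock; exact: RintegralD. Qed.

Lemma IntB f g : Ig f -> Ig g -> Int (fun z => f z - g z) = Int f - Int g.
Proof. by move=> *; rewrite unlock; exact: RintegralB. Qed.

Lemma IntZ c f : Ig f -> Int (fun z => c * f z) = c * Int f.
Proof. by move=> *; rewrite unlock; exact: RintegralZl. Qed.

Lemma IntZr c f : Ig f -> Int (fun z => f z * c) = Int f * c.
Proof. by move=> *; rewrite unlock; exact: RintegralZr. Qed.

Lemma IntN f : Ig f -> Int (fun z => - f z) = - Int f.
Proof.
move=> If; rewrite -mulN1r -IntZ//; congr Int; apply/funext => z.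
by rewrite mulN1r.
Qed.

Lemma Int_le f g : Ig f -> Ig g -> (forall z, f z <= g z) -> Int f <= Int g.
Proof. by move=> If Ig' fg; rewrite unlock; apply: le_Rintegral => // z _; exact: fg. Qed.

Lemma Int_ge0 f : (forall z, 0 <= f z) -> 0 <= Int f.
Proof. by move=> f0; rewrite unlock; apply: Rintegral_ge0 => z _; exact: f0. Qed.

Lemma Int_abs f : Ig f -> `|Int f| <= Int (fun z => `|f z|).
Proof. by move=> If; rewrite unlock; exact: le_normr_Rintegral. Qed.

Lemma Int0 : Int (fun=> 0) = 0 :> R.
Proof. by rewrite unlock Rintegral_cst// mul0r. Qed.

Lemma Int_sum (I : Type) (s : seq I) (F : I -> plane R -> R) :
  (forall i, bcs (F i)) ->
  Int (fun z => \sum_(i <- s) F i z) = \sum_(i <- s) Int (F i).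
Proof.
move=> bF; elim: s => [|i s ih].
  by under eq_fun do rewrite big_nil; rewrite big_nil Int0.
under eq_fun do rewrite big_cons.
by rewrite big_cons IntD ?ih//; apply: bcs_Ig => //; exact: bcs_sum.
Qed.

Lemma Int_area_preserving phi f : area_preserving phi -> measurable_fun setT f ->
  Int (fun z => f (phi z)) = Int f.
Proof.
move=> ap mf; rewrite unlock /Rintegral; congr fine.
by apply: (@integral_area_preserving _ _ (EFin \o f)) => //; exact/measurable_EFinP.
Qed.

Lemma area_preserving_refl (a : plane R) : area_preserving (fun z => (a : R * R) - z).
Proof.
have := area_preserving_comp (area_preserving_add a) (@area_preserving_opp R).
by congr area_preserving; apply/funext => z /=; rewrite addrC.
Qed.

Lemma Int_refl (a : plane R) f : measurable_fun setT f ->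
  Int (fun z => f ((a : R * R) - z)) = Int f.
Proof. by move=> mf; rewrite (Int_area_preserving (area_preserving_refl a)). Qed.

Lemma Int_shift (a : plane R) f : measurable_fun setT f ->
  Int (fun z => f ((z : R * R) - a)) = Int f.
Proof. by move=> mf; rewrite (Int_area_preserving (area_preserving_add (- (a : R * R)))). Qed.

Lemma Int_bcsM_le M f : measurable_fun setT f -> bcsM M f ->
  `|Int f| <= M * (2 * M) ^+ 2.
Proof.
move=> mf fM; have M0 := bcsM_ge0 fM.
have bf : bcs f by split => //; exists M.
apply: le_trans (Int_abs (bcs_Ig bf)) _.
have -> : M * (2 * M) ^+ 2 = Int (fun z => \1_(sq (0 : plane R) M) z * M).
  rewrite unlock [RHS](_ : _ = Rintegral (area R) (sq 0 M) (fun=> M)).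
    rewrite Rintegral_cst; last exact: measurable_sq.
    by congr (_ * _); exact: (congr1 fine (esym (area_sq 0 M0))).
  rewrite [RHS]Rintegral_mkcond; congr Rintegral; apply/funext => z.
  by rewrite /patch indicE; case: (_ \in _); rewrite ?mul1r ?mul0r.
apply: Int_le; first exact/bcs_Ig/bcs_norm.
  apply: (@integrable_bounded_support _ (sq 0 M) M).
  - apply: measurable_funM; [apply: measurable_indic; exact: measurable_sq|exact: measurable_cst].
  - exact: measurable_sq.
  - by rewrite area_sq// ltry.
  - move=> z; rewrite /= indicE; case: (_ \in _); rewrite ?mul1r ?mul0r ?normr0//.
    by rewrite ger0_norm.
  - by move=> z zM /=; rewrite indicE memNset// mul0r.
move=> z /=; have [f1 f2] := fM z.
rewrite indicE; case: (boolP (z \in _)) => zM; rewrite ?mul1r// mul0r.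
move: zM; rewrite notin_setE => zM.
rewrite f2 ?normr0// ltNge; apply/negP => h; apply: zM.
by apply: en_sq; rewrite subr0.
Qed.

End bcs.

(* [area R] lacks a canonical sigma-finite structure, which Fubini requires:
   the canonical instances of the library cover products of probabilities. *)
Definition sarea (R : realType) : set (plane R) -> \bar R := area R.

Section sigma_finite_area.
Context {R : realType}.

HB.instance Definition _ := Measure.on (@sarea R).

Let sarea_sigma_finite : sigma_finite setT (@sarea R).
Proof.
exists (fun n => sq (0 : plane R) n%:R).
  apply/esym; rewrite -subTset => z _; exists (Num.bound (en z)) => //.
  by apply: en_sq; rewrite subr0 ltW// archi_boundP// en_ge0.
move=> n; split; first exact: measurable_sq.
by rewrite /sarea area_sq ?ler0n// ltry.
Qed.

HB.instance Definition _ := Measure_isSigmaFinite.Build _ _ _ (@sarea R) sarea_sigma_finite.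

End sigma_finite_area.

(** * Fubini for bounded functions of bounded support *)

Section fubini.
Context {R : realType}.
Notation Ig f := ((area R).-integrable setT (EFin \o f)).

(** Tonelli gives the measurability for the positive and the negative part; [fine] sends the points
    where their difference is infinite to [0]. *)
Lemma measurable_Int_param d (T : measurableType d) (F : T -> plane R -> R) :
  measurable_fun setT (fun p : T * plane R => F p.1 p.2) ->
  measurable_fun setT (fun z => Int (F z)).
Proof.
move=> mF; rewrite unlock /Rintegral.
apply: (measurableT_comp (@fine_measurable R setT measurableT)).
have mE : measurable_fun setT (fun p : T * plane R => (F p.1 p.2)%:E).
  exact/measurable_EFinP.
pose G := fun p : T * plane R => (F p.1 p.2)%:E.
have -> : (fun z => \int[area R]_w (F z w)%:E)%E =
    (fubini_F (area R) G^\+ \- fubini_F (area R) G^\-)%E.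
  apply/funext => z; rewrite integralE; congr (_ - _)%E.
    by apply: eq_integral => w _; rewrite !funeposE.
  by apply: eq_integral => w _; rewrite !funenegE.
apply: emeasurable_funB.
  apply: (@measurable_fun_fubini_tonelli_F _ _ _ _ R (@sarea R) G^\+%E) => [|p];
    last exact: funepos_ge0.
  exact: measurable_funepos.
apply: (@measurable_fun_fubini_tonelli_F _ _ _ _ R (@sarea R) G^\-%E) => [|p];
  last exact: funeneg_ge0.
exact: measurable_funeneg.
Qed.

(** The two-variable analogue of [bcs]. The support lies in a product of two squares, so [F] is
    integrable for the product measure and Fubini applies. *)
Definition bcs2 (F : plane R -> plane R -> R) :=
  measurable_fun setT (fun p : plane R * plane R => F p.1 p.2) /\
  exists M, forall z w, `|F z w| <= M /\ (M < en z -> F z w = 0) /\ (M < en w -> F z w = 0).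

Lemma bcs2_swap F : bcs2 F -> bcs2 (fun z w => F w z).
Proof.
move=> [mF [M FM]]; split.
  have := measurableT_comp mF (@measurable_swap _ _ (plane R) (plane R)).
  by [].
by exists M => z w; have [? []] := FM w z.
Qed.

Lemma bcs2_bcs F z : bcs2 F -> bcs (F z).
Proof.
move=> [mF [M FM]]; split.
  by apply: (@measurable_fun_pair2 _ _ _ _ _ _ _ z) mF.
by exists M => w; have [? []] := FM z w.
Qed.

Lemma bcs2_Int F : bcs2 F -> bcs (fun z => Int (F z)).
Proof.
move=> bF; have [mF [M FM]] := bF; split; first exact: measurable_Int_param.
exists (`|M| + M * (2 * M) ^+ 2) => z; split.
  apply: (le_trans (@Int_bcsM_le _ M _ _ _)).
  - by case: (bcs2_bcs z bF).
  - by move=> w; have [? []] := FM z w.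
  - by rewrite lerDr.
have M0 : 0 <= M by apply: le_trans (FM 0 0).1.
move=> Mz; rewrite (_ : F z = fun=> 0); first by rewrite Int0.
apply/funext => w; apply: (FM z w).2.1; apply: le_lt_trans Mz.
by rewrite ger0_norm// lerDl mulr_ge0// sqr_ge0.
Qed.

Lemma Int_fubini F : bcs2 F ->
  Int (fun z => Int (F z)) = Int (fun w => Int (fun z => F z w)).
Proof.
move=> bF; have bF' := bcs2_swap bF; have [mF [M FM]] := bF.
have M0 : 0 <= M by apply: le_trans (FM 0 0).1.
have mE : measurable_fun setT (fun p : plane R * plane R => (F p.1 p.2)%:E).
  exact/measurable_EFinP.
have iF : (@sarea R \x @sarea R)%E.-integrable setT (fun p : plane R * plane R => (F p.1 p.2)%:E).
  pose A := sq (0 : plane R) M; have mA : measurable A := measurable_sq _ _.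
  have mAA : measurable (A `*` A) by exact: measurableX.
  have -> : (fun p : plane R * plane R => (F p.1 p.2)%:E) =
            (EFin \o (fun p : plane R * plane R => F p.1 p.2)) \_ (A `*` A).
    apply/funext => -[z w]; rewrite /patch; case: ifPn => //.
    rewrite notin_setE => /= zw; have [_ [Fz Fw]] := FM z w.
    have [Mz|zM] := ltP M (en z); first by rewrite Fz.
    have [Mw|wM] := ltP M (en w); first by rewrite Fw.
    by exfalso; apply: zw; split; apply: en_sq; rewrite subr0.
  apply/(integrable_mkcond _ mAA); apply: measurable_bounded_integrable => //.
  - have AE : @sarea R A = ((2 * M) ^+ 2)%:E by exact: area_sq.
    have E := etrans (product_measure1E (@sarea R) (@sarea R) mA mA) (congr2 *%E AE AE).
    by apply: (eq_ind_r (fun x => (x < +oo)%E) _ E); rewrite -EFinM ltry.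
  - exact: measurable_funS mF.
  - exists M; split; first exact: num_real.
    by move=> x Mx -[z w] _; apply: le_trans (ltW Mx); case: (FM z w).
have fin1 (G : plane R -> plane R -> R) z : bcs2 G ->
    ((Int (G z))%:E = \int[area R]_w (G z w)%:E)%E.
  move=> bG; rewrite unlock /Rintegral fineK//.
  by apply: integrable_fin_num => //; exact/bcs_Ig/bcs2_bcs.
have := Fubini iF => /= E.
rewrite [in LHS]Int.unlock [in RHS]Int.unlock /Rintegral; congr fine.
transitivity (\int[area R]_x \int[area R]_y (F x y)%:E)%E.
  by apply: eq_integral => z _; rewrite -(fin1 F)// Int.unlock.
rewrite E; apply: eq_integral => z _.
by rewrite -(fin1 (fun z w => F w z))// Int.unlock.
Qed.

End fubini.

(** * Convolutions *)

Section dot_product.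
Context {R : realType}.
Implicit Types (f g h : plane R -> R).
Notation Ig f := ((area R).-integrable setT (EFin \o f)).

Definition dot f g : R := Int (fun z => f z * g z).
Definition nrm2 f : R := Num.sqrt (dot f f).
Definition nrm1 f : R := Int (fun z => `|f z|).

Lemma dotC f g : dot f g = dot g f.
Proof. by congr Int; apply/funext => z; rewrite mulrC. Qed.

Lemma dot_ge0 f : 0 <= dot f f.
Proof. by apply: Int_ge0 => z; rewrite -expr2 sqr_ge0. Qed.

Lemma nrm2_ge0 f : 0 <= nrm2 f. Proof. exact: sqrtr_ge0. Qed.

Lemma nrm1_ge0 f : 0 <= nrm1 f. Proof. exact: Int_ge0. Qed.

Lemma sqr_nrm2 f : nrm2 f ^+ 2 = dot f f.
Proof. by rewrite sqr_sqrtr// dot_ge0. Qed.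

Lemma dotDl f g h : bcs f -> bcs g -> bcs h ->
  dot (fun z => f z + g z) h = dot f h + dot g h.
Proof.
move=> bf bg bh; rewrite -IntD; [|by apply: bcs_Ig; exact: bcs_mul..].
by congr Int; apply/funext => z; rewrite mulrDl.
Qed.

Lemma dotZl c f g : bcs f -> bcs g -> dot (fun z => c * f z) g = c * dot f g.
Proof.
move=> bf bg; rewrite -IntZ; last by apply: bcs_Ig; exact: bcs_mul.
by congr Int; apply/funext => z; rewrite mulrA.
Qed.

Lemma dotDr f g h : bcs f -> bcs g -> bcs h ->
  dot h (fun z => f z + g z) = dot h f + dot h g.
Proof. by move=> *; rewrite dotC dotDl// dotC (dotC g). Qed.

Lemma dotZr c f g : bcs f -> bcs g -> dot g (fun z => c * f z) = c * dot g f.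
Proof. by move=> *; rewrite dotC dotZl// dotC. Qed.

Lemma dot_suml (I : Type) (s : seq I) (F : I -> plane R -> R) h :
  (forall i, bcs (F i)) -> bcs h ->
  dot (fun z => \sum_(i <- s) F i z) h = \sum_(i <- s) dot (F i) h.
Proof.
move=> bF bh; rewrite -Int_sum; last by move=> i; exact: bcs_mul.
by congr Int; apply/funext => z; rewrite mulr_suml.
Qed.

Lemma dot_sumr (I : Type) (s : seq I) (F : I -> plane R -> R) h :
  (forall i, bcs (F i)) -> bcs h ->
  dot h (fun z => \sum_(i <- s) F i z) = \sum_(i <- s) dot h (F i).
Proof.
move=> bF bh; rewrite dotC dot_suml//; apply: eq_bigr => i _; exact: dotC.
Qed.

Lemma dot_CS f g : bcs f -> bcs g -> `|dot f g| <= nrm2 f * nrm2 g.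
Proof.
move=> bf bg.
have quad t : 0 <= dot f f + 2 * t * dot f g + t ^+ 2 * dot g g.
  have btg := bcsZ t bg.
  have := dot_ge0 (fun z => f z + t * g z).
  rewrite dotDl ?dotDr ?dotZl ?dotZr ?(dotC g)//; last exact: bcsD.
  by congr (_ <= _); ring.
rewrite -(@ler_pXn2r _ 2)// ?nnegrE ?mulr_ge0 ?nrm2_ge0//.
rewrite exprMn !sqr_nrm2 real_normK ?num_real//.
have a0 := dot_ge0 f; have c0 := dot_ge0 g.
move: (dot f f) (dot g g) (dot f g) quad a0 c0 => a c b quad a0 c0.
have [cz|cn] := eqVneq c 0.
  have [->|bn] := eqVneq b 0; first by rewrite expr0n/= mulr_ge0.
  (* With [c = 0] the polynomial is affine in [t], and it would take the value [-1] at this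
     point. *)
  have := quad (- (a + 1) / (2 * b)); rewrite cz mulr0 addr0.
  have -> : 2 * (- (a + 1) / (2 * b)) * b = - (a + 1) by field.
  lra.
have cp : 0 < c by rewrite lt_def cn.
have := quad (- b / c).
have -> : a + 2 * (- b / c) * b + (- b / c) ^+ 2 * c = (a * c - b ^+ 2) / c by field.
by rewrite pmulr_lge0 ?invr_gt0// subr_ge0.
Qed.

Lemma dot_le f g : bcs f -> bcs g -> dot f g <= nrm2 f * nrm2 g.
Proof. by move=> bf bg; apply: le_trans (ler_norm _) (dot_CS bf bg). Qed.

Lemma nrm2D f g : bcs f -> bcs g -> nrm2 (fun z => f z + g z) <= nrm2 f + nrm2 g.
Proof.
move=> bf bg.
rewrite -(@ler_pXn2r _ 2)// ?nnegrE ?addr_ge0 ?nrm2_ge0//.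
rewrite sqrrD !sqr_nrm2 dotDl ?dotDr//; last exact: bcsD.
by have := dot_le bf bg; rewrite (dotC g f); lra.
Qed.

End dot_product.

Section convolution.
Context {R : realType}.
Implicit Types (f g h k : plane R -> R).
Notation Ig f := ((area R).-integrable setT (EFin \o f)).

Definition cv k g (z : plane R) : R := Int (fun w => k ((z : R * R) - w) * g w).
(** Convolution with the reflected kernel is the adjoint of convolution with [f], see [dot_cv]. *)
Definition rf f (z : plane R) : R := f (- (z : R * R)).

Definition bdd f := measurable_fun setT f /\ exists M, forall z, `|f z| <= M.

Lemma bcs_bdd f : bcs f -> bdd f.
Proof.
move=> bf; have [M [_ fM]] := bcs_bound bf; split; first exact: bcs_measurable.
by exists M => z; case: (fM z).
Qed.

Lemma bdd_rf f : bdd f -> bdd (rf f).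
Proof.
move=> [mf [M fM]]; split; last by exists M => z; exact: fM.
by apply: (measurableT_comp mf); exact: measurable_opp.
Qed.

Lemma rfK f : rf (rf f) = f.
Proof. by apply/funext => z; rewrite /rf opprK. Qed.

Lemma measurable_sub_comp f : measurable_fun setT f ->
  measurable_fun setT (fun p : plane R * plane R => f ((p.1 : R * R) - p.2)).
Proof. by move=> mf; apply: (measurableT_comp mf); exact: measurable_sub. Qed.

Lemma bdd_mul_bcs f g : bdd f -> bcs g -> bcs (fun z => f z * g z).
Proof.
move=> [mf [M fM]] bg; have := bcsM_bd bg mf fM.
by under eq_fun do rewrite mulrC.
Qed.

Lemma bdd_shift f (a : plane R) : bdd f -> bdd (fun w => f ((a : R * R) - w)).
Proof.
move=> [mf [M fM]]; split; last by exists M => w; exact: fM.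
by apply: (measurableT_comp mf); apply: measurable_sub => //; exact: measurable_cst.
Qed.

Lemma cv_Ig k g z : bdd k -> bcs g -> Ig (fun w => k ((z : R * R) - w) * g w).
Proof. by move=> bk bg; apply/bcs_Ig/bdd_mul_bcs => //; exact: bdd_shift. Qed.

Lemma cvC k g z : measurable_fun setT k -> measurable_fun setT g -> cv k g z = cv g k z.
Proof.
move=> mk mg; rewrite /cv.
rewrite -(@Int_refl _ z (fun w => k ((z : R * R) - w) * g w)).
  by congr Int; apply/funext => w; rewrite subKr mulrC.
apply: measurable_funM => //; apply: (measurableT_comp mk).
by apply: measurable_sub => //; exact: measurable_cst.
Qed.

Lemma measurable_cv k g : measurable_fun setT k -> measurable_fun setT g ->
  measurable_fun setT (cv k g).
Proof.
move=> mk mg; apply: (@measurable_Int_param _ _ _ (fun z w => k ((z : R * R) - w) * g w)).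
apply: measurable_funM; first exact: measurable_sub_comp.
exact: (measurableT_comp mg measurable_snd).
Qed.

Lemma bdd_cv k g : bdd k -> bcs g -> bdd (cv k g).
Proof.
move=> bk bg; split; first by apply: measurable_cv; [case: bk|exact: bcs_measurable].
have [mk [M kM]] := bk.
exists (M * nrm1 g) => z.
apply: (le_trans (Int_abs (cv_Ig z bk bg))).
rewrite -IntZ; last exact/bcs_Ig/bcs_norm.
apply: Int_le => [||w].
- by apply/bcs_Ig/bcs_norm/bdd_mul_bcs => //; exact: bdd_shift.
- exact/bcs_Ig/bcsZ/bcs_norm.
- by rewrite normrM ler_wpM2r.
Qed.

Lemma bcs_cv f g : bcs f -> bcs g -> bcs (cv f g).
Proof.
move=> bf bg; split; first by case: (bdd_cv (bcs_bdd bf) bg).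
have [M0 fM0] := (bdd_cv (bcs_bdd bf) bg).2.
have [M [_ fM]] := bcs_bound bf; have [N [_ gN]] := bcs_bound bg.
exists (`|M0| + `|M| + `|N|) => z; split.
  by apply: (le_trans (fM0 z)); have := ler_norm M0; have := normr_ge0 M;
     have := normr_ge0 N; lra.
move=> MNz; rewrite /cv (_ : (fun w => _) = fun=> 0).
  by rewrite Int0.
apply/funext => w; have [Nw|wN] := ltP N (en w); first by rewrite (gN w).2// mulr0.
rewrite (fM _).2 ?mul0r//.
by have := en_subl z w; have := normr_ge0 M0; have := ler_norm N; have := ler_norm M; lra.
Qed.

Lemma cvDl f g h z : bdd f -> bdd g -> bcs h ->
  cv (fun w => f w + g w) h z = cv f h z + cv g h z.
Proof.
move=> bf bg bh; rewrite -IntD; [|exact: cv_Ig..].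
by congr Int; apply/funext => w; rewrite mulrDl.
Qed.

Lemma cvBl f g h z : bdd f -> bdd g -> bcs h ->
  cv (fun w => f w - g w) h z = cv f h z - cv g h z.
Proof.
move=> bf bg bh; rewrite -IntB; [|exact: cv_Ig..].
by congr Int; apply/funext => w; rewrite mulrBl.
Qed.

Lemma cvDr f g h z : bdd f -> bcs g -> bcs h ->
  cv f (fun w => g w + h w) z = cv f g z + cv f h z.
Proof.
move=> bf bg bh; rewrite -IntD; [|exact: cv_Ig..].
by congr Int; apply/funext => w; rewrite mulrDr.
Qed.

Lemma cv_suml (I : Type) (s : seq I) (F : I -> plane R -> R) h z :
  (forall i, bcs (F i)) -> bcs h ->
  cv (fun w => \sum_(i <- s) F i w) h z = \sum_(i <- s) cv (F i) h z.
Proof.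
move=> bF bh; rewrite -Int_sum.
  by congr Int; apply/funext => w; rewrite mulr_suml.
by move=> i; apply: bdd_mul_bcs => //; apply/bdd_shift/bcs_bdd.
Qed.

Lemma bcs2_cv k g h : bdd k -> bcs g -> bcs h ->
  bcs2 (fun z w => k ((z : R * R) - w) * g w * h z).
Proof.
move=> [mk [M kM]] bg bh; split.
  apply: measurable_funM; first apply: measurable_funM.
  - exact: measurable_sub_comp.
  - exact: (measurableT_comp (bcs_measurable bg) measurable_snd).
  - exact: (measurableT_comp (bcs_measurable bh) measurable_fst).
have [G [G0 gG]] := bcs_bound bg; have [H [H0 hH]] := bcs_bound bh.
have M0 : 0 <= M by apply: le_trans (kM 0).
exists (M * G * H + G + H) => z w; split; [|split].
- rewrite !normrM -addrA; apply: ler_wpDr; first by rewrite addr_ge0// ltW.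
  by apply: ler_pM => //; [apply: ler_pM => //; case: (gG w)|case: (hH z)].
- move=> zz; rewrite (hH z).2 ?mulr0//; apply: le_lt_trans zz.
  by have := mulr_ge0 (mulr_ge0 M0 (ltW G0)) (ltW H0); lra.
- move=> zz; rewrite (gG w).2 ?mulr0 ?mul0r//; apply: le_lt_trans zz.
  by have := mulr_ge0 (mulr_ge0 M0 (ltW G0)) (ltW H0); lra.
Qed.

Lemma dot_cv k g h : bdd k -> bcs g -> bcs h ->
  dot (cv k g) h = dot g (cv (rf k) h).
Proof.
move=> bk bg bh.
transitivity (Int (fun z => Int (fun w => k ((z : R * R) - w) * g w * h z))).
  congr Int; apply/funext => z; rewrite /cv -IntZr//; exact: cv_Ig.
rewrite Int_fubini; last exact: bcs2_cv.
congr Int; apply/funext => w; rewrite /cv -IntZ; last first.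
  by apply: cv_Ig => //; exact: bdd_rf.
by congr Int; apply/funext => z; rewrite /rf opprB; ring.
Qed.

Lemma cvA f g h z : bcs f -> bcs g -> bcs h -> cv f (cv g h) z = cv (cv f g) h z.
Proof.
move=> bf bg bh.
pose F (w v : plane R) : R := g ((w : R * R) - v) * h v * f ((z : R * R) - w).
have bF : bcs2 F by apply: bcs2_cv => //; [exact: bcs_bdd|exact: bcs_refl].
transitivity (Int (fun w => Int (F w))).
  congr Int; apply/funext => w; rewrite mulrC /cv -IntZr//.
  by apply: cv_Ig => //; exact: bcs_bdd.
rewrite Int_fubini//.
congr Int; apply/funext => v; rewrite /cv -IntZr; last first.
  by apply: cv_Ig => //; exact: bcs_bdd.
rewrite -(@Int_shift _ v (fun p => f ((z : R * R) - v - p) * g p * h v)).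
  congr Int; apply/funext => w /=.
  have -> : (z : R * R) - v - ((w : R * R) - v) = (z : R * R) - w by rewrite opprB addrA subrK.
  by rewrite /F; ring.
apply: measurable_funM; last exact: measurable_cst.
apply: measurable_funM; last exact: bcs_measurable.
by case: (bdd_shift ((z : R * R) - v) (bcs_bdd bf)).
Qed.

Lemma nrm2_shift (u : plane R -> R) (a : plane R) : bcs u -> nrm2 (fun z => u ((z : R * R) - a)) = nrm2 u.
Proof.
move=> bu; rewrite /nrm2 /dot; congr Num.sqrt.
rewrite (@Int_shift _ a (fun z => u z * u z))//.
by apply: measurable_funM; exact: bcs_measurable.
Qed.

(* [dot (cv f u) v] is the average of the inner products of [v] with the translates of [u]. *)
Lemma dot_cv_young f u v : bcs f -> bcs u -> bcs v ->
  `|dot (cv f u) v| <= nrm1 f * (nrm2 u * nrm2 v).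
Proof.
move=> bf bu bv.
have -> : dot (cv f u) v = Int (fun z => Int (fun y => u ((z : R * R) - y) * f y * v z)).
  congr Int; apply/funext => z; rewrite cvC; try exact: bcs_measurable.
  by rewrite /cv -IntZr//; apply: cv_Ig => //; exact: bcs_bdd.
have b2 : bcs2 (fun z y => u ((z : R * R) - y) * f y * v z) by apply: bcs2_cv => //; exact: bcs_bdd.
rewrite Int_fubini//.
have := bcs2_Int (bcs2_swap b2) => bI.
apply: (le_trans (Int_abs (bcs_Ig bI))).
rewrite -IntZr; last exact/bcs_Ig/bcs_norm.
apply: Int_le => [||y].
- exact/bcs_Ig/bcs_norm.
- rewrite (_ : _ \o _ = EFin \o (fun z => (nrm2 u * nrm2 v) * `|f z|)).
    exact/bcs_Ig/bcsZ/bcs_norm.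
  by apply/funext => z /=; rewrite mulrC.
- have -> : Int (fun z => u ((z : R * R) - y) * f y * v z) =
            f y * dot (fun z => u ((z : R * R) - y)) v.
    rewrite -IntZ; last by apply/bcs_Ig/bcs_mul => //; exact: bcs_shift.
    by congr Int; apply/funext => z; ring.
  rewrite normrM ler_wpM2l// -(nrm2_shift y bu).
  by apply: dot_CS => //; exact: bcs_shift.
Qed.

Lemma nrm2_cv f u : bcs f -> bcs u -> nrm2 (cv f u) <= nrm1 f * nrm2 u.
Proof.
move=> bf bu; have bc := bcs_cv bf bu.
have := dot_cv_young bf bu bc.
rewrite ger0_norm ?dot_ge0// -sqr_nrm2.
have [->|n0] := eqVneq (nrm2 (cv f u)) 0; first by rewrite mulr_ge0 ?nrm1_ge0 ?nrm2_ge0.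
by rewrite expr2 mulrA ler_pM2r// lt_def n0 nrm2_ge0.
Qed.

(** As [f] has mean zero, [g (z - y)] may be replaced by [g (z - y) - g z] in the convolution;
    Fubini then leaves the [L^1] modulus of continuity of [g], over the support of [f] only. This is
    the source of decay between distant scales. *)
Lemma nrm1_cv_le f g (B : R) : bcs f -> bcs g ->
  (forall y, f y != 0 -> Int (fun z => `|g ((z : R * R) - y) - g z|) <= B) ->
  Int f = 0 -> nrm1 (cv f g) <= nrm1 f * B.
Proof.
move=> bf bg gB f0.
have b2 : bcs2 (fun z y => `|f y| * `|g ((z : R * R) - y) - g z|).
  split.
    apply: measurable_funM.
      by apply: measurableT_comp => //; exact: (measurableT_comp (bcs_measurable bf) measurable_snd).
    apply: measurableT_comp => //; apply: measurable_funB.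
      exact: (measurable_sub_comp (bcs_measurable bg)).
    exact: (measurableT_comp (bcs_measurable bg) measurable_fst).
  have [M [M0 fM]] := bcs_bound bf; have [N [N0 gN]] := bcs_bound bg.
  exists (M * (2 * N) + M + N) => z y; split; [|split].
  - rewrite ger0_norm ?mulr_ge0// -addrA; apply: ler_wpDr; first by rewrite addr_ge0// ltW.
    apply: ler_pM => //; first by case: (fM y).
    apply: (le_trans (ler_normB _ _)).
    by have := (gN ((z : R * R) - y)).1; have := (gN z).1; lra.
  - move=> zz; have [My|yM] := ltP M (en y); first by rewrite (fM y).2// normr0 mul0r.
    have := mulr_ge0 (ltW M0) (ltW N0) => MN.
    rewrite (gN z).2 ?(gN ((z : R * R) - y)).2 ?subrr ?normr0 ?mulr0//; last lra.
    by have := en_subl z y; lra.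
  - move=> zz; have := mulr_ge0 (ltW M0) (ltW N0) => MN.
    by rewrite (fM y).2 ?normr0 ?mul0r//; lra.
have bI := bcs2_Int b2.
apply: (@le_trans _ _ (Int (fun z => Int (fun y => `|f y| * `|g ((z : R * R) - y) - g z|)))).
  apply: Int_le; [exact/bcs_Ig/bcs_norm/bcs_cv|exact: bcs_Ig|move=> z].
  have -> : cv f g z = Int (fun y => f y * (g ((z : R * R) - y) - g z)).
    rewrite cvC; try exact: bcs_measurable.
    have -> : cv g f z = cv g f z - Int f * g z by rewrite f0 mul0r subr0.
    rewrite -IntZr; last exact: bcs_Ig.
    rewrite -IntB.
    - by congr Int; apply/funext => y; ring.
    - by apply: cv_Ig => //; exact: bcs_bdd.
    - rewrite (_ : _ \o _ = EFin \o (fun y => g z * f y)); first exact/bcs_Ig/bcsZ.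
      by apply/funext => y /=; rewrite mulrC.
  have bfg : bcs (fun y => f y * (g ((z : R * R) - y) - g z)).
    have [N [N0 gN]] := bcs_bound bg.
    apply: (@bcsM_bd _ _ _ (N + `|g z|)) => //.
      by apply: measurable_funB; [exact: (bcs_measurable (bcs_refl z bg))|exact: measurable_cst].
    move=> y; apply: (le_trans (ler_normB _ _)).
    by apply: lerD; [exact: (gN _).1|exact: lexx].
  apply: (le_trans (Int_abs (bcs_Ig bfg))).
  apply: Int_le => [||y]; [exact/bcs_Ig/bcs_norm|exact: (bcs_Ig (bcs2_bcs z b2))|].
  by rewrite normrM.
rewrite Int_fubini//.
rewrite -IntZr; last exact/bcs_Ig/bcs_norm.
apply: Int_le => [||y].
- exact: (bcs_Ig (bcs2_Int (bcs2_swap b2))).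
- rewrite (_ : _ \o _ = EFin \o (fun z => B * `|f z|)); first exact/bcs_Ig/bcsZ/bcs_norm.
  by apply/funext => z /=; rewrite mulrC.
rewrite IntZ; last by apply/bcs_Ig/bcs_norm/bcsB => //; exact: bcs_shift.
have [->|fy] := eqVneq (f y) 0; first by rewrite normr0 !mul0r.
by rewrite ler_wpM2l// gB.
Qed.

Lemma nrm1_cv f g : bcs f -> bcs g -> nrm1 (cv f g) <= nrm1 f * nrm1 g.
Proof.
move=> bf bg.
have b2 : bcs2 (fun z y => `|g ((z : R * R) - y)| * `|f y|).
  have := bcs2_cv (bcs_bdd bg) bf; move=> H.
  split.
    apply: measurable_funM.
      by apply: measurableT_comp => //; exact: (measurable_sub_comp (bcs_measurable bg)).
    by apply: measurableT_comp => //; exact: (measurableT_comp (bcs_measurable bf) measurable_snd).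
  have [M [M0 fM]] := bcs_bound bf; have [N [N0 gN]] := bcs_bound bg.
  exists (N * M + M + N) => z y; split; [|split].
  - rewrite ger0_norm ?mulr_ge0// -addrA; apply: ler_wpDr; first by rewrite addr_ge0// ltW.
    by apply: ler_pM => //; [exact: (gN _).1|exact: (fM _).1].
  - move=> zz; have [My|yM] := ltP M (en y); first by rewrite (fM y).2// normr0 mulr0.
    have := mulr_ge0 (ltW M0) (ltW N0) => MN.
    by rewrite (gN ((z : R * R) - y)).2 ?normr0 ?mul0r//; have := en_subl z y; lra.
  - move=> zz; have := mulr_ge0 (ltW M0) (ltW N0) => MN.
    by rewrite (fM y).2 ?normr0 ?mulr0//; lra.
have bI := bcs2_Int b2.
apply: (@le_trans _ _ (Int (fun z => Int (fun y => `|g ((z : R * R) - y)| * `|f y|)))).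
  apply: Int_le; [exact/bcs_Ig/bcs_norm/bcs_cv|exact: bcs_Ig|move=> z].
  rewrite cvC; try exact: bcs_measurable.
  apply: (le_trans (Int_abs (cv_Ig z (bcs_bdd bg) bf))).
  apply: Int_le => [||y]; last by rewrite normrM.
    by apply/bcs_Ig/bcs_norm/bdd_mul_bcs => //; exact/bdd_shift/bcs_bdd.
  exact: (bcs_Ig (bcs2_bcs z b2)).
rewrite Int_fubini// -IntZr; last exact/bcs_Ig/bcs_norm.
rewrite le_eqVlt; apply/orP; left; apply/eqP; congr Int; apply/funext => y.
rewrite IntZr; last by apply/bcs_Ig/bcs_norm/bcs_shift.
rewrite mulrC /nrm1 -(@Int_shift _ y (fun z => `|g z|))//.
by apply: measurableT_comp => //; exact: bcs_measurable.
Qed.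

End convolution.

Section unfolding.
Context {R : realType}.
Implicit Types (f g h : plane R -> R).

Lemma bcsI f M : measurable_fun setT f -> bcsM M f -> bcs f.
Proof. by move=> mf fM; split => //; exists M. Qed.

Lemma bddI f M : measurable_fun setT f -> (forall z, `|f z| <= M) -> bdd f.
Proof. by move=> mf fM; split => //; exists M. Qed.

Lemma bdd_measurable f : bdd f -> measurable_fun setT f.
Proof. by case. Qed.

Lemma bdd_bound f : bdd f -> exists M, 0 < M /\ forall z, `|f z| <= M.
Proof.
move=> [_ [M fM]]; exists (M + 1); have M0 : 0 <= M by apply: le_trans (fM 0).
by split => [|z]; [lra|have := fM z; lra].
Qed.

Lemma cvE k g z : cv k g z = Int (fun w : plane R => k ((z : R * R) - w) * g w).
Proof. by []. Qed.

Lemma dotE f g : dot f g = Int (fun z : plane R => f z * g z).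
Proof. by []. Qed.

Lemma nrm1E f : nrm1 f = Int (fun z : plane R => `|f z|).
Proof. by []. Qed.

Lemma nrm2E f : nrm2 f = Num.sqrt (dot f f).
Proof. by []. Qed.

Lemma bcs_rf f : bcs f -> bcs (rf f).
Proof. exact: bcs_opp. Qed.

End unfolding.

(** * Almost orthogonality *)

Section almost_orthogonality.
Context {R : realType}.
Implicit Types (f g h : plane R -> R).

Lemma cvCA f g h : bcs f -> bcs g -> bcs h -> cv f (cv g h) = cv g (cv f h).
Proof.
move=> bf bg bh; apply/funext => z; rewrite !cvA//.
congr (cv _ h z); apply/funext => w; apply: cvC; exact: bcs_measurable.
Qed.

Lemma nrm2_cvA f g h : bcs f -> bcs g -> bcs h ->
  nrm2 (cv f (cv g h)) <= nrm1 (cv f g) * nrm2 h.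
Proof.
move=> bf bg bh; have -> : cv f (cv g h) = cv (cv f g) h.
  by apply/funext => z; exact: cvA.
by apply: nrm2_cv => //; exact: bcs_cv.
Qed.

Lemma dot_cv_rf f g h : bcs f -> bcs g -> bcs h -> dot (cv (rf f) g) h = dot g (cv f h).
Proof.
move=> bf bg bh; rewrite dot_cv//; last exact/bcs_bdd/bcs_rf.
by rewrite rfK.
Qed.

(** Convolutions commute, so a convolution operator commutes with its adjoint, and a normal operator
    and its adjoint have the same norm on each vector. *)
Lemma nrm2_cv_rf f g : bcs f -> bcs g -> nrm2 (cv (rf f) g) = nrm2 (cv f g).
Proof.
move=> bf bg; have brf := bcs_rf bf; have bc := bcs_cv bf bg; have brc := bcs_cv brf bg.
rewrite !nrm2E; congr Num.sqrt.
by rewrite dot_cv_rf// cvCA// [RHS]dot_cv//; exact: bcs_bdd.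
Qed.

Variables (n : nat) (k : 'I_n -> plane R -> R) (u : 'I_n -> 'I_n -> R).
Hypothesis bk : forall i, bcs (k i).
Hypothesis u0 : forall i j, 0 <= u i j.
Hypothesis uC : forall i j, u i j = u j i.
Hypothesis ku : forall i j, nrm1 (cv (k i) (k j)) <= u i j.
Hypothesis kru : forall i j, nrm1 (cv (k i) (rf (k j))) <= u i j.

Let q g i := nrm2 (cv (k i) g).

Let brk i : bcs (rf (k i)). Proof. exact: bcs_rf. Qed.

(** With [T_i] the convolution by [k i], the left side [X] is the inner product of [g] with [G], the
    sum of [T_i' T_i g]. Schur's test with the weights [u] gives [|G|^2 <= S X], and Cauchy-Schwarz
    gives [X^2 <= |g|^2 S X]. *)
Lemma TTstar (S : R) g : bcs g -> 0 <= S -> (forall i, \sum_j u i j <= S) ->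
  \sum_i q g i ^+ 2 <= S * dot g g.
Proof.
move=> bg S0 uS.
pose w i := cv (k i) g.
have bw i : bcs (w i) by exact: bcs_cv.
pose G (z : plane R) := \sum_i cv (rf (k i)) (w i) z.
have bG : bcs G by apply: bcs_sum => i; exact: bcs_cv.
set X := \sum_i _.
have X0 : 0 <= X by apply: sumr_ge0 => i _; exact: sqr_ge0.
have XG : X = dot g G.
  rewrite dot_sumr//; last by move=> i; exact: bcs_cv.
  by apply: eq_bigr => i _; rewrite /q sqr_nrm2 (dot_cv (bcs_bdd (bk i)) bg (bw i)).
have GS : dot G G <= S * X.
  rewrite dot_suml//; last by move=> i; exact: bcs_cv.
  have st i j : dot (cv (rf (k i)) (w i)) (cv (rf (k j)) (w j)) <=
      u i j * ((q g i ^+ 2 + q g j ^+ 2) / 2).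
    rewrite dotC dot_cv_rf//; last exact: bcs_cv.
    have bc := bcs_cv (brk i) (bw i).
    apply: (le_trans (dot_le (bw j) (bcs_cv (bk j) bc))).
    have H := nrm2_cvA (bk j) (brk i) (bw i).
    apply: (le_trans (ler_wpM2l (nrm2_ge0 _) H)).
    have H2 : nrm1 (cv (k j) (rf (k i))) <= u i j by rewrite uC.
    rewrite mulrCA.
    apply: (@le_trans _ _ (u i j * (nrm2 (w j) * nrm2 (w i)))).
      by apply: ler_wpM2r => //; rewrite mulr_ge0// nrm2_ge0.
    apply: ler_wpM2l => //.
    rewrite /q -/(w i) -/(w j); have := sqr_ge0 (nrm2 (w i) - nrm2 (w j)).
    rewrite sqrrB; lra.
  apply: (@le_trans _ _ (\sum_i \sum_j u i j * ((q g i ^+ 2 + q g j ^+ 2) / 2))).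
    apply: ler_sum => i _; rewrite dot_sumr//.
    - by apply: ler_sum => j _.
    - by move=> j; exact: bcs_cv.
    - exact: bcs_cv.
  have E1 : \sum_i \sum_j u i j * q g i ^+ 2 <= S * X.
    rewrite mulr_sumr; apply: ler_sum => i _.
    by rewrite -mulr_suml ler_wpM2r// sqr_ge0.
  have E2 : \sum_i \sum_j u i j * q g j ^+ 2 <= S * X.
    rewrite exchange_big/= mulr_sumr; apply: ler_sum => i _.
    rewrite -mulr_suml ler_wpM2r// ?sqr_ge0//.
    by under eq_bigr do rewrite uC.
  have -> : \sum_i \sum_j u i j * ((q g i ^+ 2 + q g j ^+ 2) / 2) =
    (\sum_i \sum_j u i j * q g i ^+ 2 + \sum_i \sum_j u i j * q g j ^+ 2) / 2.
    rewrite -big_split/= mulr_suml; apply: eq_bigr => i _.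
    by rewrite -big_split/= mulr_suml; apply: eq_bigr => j _; rewrite -mulrDr mulrA.
  lra.
have [->|Xn] := eqVneq X 0; first by rewrite mulr_ge0 ?dot_ge0.
have Xp : 0 < X by rewrite lt_def Xn.
have := dot_CS bg bG; rewrite -XG ger0_norm//.
rewrite -(@ler_pXn2r _ 2)// ?nnegrE ?mulr_ge0 ?nrm2_ge0// exprMn !sqr_nrm2 => XX.
have : X ^+ 2 <= dot g g * (S * X) by apply: le_trans XX _; rewrite ler_wpM2l// dot_ge0.
by rewrite expr2 mulrA ler_pM2r// mulrC.
Qed.

(** Stands for the geometric mean of three estimates without cube roots: [x] is at most the cube of
    the least of [a], [b], [c], and this cube is at most their product. *)
Lemma cube_min (x a b c : R) : 0 <= a -> 0 <= b -> 0 <= c ->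
  x <= a ^+ 3 -> x <= b ^+ 3 -> x <= c ^+ 3 -> x <= a * b * c.
Proof.
move=> a0 b0 c0 xa xb xc.
have [x0|x0] := leP x 0; first by apply: (le_trans x0); rewrite !mulr_ge0.
have H m : 0 <= m -> m <= a -> m <= b -> m <= c -> x <= m ^+ 3 -> x <= a * b * c.
  move=> m0 ma mb mc /le_trans; apply; rewrite exprSr expr2.
  by apply: ler_pM => //; [rewrite mulr_ge0|apply: ler_pM].
have [ab|ab] := leP a b; have [ac|ac] := leP a c; have [bc|bc] := leP b c;
  first [exact: (H a)|exact: (H b)|exact: (H c)|apply: (H b) => //; lra|apply: (H c) => //; lra|apply: (H a) => //; lra].
Qed.

(** Since all the convolutions commute, the factor with index [i] can be brought next to the one
    with index [j], [l] or [m] in turn; the two remaining factors act on [g], one on each side of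
    the inner product. *)
Let four i j l m g : bcs g ->
  let t := dot (cv (rf (k i)) (cv (k j) g)) (cv (rf (k l)) (cv (k m) g)) in
  [/\ t <= u i j * (q g l * q g m), t <= u i l * (q g j * q g m) & t <= u i m * (q g j * q g l)].
Proof.
move=> bg t.
have bj a : bcs (cv (k a) g) by exact: bcs_cv.
have brj a : bcs (cv (rf (k a)) g) by exact: bcs_cv.
have bb a b : bcs (cv (rf (k a)) (cv (k b) g)) by exact: bcs_cv.
have tE : t = dot (cv (k j) g) (cv (k i) (cv (rf (k l)) (cv (k m) g))) by exact: dot_cv_rf.
have q0 a : 0 <= q g a by exact: nrm2_ge0.
split.
- rewrite /t dotC dot_cv_rf//.
  apply: (le_trans (dot_le (bj m) (bcs_cv (bk l) (bb i j)))).
  rewrite -/(q g m) mulrC [leRHS]mulrA ler_wpM2r//.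
  rewrite (cvCA (bk l) (brk i) (bj j)) (cvCA (bk l) (bk j) bg).
  apply: (le_trans (nrm2_cvA (brk i) (bk j) (bj l))); rewrite -/(q g l) ler_wpM2r//.
  suff -> : cv (rf (k i)) (k j) = cv (k j) (rf (k i)) by rewrite uC.
  by apply/funext => z; apply: cvC; exact: bcs_measurable.
- rewrite tE; apply: (le_trans (dot_le (bj j) (bcs_cv (bk i) (bb l m)))).
  rewrite -/(q g j) mulrCA ler_wpM2l//.
  by apply: (le_trans (nrm2_cvA (bk i) (brk l) (bj m))); rewrite -/(q g m) ler_wpM2r.
- rewrite tE; apply: (le_trans (dot_le (bj j) (bcs_cv (bk i) (bb l m)))).
  rewrite -/(q g j) mulrCA ler_wpM2l//.
  rewrite (cvCA (brk l) (bk m) bg).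
  apply: (le_trans (nrm2_cvA (bk i) (bk m) (brj l))).
  by rewrite nrm2_cv_rf// -/(q g l) ler_wpM2r.
Qed.

(* Four-fold expansion of [|Tg|^4 <= |g|^2 |T'Tg|^2]: each term carries three different pairs
   of almost orthogonal factors and is bounded by the geometric mean of the three estimates. *)
Lemma cotlar_stein (B V : R) (v : 'I_n -> 'I_n -> R) g : bcs g -> 0 <= B -> 0 <= V ->
  (forall i j, 0 <= v i j <= 1) -> (forall i j, v i j = v j i) ->
  (forall i j, u i j <= B * v i j ^+ 3) -> (forall i, \sum_j v i j <= V) ->
  dot (fun z => \sum_i cv (k i) g z) (fun z => \sum_i cv (k i) g z) <=
  2 * B * V ^+ 2 * dot g g.
Proof.
move=> bg B0 V0 v01 vC uv vV.
set Tg := (fun z : plane R => _).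
have v0 i j : 0 <= v i j by case/andP: (v01 i j).
have v1 i j : v i j <= 1 by case/andP: (v01 i j).
have bj a : bcs (cv (k a) g) by exact: bcs_cv.
have bb a b : bcs (cv (rf (k a)) (cv (k b) g)) by exact: bcs_cv.
pose X := \sum_i q g i ^+ 2.
have q0 a : 0 <= q g a by exact: nrm2_ge0.
have XS : X <= B * V * dot g g.
  apply: TTstar => //; first exact: mulr_ge0.
  move=> i; apply: (@le_trans _ _ (B * \sum_j v i j)); last exact: ler_wpM2l.
  rewrite mulr_sumr; apply: ler_sum => j _; apply: (le_trans (uv i j)).
  apply: ler_wpM2l => //; rewrite -[leRHS]expr1; exact: ler_wiXn2l.
pose W (z : plane R) := \sum_i \sum_j cv (rf (k i)) (cv (k j) g) z.
have bWi i : bcs (fun z => \sum_j cv (rf (k i)) (cv (k j) g) z) by exact: bcs_sum.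
have bW : bcs W by exact: bcs_sum.
have bT : bcs Tg by exact: bcs_sum.
have TW : dot Tg Tg = dot g W.
  rewrite dot_suml// dot_sumr//; apply: eq_bigr => i _.
  rewrite !dot_sumr//; apply: eq_bigr => j _.
  by rewrite dot_cv//; exact: bcs_bdd.
(* A sum over four indices. In the three bounds of [four] the product of two norms is at most half
   the sum of their squares, hence at most a common quantity [Q]; [cube_min] then combines the
   bounds. *)
have WW : dot W W <= 3 / 2 * B * V ^+ 3 * X.
  pose F i j l m := dot (cv (rf (k i)) (cv (k j) g)) (cv (rf (k l)) (cv (k m) g)).
  have -> : dot W W = \sum_i \sum_j \sum_l \sum_m F i j l m.
    rewrite dot_suml//; apply: eq_bigr => i _; rewrite dot_suml//; apply: eq_bigr => j _.
    rewrite dot_sumr//; apply: eq_bigr => l _; rewrite dot_sumr//.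
  pose a i := q g i ^+ 2.
  have a0 i : 0 <= a i by exact: sqr_ge0.
  have Fle i j l m : F i j l m <= v i j * v i l * v i m * (a j + a l + a m) * (B / 2).
    have [F1 F2 F3] := four i j l m bg.
    rewrite -/(F i j l m) in F1 F2 F3.
    have qq x y : q g x * q g y <= (a x + a y) / 2.
      by have := sqr_ge0 (q g x - q g y); rewrite sqrrB /a; lra.
    pose Q := (a j + a l + a m) / 2.
    have Q0 : 0 <= Q by rewrite /Q; have := a0 j; have := a0 l; have := a0 m; lra.
    have step x y z : F i j l m <= u i x * (q g y * q g z) -> q g y * q g z <= Q ->
        F i j l m <= v i x ^+ 3 * (B * Q).
      move=> h1 h2; apply: (le_trans h1).
      apply: (le_trans (ler_wpM2l (u0 _ _) h2)).
      by rewrite mulrA (mulrC _ B) ler_wpM2r.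
    have G1 : F i j l m <= v i j ^+ 3 * (B * Q).
      by apply: (step _ l m) => //; have := qq l m; have := a0 j; rewrite /Q; lra.
    have G2 : F i j l m <= v i l ^+ 3 * (B * Q).
      by apply: (step _ j m) => //; have := qq j m; have := a0 l; rewrite /Q; lra.
    have G3 : F i j l m <= v i m ^+ 3 * (B * Q).
      by apply: (step _ j l) => //; have := qq j l; have := a0 m; rewrite /Q; lra.
    have -> : v i j * v i l * v i m * (a j + a l + a m) * (B / 2) =
              v i j * v i l * v i m * (B * Q) by rewrite /Q; ring.
    have BQ : 0 <= B * Q by exact: mulr_ge0.
    have [BQ0|BQn] := eqVneq (B * Q) 0; first by move: G1; rewrite BQ0 !mulr0.
    have BQp : 0 < B * Q by rewrite lt_def BQn.
    have D x : (F i j l m <= x * (B * Q)) = (F i j l m / (B * Q) <= x).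
      by rewrite ler_pdivrMr.
    by move: G1 G2 G3; rewrite !D; exact: cube_min.
  pose P i := \sum_j v i j; pose A i := \sum_j v i j * a j.
  have sumE i c d e : \sum_j c * (v i j * (d + a j * e)) = c * (d * P i + A i * e).
    rewrite -mulr_sumr; congr (_ * _); rewrite /P /A mulr_sumr mulr_suml -big_split/=.
    by apply: eq_bigr => j _; ring.
  (* By symmetry in [j], [l], [m] the three squares contribute the same sum [A i * P i ^+ 2]. *)
  have tot i : \sum_j \sum_l \sum_m v i j * v i l * v i m * (a j + a l + a m) * (B / 2) =
      3 * A i * P i ^+ 2 * (B / 2).
    transitivity (\sum_j \sum_l v i j * v i l * (B / 2) * ((a j + a l) * P i + A i * 1)).
      apply: eq_bigr => j _; apply: eq_bigr => l _; rewrite -sumE.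
      by apply: eq_bigr => m _; ring.
    transitivity (\sum_j v i j * (B / 2) * ((a j * P i + A i) * P i + A i * P i)).
      apply: eq_bigr => j _; rewrite -sumE; apply: eq_bigr => l _; ring.
    transitivity (\sum_j (B / 2) * (v i j * (2 * A i * P i + a j * P i ^+ 2))).
      apply: eq_bigr => j _; ring.
    rewrite sumE; ring.
  apply: (@le_trans _ _ (\sum_i 3 * A i * P i ^+ 2 * (B / 2))).
    apply: ler_sum => i _; rewrite -tot; do 3 (apply: ler_sum => ? _); exact: Fle.
  have A0 i : 0 <= A i by apply: sumr_ge0 => j _; rewrite mulr_ge0.
  have P0 i : 0 <= P i by apply: sumr_ge0 => j _.
  apply: (@le_trans _ _ (\sum_i (3 / 2 * B * V ^+ 2) * A i)).
    apply: ler_sum => i _.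
    have -> : 3 * A i * P i ^+ 2 * (B / 2) = 3 / 2 * B * A i * P i ^+ 2 by field.
    rewrite [leRHS]mulrAC; apply: ler_wpM2l; first by rewrite !mulr_ge0//; lra.
    by apply: lerXn2r; rewrite ?nnegrE//; exact: vV.
  have SA : \sum_i A i <= V * X.
    rewrite exchange_big/= mulr_sumr; apply: ler_sum => j _.
    rewrite -mulr_suml ler_wpM2r//; under eq_bigr do rewrite vC; exact: vV.
  rewrite -mulr_sumr (_ : _ * V ^+ 3 * X = 3 / 2 * B * V ^+ 2 * (V * X)); last by ring.
  by apply: ler_wpM2l => //; rewrite !mulr_ge0 ?sqr_ge0//; lra.
have T0 := dot_ge0 Tg; have g0 := dot_ge0 g.
(* Cauchy-Schwarz for [dot Tg Tg = dot g W]. What remains is the square of the claim, with [3 / 2]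
   in place of [4]. *)
have TgW : dot Tg Tg ^+ 2 <= dot g g * dot W W.
  have := dot_CS bg bW; rewrite -TW ger0_norm//.
  by rewrite -(@ler_pXn2r _ 2)// ?nnegrE ?mulr_ge0 ?nrm2_ge0// exprMn !sqr_nrm2.
have BV : 0 <= B * V ^+ 3 by rewrite mulr_ge0// exprn_ge0.
rewrite -(@ler_pXn2r _ 2)// ?nnegrE ?mulr_ge0 ?sqr_ge0//.
apply: (le_trans TgW).
have WX : dot W W <= 3 / 2 * B * V ^+ 3 * (B * V * dot g g).
  by apply: (le_trans WW); apply: ler_wpM2l XS; rewrite -mulrA mulr_ge0//; lra.
apply: (le_trans (ler_wpM2l g0 WX)).
have -> : dot g g * (3 / 2 * B * V ^+ 3 * (B * V * dot g g)) =
  3 / 2 * (B * V ^+ 2 * dot g g) ^+ 2 by ring.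
have -> : (2 * B * V ^+ 2 * dot g g) ^+ 2 = 4 * (B * V ^+ 2 * dot g g) ^+ 2 by ring.
by apply: ler_wpM2r; [exact: sqr_ge0|lra].
Qed.

End almost_orthogonality.

(** * Integrals of functions supported in a square *)

Section square_bounds.
Context {R : realType}.
Implicit Types (f g h : plane R -> R).
Notation Ig f := ((area R).-integrable setT (EFin \o f)).

Lemma Ig_sq f (a : plane R) (r c : R) : measurable_fun setT f -> 0 <= r ->
  (forall z, `|f z| <= c) -> (forall z, ~ sq a r z -> f z = 0) -> Ig f.
Proof.
move=> mf r0 fc f0; apply: (@integrable_bounded_support _ f (sq a r) c) => //.
  exact: measurable_sq.
by rewrite area_sq// ltry.
Qed.

Lemma Int_indic_sq (a : plane R) (r : R) : 0 <= r -> Int (\1_(sq a r) : plane R -> R) = (2 * r) ^+ 2.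
Proof.
move=> r0; rewrite unlock.
transitivity (Rintegral (area R) (sq a r) (fun=> 1)).
  rewrite [RHS]Rintegral_mkcond; congr Rintegral; apply/funext => z.
  by rewrite /patch indicE; case: (_ \in _).
rewrite Rintegral_cst; last exact: measurable_sq.
by rewrite mul1r; exact: (congr1 fine (area_sq a r0)).
Qed.

Lemma measurable_indic_sq (a : plane R) (r : R) : measurable_fun setT (\1_(sq a r) : plane R -> R).
Proof. by apply: measurable_indic; exact: measurable_sq. Qed.

Lemma Ig_indic_sq (a : plane R) (r : R) : 0 <= r -> Ig (\1_(sq a r) : plane R -> R).
Proof.
move=> r0; apply: (@Ig_sq _ a r 1) => //; first exact: measurable_indic_sq.
- by move=> z; rewrite indicE; case: (_ \in _); rewrite ?normr1 ?normr0.
- by move=> z za; rewrite indicE memNset.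
Qed.

Lemma Int_le_sq f (a : plane R) (r c : R) : measurable_fun setT f -> 0 <= r ->
  (forall z, `|f z| <= c) -> (forall z, ~ sq a r z -> f z = 0) ->
  Int (fun z => `|f z|) <= c * (2 * r) ^+ 2.
Proof.
move=> mf r0 fc f0; rewrite -(Int_indic_sq a r0) -IntZ; last exact: Ig_indic_sq.
apply: Int_le => [||z].
- apply: (@Ig_sq _ a r c) => //; first exact: measurableT_comp.
    by move=> z; rewrite normr_id.
  by move=> z za; rewrite f0// normr0.
- apply: (@Ig_sq _ a r `|c|) => //.
  + by apply: measurable_funM; [exact: measurable_cst|exact: measurable_indic_sq].
  + by move=> z; rewrite normrM indicE; case: (_ \in _); rewrite ?normr1 ?normr0 ?mulr1// mulr0.
  + by move=> z za; rewrite indicE memNset// mulr0.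
- have [za|za] := pselect (sq a r z); first by rewrite indicE mem_set// mulr1.
  by rewrite f0// normr0 mulr_ge0// (le_trans _ (fc z)).
Qed.

End square_bounds.

(** * Lipschitz radial cutoffs *)

Section cutoff.
Context {R : realType}.
Implicit Types (z w : plane R) (s : R).

(** Vanishes for [|z| <= s], equals [1] for [|z| >= 2 s] and is linear in [|z|] between. Being
    Lipschitz with constant [1 / s], it lets the annular pieces of a kernel inherit its smoothness,
    which a sharp cut would destroy. *)
Definition cut s z : R := Num.min 1 (Num.max 0 (en z / s - 1)).

Lemma cut_ge0 s z : 0 <= cut s z.
Proof. by rewrite le_min ler01 le_max lexx. Qed.

Lemma cut_le1 s z : cut s z <= 1.
Proof. by rewrite ge_min lexx. Qed.

Lemma cut_eq0 s z : 0 < s -> en z <= s -> cut s z = 0.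
Proof.
move=> s0 zs; rewrite /cut; have : en z / s - 1 <= 0 by rewrite subr_le0 ler_pdivrMr// mul1r.
by move=> /max_idPl ->; apply/min_idPr.
Qed.

Lemma cut_eq1 s z : 0 < s -> 2 * s <= en z -> cut s z = 1.
Proof.
move=> s0 zs; rewrite /cut; have h : 1 <= en z / s - 1 by rewrite lerBrDr ler_pdivlMr//; lra.
by apply/min_idPl; rewrite le_max h orbT.
Qed.

Lemma measurable_cut s : measurable_fun setT (cut s).
Proof.
apply: measurable_minr; first exact: measurable_cst.
apply: measurable_maxr; first exact: measurable_cst.
apply: measurable_funB; last exact: measurable_cst.
by apply: measurable_funM; [exact: measurable_en|exact: measurable_cst].
Qed.

Lemma cut_mono s t z : 0 < s -> s <= t -> cut t z <= cut s z.
Proof.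
move=> s0 st; have t0 : 0 < t by lra.
have h : en z / t <= en z / s by rewrite ler_wpM2l ?en_ge0// lef_pV2.
rewrite /cut; have [a1|a1] := leP 1 (Num.max 0 (en z / s - 1)); first exact: cut_le1.
rewrite ge_min; apply/orP; right; rewrite ge_max !le_max lexx/= ; apply/orP; right; lra.
Qed.

Lemma clamp_lip (a b : R) :
  `|Num.min 1 (Num.max 0 a) - Num.min 1 (Num.max 0 b)| <= `|a - b|.
Proof.
have h1 := ler_norm (a - b); have h2 := ler_norm (b - a); rewrite distrC in h2.
move: `|a - b| h1 h2 => c h1 h2.
rewrite /Num.min /Num.max.
case: ifPn; rewrite -?leNgt; case: ifPn; rewrite -?leNgt; case: ifPn; rewrite -?leNgt; case: ifPn; rewrite -?leNgt => *;
  rewrite ler_norml; apply/andP; split; lra.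
Qed.

Lemma cut_lip s z w : 0 < s -> `|cut s z - cut s w| <= en ((z : R * R) - w) / s.
Proof.
move=> s0.
have D : `|(en z / s - 1) - (en w / s - 1)| <= en ((z : R * R) - w) / s.
  have -> : (en z / s - 1) - (en w / s - 1) = (en z - en w) / s by field; rewrite gt_eqF.
  rewrite normrM (gtr0_norm (_ : 0 < s^-1)) ?invr_gt0// ler_pM2r ?invr_gt0//.
  rewrite ler_norml; have := en_subl z w; have := en_subl w z; rewrite enB; lra.
apply: le_trans D; rewrite /cut; move: (en z / s - 1) (en w / s - 1) => a b.
exact: clamp_lip.
Qed.

End cutoff.

(** * Kernels and their dyadic pieces *)

Section kernel_pieces.
Context {R : realType}.
Implicit Types (z w : plane R) (f g h : plane R -> R).

(** A Calderon-Zygmund kernel whose smoothness constant exceeds the size constant by the factor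
    [kap]; for the two parts of the kernel of [R^k] these are [5 k] and [k]. Cancellation is encoded
    by [czk_rot], a norm-preserving symmetry that reverses the sign of [K]. Since a quotient by zero
    is zero, [czk_size] forces [K 0 = 0]. *)
Record czk (A kap : R) (K : plane R -> R) : Prop := Czk {
  czk_A : 0 <= A;
  czk_kap : 1 <= kap;
  czk_meas : measurable_fun setT K;
  czk_size : forall z, `|K z| <= A / en z ^+ 2;
  czk_smooth : forall z w, 2 * en w <= en z ->
    `|K ((z : R * R) - w) - K z| <= A * kap * en w / en z ^+ 3;
  czk_rot : exists phi : plane R -> plane R, area_preserving phi /\
    forall z, en (phi z) = en z /\ K (phi z) = - K z }.

Lemma czk_rf A kap K : czk A kap K -> czk A kap (rf K).
Proof.
case=> A0 k1 mK sK mo [phi [ap phiP]]; split => //.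
- by apply: (measurableT_comp mK); exact: measurable_opp.
- by move=> z; rewrite -(enN z); exact: sK.
- move=> z w zw.
  have -> : rf K ((z : R * R) - w) = K (- (z : R * R) - (- (w : R * R))).
    by rewrite /rf opprB opprK addrC.
  by rewrite -(enN w) -(enN z); apply: mo; rewrite !enN.
- exists (fun z => - (phi (- (z : R * R)) : R * R)); split.
    exact: (area_preserving_comp (@area_preserving_opp R)
      (area_preserving_comp ap (@area_preserving_opp R))).
  move=> z; have [e1 e2] := phiP (- (z : R * R)); split; first by rewrite enN e1 enN.
  by rewrite /rf opprK e2.
Qed.

Variables (A kap : R).
Implicit Types K : plane R -> R.

(** The change of variables by the symmetry of [czk_rot] turns the integral into its opposite. *)
Lemma czk_annulus K (chi : R -> R) : czk A kap K ->
  bcs (fun z => K z * chi (en z)) -> Int (fun z => K z * chi (en z)) = 0.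
Proof.
move=> cK bK; have [phi [ap phiP]] := czk_rot cK.
have := Int_area_preserving ap (bcs_measurable bK).
have -> : (fun z => K (phi z) * chi (en (phi z))) = fun z => - (K z * chi (en z)).
  by apply/funext => z; have [-> ->] := phiP z; rewrite mulNr.
rewrite IntN; last exact: bcs_Ig.
move: (Int _) => x; lra.
Qed.

Definition cutr (s : R) (r : R) : R := Num.min 1 (Num.max 0 (r / s - 1)).

(** The piece at scale [s], supported in [s <= |z| <= 16 s]; over the scales [s], [8 s], [64 s], ...
    the pieces telescope. The ratio is [8 = 2^3] because [cotlar_stein] takes cube roots of the
    interaction bounds, which then decay like powers of [1 / 2]. *)
Definition Kp (K : plane R -> R) (s : R) (z : plane R) : R := K z * (cut s z - cut (8 * s) z).

Lemma cut_diff01 (s : R) z : 0 < s -> 0 <= cut s z - cut (8 * s) z <= 1.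
Proof.
move=> s0; have h : s <= 8 * s by lra.
have := cut_mono z s0 h; have := cut_ge0 (8 * s) z; have := cut_le1 s z.
by move=> *; apply/andP; split; lra.
Qed.

Lemma cut_diff_small (s : R) z : 0 < s -> en z <= s -> cut s z - cut (8 * s) z = 0.
Proof.
move=> s0 zs; rewrite (cut_eq0 s0 zs) cut_eq0 ?subrr//; lra.
Qed.

Lemma cut_diff_large (s : R) z : 0 < s -> 16 * s <= en z -> cut s z - cut (8 * s) z = 0.
Proof.
move=> s0 zs; rewrite !cut_eq1 ?subrr//; lra.
Qed.

Lemma cut_diff_lip (s : R) z w : 0 < s ->
  `|(cut s ((z : R * R) - w) - cut (8 * s) ((z : R * R) - w)) - (cut s z - cut (8 * s) z)| <= 2 * en w / s.
Proof.
move=> s0; have s8 : 0 < 8 * s by lra.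
have := cut_lip ((z : R * R) - w) z s0; have := cut_lip ((z : R * R) - w) z s8.
have -> : en ((z : R * R) - w - z) = en w by rewrite addrAC subrr add0r enN.
have -> : en w / (8 * s) = (en w / s) / 8 by field; rewrite gt_eqF.
have : 0 <= en w / s by rewrite divr_ge0 ?en_ge0// ltW.
have -> : 2 * en w / s = 2 * (en w / s) by rewrite mulrA.
move: (en w / s) (cut s _) (cut s z) (cut (8 * s) _) (cut (8 * s) z) => e a b c d e0 H1 H2.
have -> : a - c - (b - d) = (a - b) - (c - d) by ring.
by apply: (le_trans (ler_normB _ _)); lra.
Qed.

Lemma measurable_Kp K (s : R) : czk A kap K -> measurable_fun setT (Kp K s).
Proof.
move=> cK; apply: measurable_funM; first exact: czk_meas cK.
by apply: measurable_funB; exact: measurable_cut.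
Qed.

Lemma size_away K (s : R) z : czk A kap K -> 0 < s -> s <= en z -> `|K z| <= A / s ^+ 2.
Proof.
move=> cK s0 sz; apply: (le_trans (czk_size cK z)).
apply: ler_wpM2l; first exact: czk_A cK.
have z0 : 0 < en z by lra.
by rewrite lef_pV2 ?posrE ?exprn_gt0// lerXn2r ?nnegrE// ltW.
Qed.

Lemma Kp_size K (s : R) z : czk A kap K -> 0 < s -> `|Kp K s z| <= A / s ^+ 2.
Proof.
move=> cK s0; have A0 := czk_A cK.
have [zs|sz] := leP (en z) s.
  by rewrite /Kp cut_diff_small// mulr0 normr0 divr_ge0// sqr_ge0.
have /andP[c0 c1] := cut_diff01 z s0.
rewrite normrM (ger0_norm c0); apply: (@le_trans _ _ (`|K z| * 1)).
  by rewrite ler_wpM2l.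
by rewrite mulr1; apply: size_away cK s0 (ltW sz).
Qed.

Lemma Kp_supp K (s : R) z : 0 < s -> Kp K s z != 0 -> s < en z < 16 * s.
Proof.
move=> s0; apply: contraNT; rewrite negb_and -!leNgt => /orP[zs|zs].
  by rewrite /Kp cut_diff_small// mulr0.
by rewrite /Kp cut_diff_large// mulr0.
Qed.

Lemma bcs_Kp K (s : R) : czk A kap K -> 0 < s -> bcs (Kp K s).
Proof.
move=> cK s0; apply: (@bcsI _ _ (A / s ^+ 2 + 16 * s)); first exact: measurable_Kp.
have A0 := czk_A cK; have As : 0 <= A / s ^+ 2 by rewrite divr_ge0// sqr_ge0.
move=> z; split; first by have := Kp_size z cK s0; lra.
move=> Mz; apply/eqP; apply: contraT => /(Kp_supp s0)/andP[]; lra.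
Qed.

Lemma nrm1_Kp K (s : R) : czk A kap K -> 0 < s -> nrm1 (Kp K s) <= 1024 * A.
Proof.
move=> cK s0; rewrite nrm1E.
have s16 : 0 <= 16 * s by lra.
apply: (le_trans (@Int_le_sq _ _ 0 (16 * s) (A / s ^+ 2) (measurable_Kp s cK) s16 _ _)).
- by move=> z; exact: Kp_size.
- move=> z zs; apply/eqP; apply: contraT => /(Kp_supp s0)/andP[_ h]; exfalso; apply: zs.
  by apply: en_sq; rewrite subr0 ltW.
- rewrite le_eqVlt; apply/orP; left; apply/eqP; field; by rewrite gt_eqF.
Qed.

Lemma Int_Kp K (s : R) : czk A kap K -> 0 < s -> Int (Kp K s) = 0.
Proof.
move=> cK s0; exact: (@czk_annulus K (fun r => cutr s r - cutr (8 * s) r) cK (bcs_Kp cK s0)).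
Qed.

(** The product rule [a p - b q = a (p - q) + q (a - b)], where [p], [q] are the cutoffs and [a],
    [b] the values of [K]. With [E = A |w| / s^3] the first term costs [8 E] by the Lipschitz bound
    of the cutoffs, the second [kap E] by the smoothness of [K]. *)
Lemma Kp_lip_pt K (s : R) z w : czk A kap K -> 0 < s -> 2 * en w <= s ->
  `|Kp K s ((z : R * R) - w) - Kp K s z| <= 9 * A * kap * en w / s ^+ 3.
Proof.
move=> cK s0 ws; have A0 := czk_A cK; have k1 := czk_kap cK; have w0 := en_ge0 w.
pose E := A * en w / s ^+ 3.
have E0 : 0 <= E by rewrite !mulr_ge0// invr_ge0 exprn_ge0// ltW.
have EkE : E <= kap * E by rewrite ler_peMl.
have -> : 9 * A * kap * en w / s ^+ 3 = 9 * (kap * E) by rewrite /E; ring.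
have Kzw : s / 2 <= en ((z : R * R) - w) ->
    `|K ((z : R * R) - w)| * (2 * en w / s) <= 8 * E.
  move=> h; have h2 : 0 < s / 2 by lra.
  have := size_away cK h2 h.
  have -> : A / (s / 2) ^+ 2 = 4 * A / s ^+ 2 by field; rewrite gt_eqF.
  move=> h3; apply: (@le_trans _ _ (4 * A / s ^+ 2 * (2 * en w / s))).
    by apply: ler_wpM2r h3; rewrite !mulr_ge0// invr_ge0 ltW.
  by rewrite /E le_eqVlt; apply/orP; left; apply/eqP; field; rewrite gt_eqF.
have L := cut_diff_lip z w s0.
have [sz|zs] := leP s (en z).
  have zws : s / 2 <= en ((z : R * R) - w) by have := en_subl z w; lra.
  have /andP[c0 c1] := cut_diff01 z s0.
  rewrite /Kp.
  set a := K ((z : R * R) - w) in Kzw *; set b := K z; 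
  set p := cut s ((z : R * R) - w) - cut (8 * s) ((z : R * R) - w) in L *.
  set q := cut s z - cut (8 * s) z in L c0 c1 *.
  have -> : a * p - b * q = a * (p - q) + q * (a - b) by ring.
  apply: (le_trans (ler_normD _ _)); rewrite !normrM (ger0_norm c0).
  have wz : 2 * en w <= en z by lra.
  have S : `|a - b| <= kap * E.
    apply: (le_trans (czk_smooth cK wz)).
    rewrite (_ : kap * E = A * kap * en w / s ^+ 3); last by rewrite /E; ring.
    apply: ler_wpM2l; first by rewrite !mulr_ge0//; lra.
    by rewrite lef_pV2 ?posrE ?exprn_gt0//; [rewrite lerXn2r ?nnegrE// ?en_ge0 ?ltW|lra].
  have H1 : `|a| * `|p - q| <= 8 * E.
    by apply: le_trans (Kzw zws); apply: ler_wpM2l.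
  have H2 : q * `|a - b| <= kap * E.
    by apply: le_trans S; rewrite ler_piMl.
  lra.
rewrite /Kp (cut_diff_small s0 (ltW zs)) subr0 in L *; rewrite mulr0 subr0 normrM.
have [h|h] := leP (s / 2) (en ((z : R * R) - w)).
  apply: (@le_trans _ _ (8 * E)); last lra.
  by apply: le_trans (Kzw h); apply: ler_wpM2l.
rewrite cut_diff_small ?normr0 ?mulr0; [lra|by []|lra].
Qed.

(** For [2 |w| <= s] the pointwise bound is integrated over a square of half side [17 s], and
    [10404 = 9 * 34^2]. For larger [w] the triangle inequality is enough, as [|w| / s] is then at
    least [1 / 2]. *)
Lemma Kp_lip K (s : R) w : czk A kap K -> 0 < s ->
  Int (fun z => `|Kp K s ((z : R * R) - w) - Kp K s z|) <= 10404 * A * kap * en w / s.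
Proof.
move=> cK s0; have A0 := czk_A cK; have k1 := czk_kap cK; have w0 := en_ge0 w.
have bK := bcs_Kp cK s0.
have bS : bcs (fun z => Kp K s ((z : R * R) - w)) by exact: bcs_shift.
have [ws|sw] := leP (2 * en w) s.
  have s17 : 0 <= 17 * s by lra.
  apply: (le_trans (@Int_le_sq _ _ 0 (17 * s) (9 * A * kap * en w / s ^+ 3) _ s17 _ _)).
  - by apply: bcs_measurable; exact: bcsB.
  - by move=> z; exact: Kp_lip_pt.
  - move=> z zs; have h : 17 * s < en z.
      rewrite ltNge; apply/negP => h; apply: zs; apply: en_sq; by rewrite subr0.
    have Z v : 16 * s <= en v -> Kp K s v = 0.
      by move=> vv; rewrite /Kp cut_diff_large// mulr0.
    by rewrite !Z ?subrr//; [lra|have := en_subl z w; lra].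
  - by rewrite le_eqVlt; apply/orP; left; apply/eqP; field; rewrite gt_eqF.
apply: (@le_trans _ _ (nrm1 (Kp K s) + nrm1 (Kp K s))).
  rewrite {1}nrm1E -(@Int_shift _ w (fun z => `|Kp K s z|)); last first.
    by apply: bcs_measurable; exact: bcs_norm.
  rewrite nrm1E -IntD; [|by apply: bcs_Ig; exact: bcs_norm..].
  apply: Int_le => [||z]; last exact: ler_normB.
    by apply: bcs_Ig; apply: bcs_norm; exact: bcsB.
  by apply: bcs_Ig; apply: bcsD; exact: bcs_norm.
have := nrm1_Kp cK s0 => N1.
apply: (@le_trans _ _ (4096 * A * (en w / s))).
  have : A * 1 <= A * (2 * (en w / s)).
    by apply: ler_wpM2l => //; rewrite mulrA ler_pdivlMr// mul1r ltW.
  lra.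
have -> : 10404 * A * kap * en w / s = (10404 * kap) * (A * (en w / s)) by ring.
rewrite -mulrA; apply: ler_wpM2r; last lra.
by rewrite mulr_ge0// divr_ge0// ltW.
Qed.

(** Young's inequality gives the bound with [1]. For the other one, the piece of smaller scale has
    mean zero and support in [|y| <= 16 s], so [nrm1_cv_le] applies with the [L^1] continuity of the
    piece of larger scale. The constant covers [1024 * 10404 * 16]. *)
Lemma Kp_orth K K' (s t : R) : czk A kap K -> czk A kap K' -> 0 < s -> s <= t ->
  nrm1 (cv (Kp K s) (Kp K' t)) <= 2 ^+ 28 * A ^+ 2 * Num.min 1 (kap * (s / t)).
Proof.
move=> cK cK' s0 st; have t0 : 0 < t by lra.
have A0 := czk_A cK; have k1 := czk_kap cK.
have bK := bcs_Kp cK s0; have bK' := bcs_Kp cK' t0.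
have N1 := nrm1_Kp cK s0; have N2 := nrm1_Kp cK' t0.
have A2 : 0 <= A ^+ 2 by exact: sqr_ge0.
have st0 : 0 <= s / t by rewrite divr_ge0// ltW.
have h1 : nrm1 (cv (Kp K s) (Kp K' t)) <= 2 ^+ 28 * A ^+ 2.
  apply: (le_trans (nrm1_cv bK bK')).
  apply: (le_trans (ler_pM (nrm1_ge0 _) (nrm1_ge0 _) N1 N2)).
  have -> : 1024 * A * (1024 * A) = 1024 * 1024 * A ^+ 2 by ring.
  by apply: ler_wpM2r; [exact: A2|lra].
have h2 : nrm1 (cv (Kp K s) (Kp K' t)) <= 2 ^+ 28 * A ^+ 2 * (kap * (s / t)).
  apply: (@le_trans _ _ (nrm1 (Kp K s) * (10404 * A * kap * (16 * s) / t))).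
    apply: nrm1_cv_le => //; last exact: Int_Kp.
    move=> y /(Kp_supp s0)/andP[_ /ltW ys]; apply: (le_trans (Kp_lip y cK' t0)).
    apply: ler_wpM2r; first by rewrite invr_ge0 ltW.
    apply: ler_wpM2l; last exact: ys.
    by apply: mulr_ge0; [apply: mulr_ge0; [exact: ler0n|exact: A0]|lra].
  apply: (@le_trans _ _ (1024 * A * (10404 * A * kap * (16 * s) / t))).
    apply: ler_wpM2r N1; apply: divr_ge0; last exact: ltW.
    by apply: mulr_ge0; [apply: mulr_ge0; [apply: mulr_ge0; [exact: ler0n|exact: A0]|lra]|lra].
  have -> : 1024 * A * (10404 * A * kap * (16 * s) / t) = (1024 * 10404 * 16) * A ^+ 2 * (kap * (s / t)) by ring.
  apply: ler_wpM2r; first by apply: mulr_ge0; [lra|exact: st0].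
  by apply: ler_wpM2r; [exact: A2|lra].
by rewrite /Num.min; case: ifP; rewrite ?mulr1.
Qed.

End kernel_pieces.

(** * Sums over scales *)

Section geometric_sums.
Context {R : realType}.

Definition dist (i j : nat) : nat := ((i - j) + (j - i))%N.

Lemma distC i j : dist i j = dist j i.
Proof. by rewrite /dist addnC. Qed.

(** Each distance occurs at most twice, once on either side of [i]. *)
Lemma sum_dist (F : nat -> R) n i : (forall r, 0 <= F r) -> (i < n)%N ->
  \sum_(0 <= j < n) F (dist i j) <= 2 * \sum_(0 <= r < n) F r.
Proof.
move=> F0 lin; rewrite (@big_cat_nat _ _ _ i)//=; last exact: ltnW.
have mono m p : (m <= p)%N -> \sum_(0 <= r < m) F r <= \sum_(0 <= r < p) F r.
  by move=> mp; rewrite (@big_cat_nat _ _ _ m 0 p)//= lerDl sumr_ge0.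
have h1 : \sum_(0 <= j < i) F (dist i j) <= \sum_(0 <= r < n) F r.
  apply: (@le_trans _ _ (\sum_(0 <= r < i.+1) F r)); last exact: mono.
  rewrite [leRHS]big_nat_recl// big_nat_rev/= ler_wpDl//.
  rewrite le_eqVlt; apply/orP; left; apply/eqP; apply: eq_big_nat => j /andP[_ ji].
  by rewrite /dist; congr F; lia.
have h2 : \sum_(i <= j < n) F (dist i j) <= \sum_(0 <= r < n) F r.
  rewrite -{1}(add0n i) big_addn; apply: le_trans (mono (n - i)%N n (leq_subr _ _)).
  rewrite le_eqVlt; apply/orP; left; apply/eqP; apply: eq_big_nat => j /andP[_ ji].
  by rewrite /dist; congr F; lia.
lra.
Qed.

Lemma sum_half n : \sum_(0 <= r < n) (2^-1 : R) ^+ r <= 2.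
Proof.
suff -> : \sum_(0 <= r < n) (2^-1 : R) ^+ r = 2 - 2 * 2^-1 ^+ n.
  by rewrite lerBlDr lerDl mulr_ge0// exprn_ge0// invr_ge0.
elim: n => [|n ih]; first by rewrite big_nil expr0; ring.
by rewrite big_nat_recr//= ih exprS; field.
Qed.

(** The first [L] terms are at most [1]; from [r = L] on the terms are dominated by a geometric
    series of sum at most [2]. With [kap = k] this is where the logarithm of the theorem arises. *)
Lemma sum_min1 (kap : R) (L n : nat) : 0 <= kap -> kap <= 2 ^+ L ->
  \sum_(0 <= r < n) Num.min 1 (kap * 2^-1 ^+ r) <= L%:R + 2.
Proof.
move=> k0 kL.
have F0 r : 0 <= Num.min 1 (kap * 2^-1 ^+ r).
  by rewrite le_min ler01 mulr_ge0// exprn_ge0// invr_ge0.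
apply: (@le_trans _ _ (\sum_(0 <= r < L + n) Num.min 1 (kap * 2^-1 ^+ r))).
  by rewrite (@big_cat_nat _ _ _ n 0 (L + n))//= ?leq_addl// lerDl sumr_ge0.
rewrite (@big_cat_nat _ _ _ L 0 (L + n))//= ?leq_addr//; apply: lerD.
  apply: (@le_trans _ _ (\sum_(0 <= r < L) 1)).
    by apply: ler_sum => r _; rewrite ge_min lexx.
  by rewrite big_const_nat iter_addr_0 subn0.
apply: le_trans (sum_half n).
rewrite -{1}(add0n L) big_addn addKn; apply: ler_sum => r _.
rewrite ge_min; apply/orP; right; rewrite exprD mulrCA ler_piMr ?exprn_ge0 ?invr_ge0//.
by rewrite exprVn ler_pdivrMr ?exprn_gt0// mul1r.
Qed.

End geometric_sums.

(** * The [L^2] bound for smoothly truncated kernels *)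

Section L2_bound.
Context {R : realType}.
Implicit Types (z w : plane R) (f g h K : plane R -> R).
Variables (A kap : R) (L : nat).
Hypothesis kL : kap <= 2 ^+ L.

Definition Kn K (d : R) (n : nat) z : R := K z * (cut d z - cut (d * 8 ^+ n) z).

(** Bounds the row sums of [min(1, kap 2^-|i-j|)], by [sum_dist] and [sum_min1]; it is of order
    [log (k + 1)] once [L] is close to [log_2 k]. *)
Definition Vc : R := 2 * (L%:R + 2).

Lemma Vc_ge4 : 4 <= Vc.
Proof. by rewrite /Vc; have := ler0n R L; lra. Qed.

Lemma Kn_sum K d n z : Kn K d n z = \sum_(i < n) Kp K (d * 8 ^+ i) z.
Proof.
rewrite -(big_mkord xpredT (fun i => Kp K (d * 8 ^+ i) z)).
elim: n => [|n ih]; first by rewrite big_nil /Kn expr0 mulr1 subrr mulr0.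
rewrite big_nat_recr//= -ih /Kn /Kp -mulrDr; congr (_ * _).
have -> : 8 * (d * 8 ^+ n) = d * 8 ^+ n.+1 by rewrite exprS; ring.
by ring.
Qed.

Lemma bcs_Kn K d n : czk A kap K -> 0 < d -> bcs (Kn K d n).
Proof.
move=> cK d0; rewrite (_ : Kn K d n = fun z => \sum_(i < n) Kp K (d * 8 ^+ i) z).
  by apply: bcs_sum => i; apply: (bcs_Kp cK); rewrite mulr_gt0// exprn_gt0.
by apply/funext => z; exact: Kn_sum.
Qed.

Lemma Kp_rf K (s : R) : rf (Kp K s) = Kp (rf K) s.
Proof. by apply/funext => z; rewrite /rf /Kp /cut !enN. Qed.

(** The point is that the constant depends neither on [d] nor on [n]. [cotlar_stein] bounds the
    square by [2^29 A^2 Vc^2 |g|^2], and [2^29 <= (2^15)^2]. *)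
Lemma nrm2_Kn K d n g : czk A kap K -> 0 < d -> bcs g ->
  nrm2 (cv (Kn K d n) g) <= 2 ^+ 15 * A * Vc * nrm2 g.
Proof.
move=> cK d0 bg; have A0 := czk_A cK; have k1 := czk_kap cK.
have crK := czk_rf cK.
pose s (i : 'I_n) : R := d * 8 ^+ i.
have s0 i : 0 < s i by rewrite mulr_gt0// exprn_gt0.
pose k i := Kp K (s i).
have bk i : bcs (k i) by exact: (bcs_Kp cK).
have -> : cv (Kn K d n) g = fun z => \sum_i cv (k i) g z.
  apply/funext => z; rewrite -cv_suml//; congr (cv _ g z); apply/funext => w; exact: Kn_sum.
pose B : R := 2 ^+ 28 * A ^+ 2.
have B0 : 0 <= B by rewrite mulr_ge0// ?sqr_ge0// exprn_ge0.
pose u (i j : 'I_n) : R := B * Num.min 1 (kap * 8^-1 ^+ dist i j).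
have m0 (x : R) (r : nat) : 0 <= x -> 0 <= Num.min 1 (kap * x ^+ r).
  by move=> x0; rewrite le_min ler01 mulr_ge0// ?exprn_ge0//; lra.
have u0 i j : 0 <= u i j by rewrite mulr_ge0// m0// invr_ge0.
have uC i j : u i j = u j i by rewrite /u distC.
have sE (i j : 'I_n) : (i <= j)%N -> s i / s j = 8^-1 ^+ dist i j.
  move=> ij; rewrite /s /dist (eqP (_ : i - j == 0)%N) ?subn_eq0// add0n exprVn.
  have -> : (8 : R) ^+ j = 8 ^+ (j - i) * 8 ^+ i by rewrite -exprD subnK.
  by field; rewrite !expf_neq0//= ?gt_eqF.
have orth K' (i j : 'I_n) : czk A kap K' -> nrm1 (cv (k i) (Kp K' (s j))) <= u i j.
  move=> cK'; have [ij|/ltnW ji] := leqP i j.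
    rewrite /u -sE//; apply: Kp_orth => //.
    by apply: ler_wpM2l; [exact: ltW|apply: ler_weXn2l => //; lra].
  rewrite uC /u -sE// (_ : cv (k i) _ = cv (Kp K' (s j)) (k i)); last first.
    by apply/funext => z; apply: cvC; [exact: (measurable_Kp _ cK)|exact: (measurable_Kp _ cK')].
  apply: Kp_orth => //.
  by apply: ler_wpM2l; [exact: ltW|apply: ler_weXn2l => //; lra].
pose v (i j : 'I_n) : R := Num.min 1 (kap * 2^-1 ^+ dist i j).
have V0 : 0 <= Vc by have := Vc_ge4; lra.
have H := @cotlar_stein R n k u bk u0 uC (fun i j => orth K i j cK) _ B Vc v g bg B0 V0 _ _ _ _.
rewrite -(@ler_pXn2r _ 2)// ?nnegrE ?nrm2_ge0//; last first.
  by apply: mulr_ge0; [apply: mulr_ge0; [apply: mulr_ge0; [exact: exprn_ge0|]|]|exact: nrm2_ge0].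
have -> : (2 ^+ 15 * A * Vc * nrm2 g) ^+ 2 = 2 ^+ 30 * (A ^+ 2 * Vc ^+ 2 * dot g g).
  by rewrite -sqr_nrm2 (_ : 30 = 15 * 2)%N// exprM; move: (2 ^+ 15 : R) => x; ring.
rewrite sqr_nrm2.
apply: (@le_trans _ _ (2 * B * Vc ^+ 2 * dot g g)).
  apply: H.
  - by move=> i j; rewrite Kp_rf; exact: orth.
  - by move=> i j; rewrite m0 ?invr_ge0//= ge_min lexx.
  - by move=> i j; rewrite /v distC.
  (* With [x = 2^-|i-j|] the claim is [min(1, kap x^3) <= min(1, kap x)^3], which holds because
     [kap <= kap^3]. *)
  - move=> i j; rewrite /u ler_wpM2l//.
    have x0 : 0 <= (2^-1 : R) ^+ dist i j by rewrite exprn_ge0// invr_ge0.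
    have -> : (8^-1 : R) ^+ dist i j = (2^-1 ^+ dist i j) ^+ 3.
      by rewrite -exprM mulnC exprM; congr (_ ^+ _); field.
    rewrite /v; move: (2^-1 ^+ _) x0 => x x0.
    have [kx|kx] := leP 1 (kap * x); first by rewrite expr1n ge_min lexx.
    rewrite ge_min; apply/orP; right; rewrite exprMn ler_wpM2r ?exprn_ge0//.
    rewrite -[leLHS]expr1; apply: ler_weXn2l => //.
  - move=> i; rewrite /v.
    rewrite -(big_mkord xpredT (fun j => Num.min 1 (kap * 2^-1 ^+ dist i j))).
    apply: (le_trans (@sum_dist _ (fun r => Num.min 1 (kap * 2^-1 ^+ r)) n i _ (ltn_ord i))).
      by move=> r; rewrite m0// invr_ge0.
    by rewrite /Vc ler_wpM2l// sum_min1//; lra.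
rewrite /B; have -> : 2 * (2 ^+ 28 * A ^+ 2) * Vc ^+ 2 * dot g g = 2 ^+ 29 * (A ^+ 2 * Vc ^+ 2 * dot g g).
  by rewrite (exprS 2 28); ring.
apply: ler_wpM2r.
  by apply: mulr_ge0; [apply: mulr_ge0; exact: sqr_ge0|exact: dot_ge0].
apply: ler_weXn2l => //; lra.
Qed.

End L2_bound.

(** * Sharp truncations *)

Section truncation.
Context {R : realType}.
Implicit Types (z w : plane R) (f g h K : plane R -> R).
Notation Ig f := ((area R).-integrable setT (EFin \o f)).

Lemma pow_unbounded (x e b : R) : 0 < e -> 2 <= b -> exists n, x <= e * b ^+ n.
Proof.
move=> e0 b2; exists (Num.bound (`|x| / e)).
have h : `|x| / e < (Num.bound (`|x| / e))%:R by apply: archi_boundP; rewrite divr_ge0// ltW.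
set n := Num.bound _ in h *.
have h2 : (n%:R : R) <= b ^+ n.
  apply: (@le_trans _ _ (2 ^+ n)); first by rewrite -natrX ler_nat ltnW// ltn_expl.
  by apply: lerXn2r; rewrite ?nnegrE//; lra.
apply: (le_trans (ler_norm x)); rewrite mulrC -ler_pdivrMr//; lra.
Qed.

Lemma measurable_fun_cond (A : set (plane R)) f : measurable A -> measurable_fun setT f ->
  measurable_fun setT (fun z => f z * \1_A z).
Proof. by move=> mA mf; apply: measurable_funM => //; exact: measurable_indic. Qed.

Definition far (e : R) : set (plane R) := [set z | e < en z].

Lemma measurable_far e : measurable (far e).
Proof.
have -> : far e = setT `&` (@en R) @^-1` `]e, +oo[%classic.
  by rewrite setTI; apply/seteqP; split => z /=; rewrite in_itv/= andbT.
by apply: measurable_en => //; exact: measurable_itv.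
Qed.

Definition Ks K (e : R) z : R := K z * \1_(far e) z.

Lemma KsE K e z : Ks K e z = if e < en z then K z else 0.
Proof.
rewrite /Ks indicE; case: ifPn => h; first by rewrite mem_set// mulr1.
by rewrite memNset ?mulr0//; apply/negP.
Qed.

Lemma Ks_rf K e : rf (Ks K e) = Ks (rf K) e.
Proof. by apply/funext => z; rewrite /rf !KsE enN. Qed.

Definition tr K (e : R) g : plane R -> R := cv (Ks K e) g.

Section with_kernel.
Variables (A kap : R) (L : nat).
Hypothesis kL : kap <= 2 ^+ L.

Lemma measurable_Ks K e : czk A kap K -> measurable_fun setT (Ks K e).
Proof. by move=> cK; apply: measurable_fun_cond; [exact: measurable_far|exact: (czk_meas cK)]. Qed.

Lemma Ks_size K e z : czk A kap K -> 0 < e -> `|Ks K e z| <= A / e ^+ 2.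
Proof.
move=> cK e0; rewrite KsE; case: ifPn => h; first exact: (size_away cK e0 (ltW h)).
by rewrite normr0 divr_ge0 ?sqr_ge0//; exact: (czk_A cK).
Qed.

Lemma bdd_Ks K e : czk A kap K -> 0 < e -> bdd (Ks K e).
Proof. by move=> cK e0; apply: bddI; [exact: measurable_Ks|move=> z; exact: Ks_size]. Qed.

(** Sharp minus smooth truncation at the radius [e]. It lives on [e < |z| <= 2 e], so its [L^1] norm
    is [O(A)] uniformly in [e]. *)
Definition Kd K e z : R := Ks K e z - K z * cut e z.

Lemma measurable_Kd K e : czk A kap K -> measurable_fun setT (Kd K e).
Proof.
move=> cK; apply: measurable_funB; first exact: measurable_Ks.
by apply: measurable_funM; [exact: (czk_meas cK)|exact: measurable_cut].
Qed.

Lemma Kd_eq0 K e z : 0 < e -> 2 * e < en z -> Kd K e z = 0.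
Proof.
move=> e0 ez; rewrite /Kd KsE cut_eq1// ?ltW// mulr1 ifT ?subrr//; lra.
Qed.

Lemma Kd_size K e z : czk A kap K -> 0 < e -> `|Kd K e z| <= A / e ^+ 2.
Proof.
move=> cK e0; rewrite /Kd KsE; case: ifPn => h; last first.
  rewrite cut_eq0 ?mulr0 ?subr0 ?normr0 ?divr_ge0 ?sqr_ge0//; first exact: (czk_A cK).
  by rewrite leNgt.
rewrite -{1}(mulr1 (K z)) -mulrBr normrM.
have c0 := cut_ge0 e z; have c1 := cut_le1 e z.
rewrite (ger0_norm (_ : 0 <= 1 - cut e z)); last lra.
apply: (le_trans _ (size_away cK e0 (ltW h))).
by apply: ler_piMr => //; lra.
Qed.

Lemma bcs_Kd K e : czk A kap K -> 0 < e -> bcs (Kd K e).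
Proof.
move=> cK e0; have A0 := czk_A cK.
have Ae : 0 <= A / e ^+ 2 by rewrite divr_ge0// sqr_ge0.
apply: (@bcsI _ _ (A / e ^+ 2 + 2 * e)); first exact: measurable_Kd.
move=> z; split; first by have := Kd_size z cK e0; lra.
by move=> h; apply: Kd_eq0 => //; lra.
Qed.

Lemma nrm1_Kd K e : czk A kap K -> 0 < e -> nrm1 (Kd K e) <= 16 * A.
Proof.
move=> cK e0; rewrite nrm1E.
have e2 : 0 <= 2 * e by lra.
apply: (le_trans (@Int_le_sq _ _ 0 (2 * e) (A / e ^+ 2) (measurable_Kd _ cK) e2 _ _)).
- by move=> z; exact: Kd_size.
- move=> z zs; apply: Kd_eq0 => //; rewrite ltNge; apply/negP => h; apply: zs.
  by apply: en_sq; rewrite subr0.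
- rewrite le_eqVlt; apply/orP; left; apply/eqP; field; by rewrite gt_eqF.
Qed.

(** Cut sharply inside and smoothly outside. [Ks K e] has unbounded support and so falls outside the
    [L^2] theory above; [Kt] agrees with it up to the radius [e 8^n], which suffices on bounded
    regions ([tr_loc]). *)
Definition Kt K e n z : R := Kn K e n z + Kd K e z.

Lemma bcs_Kt K e n : czk A kap K -> 0 < e -> bcs (Kt K e n).
Proof. by move=> cK e0; apply: bcsD; [exact: (bcs_Kn _ cK)|exact: bcs_Kd]. Qed.

(** The uniform [L^2] constant: twice that of [nrm2_Kn], the second half absorbing the part [Kd]. *)
Definition Cb : R := 2 ^+ 16 * A * Vc L.

Lemma Cb_ge0 : 0 <= A -> 0 <= Cb.
Proof.
move=> A0; apply: mulr_ge0; last by have := @Vc_ge4 R L; lra.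
by apply: mulr_ge0 => //; exact: exprn_ge0.
Qed.

Lemma le_Cb : 0 <= A -> A <= Cb.
Proof.
move=> A0; rewrite /Cb; have := @Vc_ge4 R L; move: (Vc L) => V V4.
rewrite mulrAC; apply: ler_peMl => //; have : (1 : R) <= 2 ^+ 16 by apply: exprn_ege1; lra.
nra.
Qed.

Lemma nrm2_Kt K e n g : czk A kap K -> 0 < e -> bcs g ->
  nrm2 (cv (Kt K e n) g) <= Cb * nrm2 g.
Proof.
move=> cK e0 bg; have A0 := czk_A cK.
have b1 := bcs_Kn n cK e0; have b2 := bcs_Kd cK e0.
have -> : cv (Kt K e n) g = fun z => cv (Kn K e n) g z + cv (Kd K e) g z.
  by apply/funext => z; rewrite -cvDl//; exact: bcs_bdd.
apply: (le_trans (nrm2D (bcs_cv b1 bg) (bcs_cv b2 bg))).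
have h1 := nrm2_Kn kL n cK e0 bg.
have h2 : nrm2 (cv (Kd K e) g) <= 16 * A * nrm2 g.
  apply: (le_trans (nrm2_cv b2 bg)); apply: ler_wpM2r; first exact: nrm2_ge0.
  exact: nrm1_Kd.
have V4 := @Vc_ge4 R L.
have -> : Cb * nrm2 g = 2 ^+ 15 * A * Vc L * nrm2 g + 2 ^+ 15 * A * Vc L * nrm2 g.
  by rewrite /Cb (exprS 2 15); move: (2 ^+ 15 : R) => x; ring.
apply: lerD => //; apply: (le_trans h2); apply: ler_wpM2r; first exact: nrm2_ge0.
rewrite mulrAC; apply: ler_wpM2r => //.
apply: (@le_trans _ _ (2 ^+ 15 * 1)); first by rewrite mulr1; lra.
by apply: ler_wpM2l; [exact: exprn_ge0|lra].
Qed.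

Lemma Kt_Ks K e n z : 0 < e -> en z <= e * 8 ^+ n -> Kt K e n z = Ks K e z.
Proof.
move=> e0 ze; rewrite /Kt /Kn /Kd (@cut_eq0 _ (e * 8 ^+ n)) ?mulr_gt0 ?exprn_gt0//; ring.
Qed.

Lemma tr_loc K e n g (M : R) z : 0 < e -> bcsM M g -> en z + M <= e * 8 ^+ n ->
  tr K e g z = cv (Kt K e n) g z.
Proof.
move=> e0 gM ze; rewrite /tr !cvE; congr Int; apply/funext => w.
have [Mw|wM] := ltP M (en w); first by rewrite (gM w).2// !mulr0.
rewrite Kt_Ks//; apply: le_trans ze; apply: (le_trans (enD z (- (w : R * R)))).
by rewrite enN lerD2l.
Qed.

Lemma nrm2_indic_sq (a : plane R) r : 0 <= r -> nrm2 (\1_(sq a r) : plane R -> R) = 2 * r.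
Proof.
move=> r0; rewrite nrm2E dotE.
have -> : (fun z => \1_(sq a r) z * \1_(sq a r) z : R) = \1_(sq a r).
  by apply/funext => z; rewrite indicE; case: (_ \in _); rewrite ?mulr1 ?mulr0.
by rewrite Int_indic_sq// sqrtr_sqr ger0_norm// mulr_ge0.
Qed.

Lemma bcs_indic_sq (a : plane R) r : bcs (\1_(sq a r) : plane R -> R).
Proof.
apply: (@bcsI _ _ (1 + (en a + 2 * `|r|))); first exact: measurable_indic_sq.
move=> z; have := en_ge0 a; have := normr_ge0 r; split.
  by rewrite indicE; case: (_ \in _); rewrite ?normr1 ?normr0; lra.
move=> h; rewrite indicE memNset// => /sq_en za.
by have := en_subl z a; have := ler_norm r; lra.
Qed.

Lemma nrm2_norm f : nrm2 (fun z => `|f z|) = nrm2 f.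
Proof.
rewrite !nrm2E !dotE; congr (Num.sqrt (Int _)); apply/funext => z.
by rewrite -expr2 real_normK ?num_real// expr2.
Qed.

Lemma Int_sq_le_nrm2 f (a : plane R) r : bcs f -> 0 <= r ->
  Int (fun z => `|f z| * \1_(sq a r) z) <= nrm2 f * (2 * r).
Proof.
move=> bf r0; rewrite -(nrm2_indic_sq a r0) -(nrm2_norm f) -dotE.
by apply: dot_le; [exact: bcs_norm|exact: bcs_indic_sq].
Qed.

Lemma tr_bdd K e g : czk A kap K -> 0 < e -> bcs g -> bdd (tr K e g).
Proof. by move=> cK e0 bg; apply: bdd_cv => //; exact: bdd_Ks. Qed.

(** A local form of the [L^2] bound: [tr K e g] may have unbounded support, but on a square it
    coincides with a convolution by some [Kt], to which Cauchy-Schwarz and [nrm2_Kt] apply. *)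
Lemma tr_L1_sq K e g (a : plane R) r : czk A kap K -> 0 < e -> bcs g -> 0 <= r ->
  Int (fun z => `|tr K e g z| * \1_(sq a r) z) <= Cb * nrm2 g * (2 * r).
Proof.
move=> cK e0 bg r0; have [M [M0 gM]] := bcs_bound bg.
have b2 : (2 : R) <= 8 by lra.
have [n ne] := pow_unbounded (en a + 2 * r + M) e0 b2.
have -> : (fun z => `|tr K e g z| * \1_(sq a r) z) =
          (fun z => `|cv (Kt K e n) g z| * \1_(sq a r) z).
  apply/funext => z; have [za|za] := pselect (sq a r z); last by rewrite indicE memNset// !mulr0.
  rewrite (tr_loc K e0 gM (n := n))//; apply: le_trans ne.
  by have := sq_en za; have := en_subl z a; lra.
apply: (le_trans (Int_sq_le_nrm2 a (bcs_cv (bcs_Kt n cK e0) bg) r0)).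
by apply: ler_wpM2r; [lra|exact: nrm2_Kt].
Qed.

End with_kernel.
End truncation.

(** * Maximal truncations *)

Section dyadic_far.
Context {R : realType}.
Implicit Types (z w : plane R) (f g h u K : plane R -> R) (G : R -> R) (e : R).
Notation Ig f := ((area R).-integrable setT (EFin \o f)).

Definition fark (G : R -> R) (e : R) z : R := G (en z) * \1_(far e) z.

Lemma farkE G e z : fark G e z = if e < en z then G (en z) else 0.
Proof.
rewrite /fark indicE; case: ifPn => h; first by rewrite mem_set// mulr1.
by rewrite memNset ?mulr0//; apply/negP.
Qed.

Lemma measurable_fark G e : measurable_fun setT G -> measurable_fun setT (fark G e).
Proof.
move=> mG; apply: measurable_fun_cond; first exact: measurable_far.
by apply: measurableT_comp => //; exact: measurable_en.
Qed.

Lemma bdd_fark G e : measurable_fun setT G -> 0 < e ->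
  (forall r s, e <= r -> r <= s -> 0 <= G s <= G r) -> bdd (fark G e).
Proof.
move=> mG e0 anti; apply: (@bddI _ _ (G e)); first exact: measurable_fark.
move=> z; rewrite farkE; case: ifPn => h.
  by have /andP[g1 g2] := anti e (en z) (lexx _) (ltW h); rewrite ger0_norm.
by rewrite normr0; have /andP[] := anti e e (lexx _) (lexx _).
Qed.

(* Cut the complement of the disc of radius [e] into the annuli [e 2^i < |w - z| <= e 2^(i+1)]. *)
Lemma Int_far G e u z (lam S : R) : measurable_fun setT G -> 0 < e ->
  (forall r s, e <= r -> r <= s -> 0 <= G s <= G r) ->
  bcs u -> (forall w, 0 <= u w) -> 0 <= lam ->
  (forall r, e <= r -> Int (fun w => u w * \1_(sq z r) w) <= lam * r ^+ 2) ->
  (forall n, \sum_(0 <= i < n) G (e * 2 ^+ i) * (e * 2 ^+ i) ^+ 2 <= S) ->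
  Int (fun w => fark G e ((w : R * R) - z) * u w) <= 4 * lam * S.
Proof.
move=> mG e0 anti bu u0 l0 ulam GS.
have [M [M0 uM]] := bcs_bound bu.
have [N eN] := pow_unbounded (en z + M) e0 (lexx 2).
have e2 i : e <= e * 2 ^+ i by apply: ler_peMr; [exact: ltW|apply: exprn_ege1; lra].
have G0 i : 0 <= G (e * 2 ^+ i) by have /andP[] := anti e (e * 2 ^+ i) (lexx _) (e2 i).
pose H i w := G (e * 2 ^+ i) * (u w * \1_(sq z (e * 2 ^+ i.+1)) w).
have bH i : bcs (H i).
  by apply: bcsZ; apply: bcs_mul => //; exact: bcs_indic_sq.
have pt n w : en ((w : R * R) - z) <= e * 2 ^+ n ->
    fark G e ((w : R * R) - z) * u w <= \sum_(0 <= i < n) H i w.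
  elim: n => [|n ih] h.
    by rewrite big_nil farkE ifF ?mul0r//; rewrite expr0 mulr1 in h; apply/negbTE; rewrite -leNgt.
  have Hn0 : 0 <= H n w by apply: mulr_ge0 => //; apply: mulr_ge0 => //; rewrite indicE ler0n.
  rewrite big_nat_recr//=; have [h2|h2] := leP (en ((w : R * R) - z)) (e * 2 ^+ n).
    by apply: (le_trans (ih h2)); rewrite lerDl.
  apply: ler_wpDl.
    by apply: sumr_ge0 => i _; rewrite !mulr_ge0// indicE ler0n.
  rewrite /H indicE mem_set; last exact: en_sq.
  rewrite mulr1 ler_wpM2r// farkE; case: ifPn => // _.
  by have /andP[] := anti _ _ (e2 n) (ltW h2).
have sh : bdd (fun w => fark G e ((w : R * R) - z)).
  have [C [C0 HC]] := bdd_bound (bdd_fark mG e0 anti).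
  apply: (@bddI _ _ C) => //.
  apply: (measurableT_comp (measurable_fark e mG)).
  by apply: measurable_sub => //; exact: measurable_cst.
apply: (@le_trans _ _ (Int (fun w => \sum_(0 <= i < N) H i w))).
  apply: Int_le => [||w].
  - by apply: bcs_Ig; exact: bdd_mul_bcs.
  - by apply: bcs_Ig; exact: bcs_sum.
  - have [Mw|wM] := ltP M (en w).
      rewrite (uM w).2// mulr0; apply: sumr_ge0 => i _.
      by apply: mulr_ge0 => //; apply: mulr_ge0 => //; rewrite indicE ler0n.
    apply: pt; apply: le_trans eN; apply: (le_trans (enD w (- (z : R * R)))).
    by rewrite enN addrC lerD2l.
rewrite Int_sum// -mulrA.
apply: (@le_trans _ _ (\sum_(0 <= i < N) 4 * (lam * (G (e * 2 ^+ i) * (e * 2 ^+ i) ^+ 2)))).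
  apply: ler_sum => i _; rewrite IntZ; last first.
    by apply: bcs_Ig; apply: bcs_mul => //; exact: bcs_indic_sq.
  apply: (le_trans (ler_wpM2l (G0 i) (ulam _ (e2 i.+1)))).
  by rewrite (exprS 2 i) le_eqVlt; apply/orP; left; apply/eqP; ring.
by rewrite -!mulr_sumr ler_wpM2l// ler_wpM2l.
Qed.

Lemma Int_sq_bound u (F : R) z r : bcs u -> (forall w, 0 <= u w <= F) -> 0 <= r ->
  Int (fun w => u w * \1_(sq z r) w) <= 4 * F * r ^+ 2.
Proof.
move=> bu uF r0.
have -> : 4 * F * r ^+ 2 = F * (2 * r) ^+ 2 by ring.
rewrite -(Int_indic_sq z r0) -IntZ; last exact: Ig_indic_sq.
apply: Int_le => [||w].
- by apply: bcs_Ig; apply: bcs_mul => //; exact: bcs_indic_sq.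
- by apply: bcs_Ig; apply: bcsZ; exact: bcs_indic_sq.
- by rewrite ler_wpM2r ?indicE ?ler0n//; case/andP: (uF w).
Qed.

(** Writing the inverse as [x] times the power [-1] of [x^2] gives [powR] a nonnegative base; both
    sides vanish at [0]. *)
Lemma measurable_invr : measurable_fun setT (fun x : R => x^-1).
Proof.
have -> : (fun x : R => x^-1) = (fun x => x * (x ^+ 2) `^ (-1)).
  apply/funext => x; rewrite powR_inv1 ?sqr_ge0//.
  have [->|x0] := eqVneq x 0; first by rewrite mul0r invr0.
  by rewrite expr2 invfM mulrA divff// mul1r.
apply: measurable_funM => //.
apply: (measurableT_comp (measurable_powR _)); exact: measurable_funX.
Qed.

Definition G3 (r : R) : R := (r ^+ 3)^-1.

Lemma measurable_G3 : measurable_fun setT G3.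
Proof. by apply: (measurableT_comp measurable_invr); exact: measurable_funX. Qed.

Lemma G3_anti (e r s : R) : 0 < e -> e <= r -> r <= s -> 0 <= G3 s <= G3 r.
Proof.
move=> e0 er rs; rewrite /G3 invr_ge0 exprn_ge0 ?lef_pV2 ?posrE ?exprn_gt0 ?lerXn2r ?nnegrE//; lra.
Qed.

Lemma G3_sum e n : 0 < e -> \sum_(0 <= i < n) G3 (e * 2 ^+ i) * (e * 2 ^+ i) ^+ 2 <= 2 / e.
Proof.
move=> e0; have -> : \sum_(0 <= i < n) G3 (e * 2 ^+ i) * (e * 2 ^+ i) ^+ 2 =
    e^-1 * \sum_(0 <= i < n) (2^-1 : R) ^+ i.
  rewrite mulr_sumr; apply: eq_bigr => i _; rewrite /G3 exprVn.
  have p0 : (2 : R) ^+ i != 0 by rewrite expf_neq0.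
  have en0 : e != 0 by rewrite gt_eqF.
  by field; rewrite en0 p0.
by rewrite mulrC ler_wpM2r ?sum_half// invr_ge0 ltW.
Qed.

(** The profile of a kernel difference [K (z - w) - K (z0 - w)] at distance [r] when [|z - z0|] is
    at most of order [e]: size for [r] up to [kap e], smoothness beyond. Its sum over dyadic annuli
    is logarithmic in [kap], whereas the pure smoothness profile [G3] would lose a factor [kap]. *)
Definition Gm (kap e : R) (r : R) : R := Num.min 1 (kap * (e / r)) / r ^+ 2.

Lemma measurable_Gm kap e : measurable_fun setT (Gm kap e).
Proof.
apply: measurable_funM; last by apply: (measurableT_comp measurable_invr); exact: measurable_funX.
apply: measurable_minr; first exact: measurable_cst.
apply: measurable_funM; first exact: measurable_cst.
by apply: measurable_funM; [exact: measurable_cst|exact: measurable_invr].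
Qed.

Lemma Gm_anti kap e (r s : R) : 0 <= kap -> 0 < e -> e <= r -> r <= s -> 0 <= Gm kap e s <= Gm kap e r.
Proof.
move=> k0 e0 er rs; have r0 : 0 < r by lra. have s0 : 0 < s by lra.
have m0 : 0 <= Num.min 1 (kap * (e / s)).
  by rewrite le_min ler01/= !mulr_ge0// ?invr_ge0 ltW.
rewrite /Gm divr_ge0 ?sqr_ge0//=; apply: ler_pM => //.
- by rewrite invr_ge0 sqr_ge0.
- rewrite le_min ge_min lexx/= ge_min; apply/orP; right.
  by rewrite ler_wpM2l// ler_wpM2l ?(ltW e0)// lef_pV2.
- by rewrite lef_pV2 ?posrE ?exprn_gt0// lerXn2r ?nnegrE// ltW.
Qed.

Lemma Gm_sum kap e n L : 0 <= kap -> kap <= 2 ^+ L -> 0 < e ->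
  \sum_(0 <= i < n) Gm kap e (e * 2 ^+ i) * (e * 2 ^+ i) ^+ 2 <= L%:R + 2.
Proof.
move=> k0 kL e0; apply: le_trans (sum_min1 n k0 kL).
apply: ler_sum => i _; rewrite /Gm.
have p0 : (2 : R) ^+ i != 0 by rewrite expf_neq0.
have en0 : e != 0 by rewrite gt_eqF.
rewrite mulfVK ?expf_neq0 ?mulf_neq0//.
have -> : e / (e * 2 ^+ i) = 2^-1 ^+ i by rewrite exprVn; field; rewrite en0 p0.
by [].
Qed.

End dyadic_far.

(** * Maximal function over squares *)

Section maximal_function.
Context {R : realType}.
Implicit Types (z w : plane R) (u : plane R -> R).
Notation Ig f := ((area R).-integrable setT (EFin \o f)).
Notation cell := ((R * R) * R)%type.
Implicit Types (Q : cell) (l : seq cell).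

Definition Us l : set (plane R) := [set z | exists2 Q, Q \in l & sq Q.1 Q.2 z].

Lemma measurable_Us l : measurable (Us l).
Proof.
elim: l => [|Q l ih].
  by rewrite (_ : Us [::] = set0)//; apply/seteqP; split => z // -[].
rewrite (_ : Us (Q :: l) = sq Q.1 Q.2 `|` Us l).
  by apply: measurableU => //; exact: measurable_sq.
apply/seteqP; split => z.
  by move=> [Q']; rewrite inE => /predU1P[->|Q'l] zQ; [left|right; exists Q'].
move=> [zQ|[Q' Q'l zQ]]; first by exists Q => //; rewrite mem_head.
by exists Q' => //; rewrite inE Q'l orbT.
Qed.

Definition meets Q Q' : bool :=
  (`|Q.1.1 - Q'.1.1| <= Q.2 + Q'.2) && (`|Q.1.2 - Q'.1.2| <= Q.2 + Q'.2).

Lemma meetsP Q Q' z : sq Q.1 Q.2 z -> sq Q'.1 Q'.2 z -> meets Q Q'.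
Proof.
move=> [a1 a2] [b1 b2]; rewrite distrC in a1; rewrite distrC in a2.
apply/andP; split.
  by apply: (le_trans (ler_distD (z.1 : R) _ _)); exact: lerD.
by apply: (le_trans (ler_distD (z.2 : R) _ _)); exact: lerD.
Qed.

Lemma meets_sub Q Q' : meets Q Q' -> Q'.2 <= Q.2 -> sq Q'.1 Q'.2 `<=` sq Q.1 (3 * Q.2).
Proof.
move=> /andP[m1 m2] QQ z [a1 a2]; rewrite distrC in m1; rewrite distrC in m2; split.
  by have := ler_distD (Q'.1.1) (z.1 : R) Q.1.1; lra.
by have := ler_distD (Q'.1.2) (z.2 : R) Q.1.2; lra.
Qed.

Lemma bcs_indic u (B : set (plane R)) : bcs u -> measurable B -> bcs (fun w => u w * \1_B w).
Proof.
move=> bu mB; have mi : measurable_fun setT (\1_B : plane R -> R) by apply: measurable_indic.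
apply: (@bcsM_bd _ u (\1_B) 1 bu mi) => z.
by rewrite indicE; case: (_ \in _); rewrite ?normr1 ?normr0.
Qed.

Lemma max_cell l Q0 : Q0 \in l -> exists2 Q, Q \in l & forall Q', Q' \in l -> Q'.2 <= Q.2.
Proof.
elim: l Q0 => [//|Q l ih] Q0 _.
case: l ih => [|Q1 l] ih; first by exists Q; rewrite ?mem_head// => Q'; rewrite inE => /eqP->.
have [Q2 Q2l Q2m] := ih Q1 (mem_head _ _).
have [h|h] := leP Q.2 Q2.2.
  exists Q2; first by rewrite inE Q2l orbT.
  by move=> Q'; rewrite inE => /predU1P[->//|]; exact: Q2m.
exists Q; first by rewrite mem_head.
move=> Q'; rewrite inE => /predU1P[->//|/Q2m h2]; exact: le_trans h2 (ltW h).
Qed.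

Variables (u : plane R -> R) (lam : R).
Hypotheses (bu : bcs u) (u0 : forall z, 0 <= u z) (l0 : 0 < lam).

(** As [Q.2] is half the side, this says that the average of [u] over the square exceeds
    [lam / 4]. *)
Definition bad Q : bool := (0 < Q.2) && (lam * Q.2 ^+ 2 < Int (fun w => u w * \1_(sq Q.1 Q.2) w)).

(* Vitali: discard the cells meeting the largest one, whose triple covers them. *)
Lemma vitali_cells l : all bad l ->
  (area R (Us l) <= (36 / lam * Int (fun w => u w * \1_(Us l) w))%:E)%E.
Proof.
elim: {l}(size l) {-2}l (leqnn (size l)) => [|n ih] l sl bl.
  move: sl; rewrite leqn0 => /eqP/size0nil ->.
  rewrite (_ : Us [::] = set0); last by apply/seteqP; split => z // -[].
  rewrite measure0 lee_fin mulr_ge0 ?divr_ge0 ?(ltW l0)//.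
  by apply: Int_ge0 => z; rewrite mulr_ge0// indicE ler0n.
have [->|[Q0 Q0l]] : l = [::] \/ exists Q0, Q0 \in l.
- by case: l {sl bl} => [|Q l]; [left|right; exists Q; rewrite mem_head].
- rewrite (_ : Us [::] = set0); last by apply/seteqP; split => z // -[].
  rewrite measure0 lee_fin mulr_ge0 ?divr_ge0 ?(ltW l0)//.
  by apply: Int_ge0 => z; rewrite mulr_ge0// indicE ler0n.
have [Q Ql Qm] := max_cell Q0l.
have /andP[Qp Qbad] := allP bl _ Ql.
pose l' := [seq Q' <- l | ~~ meets Q Q'].
have QQ : meets Q Q by rewrite /meets !subrr !normr0 addr_ge0// ltW.
have sl' : (size l' <= n)%N.
  rewrite -ltnS; apply: leq_trans sl; rewrite size_filter -(count_predC (meets Q) l).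
  by rewrite -add1n leq_add2r -has_count; apply/hasP; exists Q.
have bl' : all bad l' by apply/allP => Q'; rewrite mem_filter => /andP[_ /(allP bl)].
have IH := ih l' sl' bl'.
have mQ3 : measurable (sq (Q.1 : plane R) (3 * Q.2)) by exact: measurable_sq.
have mQ : measurable (sq (Q.1 : plane R) Q.2) by exact: measurable_sq.
have mU := measurable_Us l; have mU' := measurable_Us l'.
apply: (@le_trans _ _ (area R (sq (Q.1 : plane R) (3 * Q.2) `|` Us l'))).
  apply: le_measure; rewrite ?inE//; first exact: measurableU.
  move=> z [Q' Q'l zQ']; have [h|h] := boolP (meets Q Q').
    by left; apply: (meets_sub h (Qm _ Q'l)).
  by right; exists Q' => //; rewrite mem_filter h.
apply: (le_trans (measureU2 _ mQ3 mU')).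
rewrite [X in (X + _)%E]area_sq; last by lra.
apply: (le_trans (leeD2l _ IH)); rewrite -EFinD lee_fin.
have D : Int (fun w => u w * \1_(sq (Q.1 : plane R) Q.2) w) + Int (fun w => u w * \1_(Us l') w) <=
         Int (fun w => u w * \1_(Us l) w).
  have bQ := bcs_indic bu mQ; have bU := bcs_indic bu mU; have bU' := bcs_indic bu mU'.
  rewrite -IntD; [|exact: bcs_Ig..].
  apply: Int_le; [by apply: bcs_Ig; exact: bcsD|exact: bcs_Ig|].
  move=> w; rewrite -mulrDr ler_wpM2l// !indicE.
  have [wU|wU] := boolP (w \in Us l); last first.
    rewrite !memNset ?addr0//.
      by move=> [Q']; rewrite mem_filter => /andP[_ Q'l] wQ'; move/negP: wU; apply; rewrite inE; exists Q'.
    by move=> wQ; move/negP: wU; apply; rewrite inE; exists Q.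
  have [wQ|wQ] := boolP (w \in sq (Q.1 : plane R) Q.2); last by rewrite add0r lern1 leq_b1.
  rewrite memNset ?addr0//.
  move=> [Q']; rewrite mem_filter => /andP[/negP h _] wQ'; apply: h.
  by apply: meetsP wQ'; rewrite inE in wQ.
apply: (@le_trans _ _ (36 / lam * (Int (fun w => u w * \1_(sq (Q.1 : plane R) Q.2) w) + Int (fun w => u w * \1_(Us l') w)))).
  rewrite mulrDr lerD2r.
  have -> : (2 * (3 * Q.2)) ^+ 2 = 36 / lam * (lam * Q.2 ^+ 2) by field; rewrite gt_eqF.
  by apply: ler_wpM2l; [rewrite divr_ge0// ltW|exact: ltW].
by apply: ler_wpM2l => //; rewrite divr_ge0// ltW.
Qed.

(** The bad squares with rational data among the first [n] codes. Their unions increase with [n], so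
    the exceptional set is a countable union of measurable sets whose area is the limit of areas of
    finite unions. *)
Definition cells n : seq cell :=
  [seq Q <- pmap (fun i => omap (fun q : rat * rat * rat => (ratr q.1.1, ratr q.1.2, ratr q.2) : cell)
    (unpickle i)) (iota 0 n) | bad Q].

(** Weak type (1,1) of the maximal function over squares. The square of half side [r] about [z] lies
    in a square with rational centre within [r] of [z] and rational half side between [2 r] and
    [4 r]; off [E] that square is not bad, whence the factor [16 = 4^2]. *)
Lemma maximal_weak : exists E, [/\ measurable E, (area R E <= (36 / lam * Int u)%:E)%E &
  forall z r, ~ E z -> 0 < r -> Int (fun w => u w * \1_(sq z r) w) <= 16 * lam * r ^+ 2].
Proof.
pose F n := Us (cells n).
have mF n : measurable (F n) by exact: measurable_Us.
have mE : measurable (\bigcup_n F n) by exact: bigcupT_measurable.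
have ndF : nondecreasing_seq F.
  move=> m n mn; apply/subsetPset => z [Q]; rewrite mem_filter => /andP[bQ].
  rewrite mem_pmap => /mapP[j + Qj zQ]; rewrite mem_iota add0n => /andP[_ jm].
  exists Q => //; rewrite mem_filter bQ mem_pmap; apply/mapP; exists j => //.
  by rewrite mem_iota add0n/= (leq_trans jm).
exists (\bigcup_n F n); split => //.
  have cv := nondecreasing_cvg_mu mF mE ndF (mu := area R).
  rewrite -(cvg_lim _ cv)//; apply: lime_le; first by apply/cvg_ex; exists (area R (\bigcup_n F n)).
  near=> n; have bl : all bad (cells n) by exact: filter_all.
  apply: (le_trans (vitali_cells bl)); rewrite lee_fin ler_wpM2l ?divr_ge0 ?(ltW l0)//.
  apply: Int_le; [by apply: bcs_Ig; apply: bcs_indic => //; exact: measurable_Us|exact: bcs_Ig|move=> w].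
  by rewrite ler_piMr// indicE lern1 leq_b1.
move=> z r zE r0.
have [q1] := @rat_in_itvoo R ((z.1 : R) - r) ((z.1 : R) + r) ltac:(lra).
have [q2] := @rat_in_itvoo R ((z.2 : R) - r) ((z.2 : R) + r) ltac:(lra).
have [q3] := @rat_in_itvoo R (2 * r) (4 * r) ltac:(lra).
rewrite !in_itv/= => /andP[h5 h6] /andP[h3 h4] /andP[h1 h2].
pose Q : cell := (ratr q1, ratr q2, ratr q3).
have zQ : sq Q.1 Q.2 z by split; rewrite /Q/= ler_norml; apply/andP; split; lra.
have nb : ~~ bad Q.
  apply/negP => bQ; apply: zE; exists (pickle (q1, q2, q3)).+1 => //; exists Q => //.
  rewrite mem_filter bQ mem_pmap; apply/mapP; exists (pickle (q1, q2, q3)).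
    by rewrite mem_iota add0n/= ltnS leqnn.
  by rewrite pickleK.
have Qp : 0 < Q.2 by rewrite /Q/=; lra.
move: nb; rewrite negb_and Qp/= -leNgt => nb.
apply: (@le_trans _ _ (Int (fun w => u w * \1_(sq Q.1 Q.2) w))).
  apply: Int_le; [by apply: bcs_Ig; apply: bcs_indic => //; exact: measurable_sq..|move=> w].
  rewrite ler_wpM2l// !indicE.
  have [|_] := boolP (w \in sq z r); last by rewrite ler0n.
  rewrite inE => -[]; rewrite !ler_distl => /andP[a1 a2] /andP[a3 a4].
  by rewrite mem_set//; split; rewrite /Q/= ler_distl; apply/andP; split; lra.
apply: (le_trans nb); rewrite /Q/=.
have -> : 16 * lam * r ^+ 2 = lam * (4 * r) ^+ 2 by ring.
by rewrite ler_wpM2l ?(ltW l0)// lerXn2r ?nnegrE//; lra.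
Unshelve. all: by end_near.
Qed.

End maximal_function.

(** * Cotlar's inequality and the weak type estimate *)

Section weak_type.
Context {R : realType}.
Implicit Types (z w y : plane R) (f g h K : plane R -> R).
Variables (A kap : R) (L : nat).
Hypothesis kL : kap <= 2 ^+ L.
Notation Cb := (Cb A L).

Lemma bdd_indic_bcs g (a : plane R) r : bdd g -> bcs (fun z => g z * \1_(sq a r) z).
Proof. by move=> bg; apply: bdd_mul_bcs => //; exact: bcs_indic_sq. Qed.

Lemma indic_sqr (B : set (plane R)) z : \1_B z * \1_B z = \1_B z :> R.
Proof. by rewrite indicE; case: (_ \in _); rewrite ?mulr1 ?mulr0. Qed.

Lemma sqrtr_mul_sqr (l r : R) : 0 <= r -> Num.sqrt l * r = Num.sqrt (l * r ^+ 2).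
Proof.
move=> r0; have [l0|/ltW l0] := leP 0 l; first by rewrite sqrtrM// sqrtr_sqr ger0_norm.
have h : l * r ^+ 2 <= 0 by apply: mulr_le0_ge0 => //; exact: sqr_ge0.
by rewrite (ler0_sqrtr l0) (ler0_sqrtr h) mul0r.
Qed.

Lemma CS_sq g (a : plane R) (r l : R) : bdd g -> 0 <= r ->
  Int (fun z => g z ^+ 2 * \1_(sq a r) z) <= l * r ^+ 2 ->
  Int (fun z => `|g z| * \1_(sq a r) z) <= 2 * Num.sqrt l * r ^+ 2.
Proof.
move=> bg r0 H; have bi := bdd_indic_bcs a r bg.
have E : nrm2 (fun z => g z * \1_(sq a r) z) <= Num.sqrt l * r.
  rewrite sqrtr_mul_sqr//.
  rewrite nrm2E; apply: ler_wsqrtr; apply: le_trans H.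
  rewrite dotE le_eqVlt; apply/orP; left; apply/eqP; congr Int; apply/funext => z.
  by rewrite mulrACA indic_sqr expr2.
have -> : (fun z => `|g z| * \1_(sq a r) z) = fun z => `|g z * \1_(sq a r) z| * \1_(sq a r) z.
  apply/funext => z; rewrite normrM (ger0_norm (_ : 0 <= \1_(sq a r) z)) ?indicE ?ler0n//.
  by rewrite -mulrA -!indicE indic_sqr.
apply: (le_trans (Int_sq_le_nrm2 a bi r0)).
have -> : 2 * Num.sqrt l * r ^+ 2 = (Num.sqrt l * r) * (2 * r) by ring.
by apply: ler_wpM2r => //; lra.
Qed.

(* Compare the truncated integral at [z] with the average over a small square of the
   integral at finer truncation. *)
Lemma cotlar_pt K f (d e l1 l2 : R) z : czk A kap K -> bcs f -> 0 < d -> 4 * d <= e ->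
  (forall r, 0 < r -> Int (fun w => f w ^+ 2 * \1_(sq z r) w) <= l1 * r ^+ 2) ->
  Int (fun w => tr K d f w ^+ 2 * \1_(sq z (e / 8)) w) <= l2 * (e / 8) ^+ 2 ->
  `|tr K e f z| <= (4 * Cb + 4 * A * kap) * Num.sqrt l1 + Num.sqrt l2 / 2.
Proof.
move=> cK bf d0 de H1 H2; have A0 := czk_A cK; have k1 := czk_kap cK.
have e0 : 0 < e by lra.
have C0 := Cb_ge0 L A0.
pose r := e / 8; have r0 : 0 < r by rewrite /r; lra.
have er : e = 8 * r by rewrite /r; field.
(* [F] splits [f] into [f1], supported in the disc of radius [e] about [z], and [f2], supported
   outside it. *)
pose F w : R := \1_(far e) ((w : R * R) - z).
have F01 w : 0 <= F w <= 1 by rewrite /F indicE ler0n lern1 leq_b1.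
have mF : measurable_fun setT F.
  apply: (@measurableT_comp _ _ _ _ _ _ (\1_(far e) : plane R -> R)).
    by apply: measurable_indic; exact: measurable_far.
  by apply: measurable_sub => //; exact: measurable_cst.
have bf2 : bcs (fun w => f w * F w).
  apply: (@bcsM_bd _ f F 1) => // w; have /andP[? ?] := F01 w; by rewrite ger0_norm.
have bf1 : bcs (fun w => f w * (1 - F w)).
  apply: (@bcsM_bd _ f (fun w => 1 - F w) 1) => //.
    by apply: measurable_funB => //; exact: measurable_cst.
  by move=> w; have /andP[? ?] := F01 w; rewrite ger0_norm; lra.
set f1 := (fun w => f w * (1 - F w)) in bf1; set f2 := (fun w => f w * F w) in bf2.
have bK := bdd_Ks cK d0.
have fE y : tr K d f y = tr K d f1 y + tr K d f2 y.
  by rewrite /tr -cvDr//; congr (cv _ _ y); apply/funext => w; rewrite /f1 /f2; ring.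
have farz w : F w != 0 -> e < en ((w : R * R) - z).
  rewrite /F indicE; have [|_] := boolP (_ \in _); last by rewrite eqxx.
  by rewrite inE.
have Fnear w : ~~ (e < en ((w : R * R) - z)) -> F w = 0.
  by move=> h; apply/eqP; apply: contraNT h; exact: farz.
have trz : tr K e f z = Int (fun w => K ((z : R * R) - w) * f2 w).
  rewrite /tr cvE; congr Int; apply/funext => w; rewrite KsE enB /f2.
  case: ifPn => h; last by rewrite Fnear ?mulr0 ?mul0r.
  by rewrite /F indicE mem_set// mulr1.
(* Here [|y - z| <= 2 r = e / 4], so on the support of [f2] the distance to [y] exceeds [3 e / 4],
   hence [d]: the truncation at [d] is not felt. *)
have try y : sq z r y -> tr K d f2 y = Int (fun w => K ((y : R * R) - w) * f2 w).
  move=> zy; rewrite /tr cvE; congr Int; apply/funext => w; rewrite KsE.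
  case: ifPn => // h; rewrite /f2; have [->|/farz h2] := eqVneq (F w) 0; first by rewrite !mulr0.
  exfalso; move: h; rewrite -leNgt; have := sq_en zy.
  have := enD ((w : R * R) - y) ((y : R * R) - z); rewrite addrA subrK (enB w y); lra.
have Iz : bcs (fun w => K ((z : R * R) - w) * f2 w).
  have -> : (fun w => K ((z : R * R) - w) * f2 w) = (fun w => Ks K e ((z : R * R) - w) * f w).
    apply/funext => w; rewrite KsE enB /f2.
    case: ifPn => h; last by rewrite Fnear ?mulr0 ?mul0r.
    by rewrite /F indicE mem_set// mulr1.
  by apply: bdd_mul_bcs => //; apply: bdd_shift; exact: (bdd_Ks cK e0).
have Iy y : sq z r y -> bcs (fun w => K ((y : R * R) - w) * f2 w).
  move=> zy.
  have -> : (fun w => K ((y : R * R) - w) * f2 w) = (fun w => Ks K d ((y : R * R) - w) * f2 w).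
    apply/funext => w; rewrite KsE.
    case: ifPn => // h; rewrite /f2; have [->|/farz h2] := eqVneq (F w) 0; first by rewrite !mulr0.
    exfalso; move: h; rewrite -leNgt; have := sq_en zy.
    have := enD ((w : R * R) - y) ((y : R * R) - z); rewrite addrA subrK (enB w y); lra.
  by apply: bdd_mul_bcs => //; exact: bdd_shift.
have D1 y : sq z r y -> `|tr K d f2 y - tr K e f z| <= 4 * A * kap * Num.sqrt l1.
  move=> zy; have ezy := sq_en zy; rewrite trz try// -IntB; [|exact: bcs_Ig (Iy _ zy)|exact: bcs_Ig].
  have bD := bcsB (Iy _ zy) Iz.
  apply: (le_trans (Int_abs (bcs_Ig bD))).
  have anti s t : e <= s -> s <= t -> 0 <= G3 t <= G3 s by exact: G3_anti.
  have bnf := bcs_norm bf.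
  have bfar : bcs (fun w => fark (@G3 R) e ((w : R * R) - z) * `|f w|).
    apply: bdd_mul_bcs => //.
    have [C [Cp HC]] := bdd_bound (bdd_fark (@measurable_G3 R) e0 anti).
    apply: (@bddI _ _ C) => //.
    apply: (measurableT_comp (measurable_fark e (@measurable_G3 R))).
    by apply: measurable_sub => //; exact: measurable_cst.
  have Ak0 : 0 <= A * kap * (2 * r) by rewrite !mulr_ge0//; lra.
  apply: (@le_trans _ _ (A * kap * (2 * r) * Int (fun w => fark (@G3 R) e ((w : R * R) - z) * `|f w|))).
    rewrite -IntZ; last exact: bcs_Ig.
    apply: Int_le; [by apply: bcs_Ig; exact: bcs_norm|by apply: bcs_Ig; exact: bcsZ|move=> w].
    rewrite farkE -mulrBl normrM /f2 normrM.
    case: ifPn => h; last by rewrite Fnear// normr0 !mulr0 mul0r mulr0.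
    rewrite {1}/F indicE mem_set// normr1 mulr1 mulrA ler_wpM2r//.
    have hz : 2 * en ((z : R * R) - y) <= en ((z : R * R) - w).
      by rewrite (enB z y) (enB z w); lra.
    have := czk_smooth cK hz.
    have -> : (z : R * R) - w - ((z : R * R) - y) = (y : R * R) - w.
      by rewrite opprB addrC addrA subrK.
    move=> /le_trans; apply; rewrite /G3 (enB z w).
    apply: ler_wpM2r; first by rewrite invr_ge0 exprn_ge0 ?en_ge0.
    by rewrite ler_wpM2l ?mulr_ge0//; [lra|rewrite enB; lra].
  have lam0 : 0 <= 2 * Num.sqrt l1 by rewrite mulr_ge0// sqrtr_ge0.
  have IF : Int (fun w => fark (@G3 R) e ((w : R * R) - z) * `|f w|) <= 4 * (2 * Num.sqrt l1) * (2 / e).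
    apply: (@Int_far _ (@G3 R) e (fun w => `|f w|) z (2 * Num.sqrt l1) (2 / e)) => //.
    - exact: measurable_G3.
    - by move=> t et; apply: CS_sq; [exact: bcs_bdd|lra|apply: H1; lra].
    - by move=> n; exact: G3_sum.
  apply: (le_trans (ler_wpM2l Ak0 IF)).
  by rewrite er le_eqVlt; apply/orP; left; apply/eqP; field; rewrite gt_eqF.
have bQ := @bcs_indic_sq R z r; have r0' := ltW r0.
have bT := tr_bdd cK d0 bf; have bT1 := tr_bdd cK d0 bf1.
have I1 : Int (fun y => `|tr K d f y| * \1_(sq z r) y) <= 2 * Num.sqrt l2 * r ^+ 2 by exact: CS_sq.
have I2 : Int (fun y => `|tr K d f1 y| * \1_(sq z r) y) <= 16 * Cb * Num.sqrt l1 * r ^+ 2.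
  apply: (le_trans (tr_L1_sq kL z cK d0 bf1 r0')).
  have N1 : nrm2 f1 <= Num.sqrt l1 * (8 * r).
    rewrite -er sqrtr_mul_sqr; last exact: ltW.
    rewrite nrm2E; apply: ler_wsqrtr; apply: le_trans (H1 e e0); rewrite dotE.
    have bff : bcs (fun w => f w ^+ 2).
      by have := bcs_mul bf bf; under eq_fun do rewrite -expr2.
    apply: Int_le => [||w].
    - by apply: bcs_Ig; exact: bcs_mul.
    - by apply: bcs_Ig; apply: bcs_mul => //; exact: bcs_indic_sq.
    - rewrite /f1; have [h|h] := boolP (e < en ((w : R * R) - z)).
        have -> : F w = 1 by rewrite /F indicE mem_set.
        rewrite subrr !mulr0; apply: mulr_ge0; first exact: sqr_ge0.
        by case/andP: (F01 z) => _ _; rewrite indicE ler0n.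
      rewrite Fnear// subr0 mulr1 -expr2 indicE mem_set ?mulr1//.
      by apply: en_sq; rewrite leNgt.
  have -> : 16 * Cb * Num.sqrt l1 * r ^+ 2 = Cb * (Num.sqrt l1 * (8 * r)) * (2 * r) by ring.
  by apply: ler_wpM2r; [lra|apply: ler_wpM2l].
pose D := 4 * A * kap * Num.sqrt l1.
(* Integrate over [y] in the small square the inequality [|T_e f (z)| <= |T_d f (y)| + |T_d f1 (y)|
   + D], which follows from [D1] and [f = f1 + f2]. *)
have tot : `|tr K e f z| * (2 * r) ^+ 2 <= 2 * Num.sqrt l2 * r ^+ 2 + 16 * Cb * Num.sqrt l1 * r ^+ 2 + D * (2 * r) ^+ 2.
  rewrite -(Int_indic_sq z r0') -!IntZ; [|exact: bcs_Ig..].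
  apply: (@le_trans _ _ (Int (fun y => `|tr K d f y| * \1_(sq z r) y) +
    Int (fun y => `|tr K d f1 y| * \1_(sq z r) y) + Int (fun y => D * \1_(sq z r) y))); last first.
    by rewrite lerD2r; exact: lerD.
  have b1 : bcs (fun y => `|tr K d f y| * \1_(sq z r) y).
    apply: bdd_indic_bcs; have [C [C1 HC]] := bdd_bound bT; apply: (@bddI _ _ C).
      by apply: measurableT_comp => //; exact: bdd_measurable.
    by move=> y; rewrite normr_id.
  have b2 : bcs (fun y => `|tr K d f1 y| * \1_(sq z r) y).
    apply: bdd_indic_bcs; have [C [C1 HC]] := bdd_bound bT1; apply: (@bddI _ _ C).
      by apply: measurableT_comp => //; exact: bdd_measurable.
    by move=> y; rewrite normr_id.
  have b3 := bcsZ D bQ.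
  rewrite -IntD; [|exact: bcs_Ig..]; rewrite -IntD; [|by apply: bcs_Ig => //; exact: bcsD..].
  apply: Int_le => [||y].
  - by apply: bcs_Ig; exact: bcsZ.
  - by apply: bcs_Ig; apply: bcsD => //; exact: bcsD.
  rewrite -!mulrDl; have [zy|zy] := pselect (sq z r y); last by rewrite indicE memNset// !mulr0.
  rewrite indicE mem_set// !mulr1.
  have := D1 y zy; have -> : tr K d f2 y = tr K d f y - tr K d f1 y by rewrite fE; ring.
  rewrite -/D; move: (tr K e f z) (tr K d f y) (tr K d f1 y) => a b c H.
  have -> : a = (b - c) - ((b - c) - a) by ring.
  apply: (le_trans (ler_normB _ _)); have := ler_normB b c; lra.
have r2 : 0 < r ^+ 2 by exact: exprn_gt0.
rewrite -(@ler_pM2r _ (4 * r ^+ 2)); last by rewrite mulr_gt0.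
have -> : `|tr K e f z| * (4 * r ^+ 2) = `|tr K e f z| * (2 * r) ^+ 2 by ring.
by apply: (le_trans tot); rewrite le_eqVlt; apply/orP; left; apply/eqP; rewrite /D; field.
Qed.

(** The lower limit is an increasing union of intersections, each contained in one [E n]. A point
    outside it avoids [E n] for infinitely many [n]. *)
Lemma area_liminf (E : nat -> set (plane R)) (c : \bar R) : (forall n, measurable (E n)) ->
  (forall n, area R (E n) <= c)%E ->
  let F := \bigcup_n \bigcap_(m in [set m | (n <= m)%N]) E m in
  measurable F /\ (area R F <= c)%E.
Proof.
move=> mE Ec F; pose H n := \bigcap_(m in [set m | (n <= m)%N]) E m.
have mH n : measurable (H n) by apply: bigcap_measurable => //; exists n => /=.
have mF : measurable F by exact: bigcupT_measurable.
split => //.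
have ndH : nondecreasing_seq H.
  move=> n m nm; apply/subsetPset => z Hz p /= mp; apply: Hz => /=; exact: leq_trans mp.
have cv := nondecreasing_cvg_mu mH mF ndH (mu := area R).
rewrite -(cvg_lim _ cv)//; apply: lime_le; first by apply/cvg_ex; exists (area R F).
near=> n; apply: le_trans (Ec n); apply: le_measure; rewrite ?inE//.
by move=> z; apply => /=.
Unshelve. all: by end_near.
Qed.

(** Cotlar's inequality is used with an inner truncation [d n = 1 / (n + 1)], and the maximal
    function of [|T_(d n) f|^2] is large on a set depending on [n]. Off the lower limit of these
    sets some [n] with [4 * d n <= e] is good for each [e]. The radius [rho] confines [z] to a
    region where [Kt] agrees with the truncated kernel. *)
Lemma tr_weak K : czk A kap K -> exists C : R, 0 <= C /\
  forall f (lam rho : R), bcs f -> 0 < lam -> exists E, [/\ measurable E,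
    (area R E <= (C / lam ^+ 2 * dot f f)%:E)%E &
    forall z, ~ E z -> en z <= rho -> forall e, 0 < e <= 1 -> `|tr K e f z| <= lam].
Proof.
move=> cK; have A0 := czk_A cK; have k1 := czk_kap cK; have C0 := Cb_ge0 L A0.
pose D := 4 * Cb + 4 * A * kap + 1.
have D1 : 1 <= D.
  by rewrite /D lerDr; apply: addr_ge0; [exact: mulr_ge0|apply: mulr_ge0; [exact: mulr_ge0|lra]].
have D0 : 0 < D by lra.
have [q [q0 qE]] : exists q : R, 0 <= q /\ q = 576 by exists 576; split; [exact: ler0n|].
exists (q * (4 * D ^+ 2) + q * Cb ^+ 2); split.
  by apply: addr_ge0; apply: mulr_ge0 => //; [apply: mulr_ge0 => //|]; exact: sqr_ge0.
move=> f lam rho bf l0; have [M [M0 fM]] := bcs_bound bf.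
(* With these levels each of the two terms of [cotlar_pt] is at most [lam / 2]. *)
pose l1 := (lam / (2 * D)) ^+ 2; pose l2 := lam ^+ 2.
have l1p : 0 < l1 by rewrite exprn_gt0// divr_gt0// mulr_gt0.
have l2p : 0 < l2 by rewrite exprn_gt0.
have bff : bcs (fun w => f w ^+ 2).
  by have := bcs_mul bf bf; under eq_fun do rewrite -expr2.
have ffE g : Int (fun w => g w ^+ 2) = dot g g.
  by rewrite dotE; congr Int; apply/funext => w; rewrite expr2.
(* [maximal_weak] loses a factor [16], so it is applied at the levels [l1 / 16] and [l2 / 16]; hence
   [q = 576 = 36 * 16]. *)
have m16 (x : R) : 0 < x -> 0 < x / 16 by move=> x0; rewrite divr_gt0.
have [E1 [mE1 aE1 E1P]] := maximal_weak bff (fun z => sqr_ge0 _) (m16 _ l1p).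
pose d (n : nat) : R := n.+1%:R^-1.
have d0 n : 0 < d n by rewrite invr_gt0.
have b2 : (2 : R) <= 8 by lra.
have /choice[N NP] n := pow_unbounded (rho + 1 + M) (d0 n) b2.
pose v n := cv (Kt K (d n) (N n)) f.
have bv n : bcs (v n) by apply: bcs_cv => //; exact: (bcs_Kt _ cK).
have bvv n : bcs (fun w => v n w ^+ 2).
  by have := bcs_mul (bv n) (bv n); under eq_fun do rewrite -expr2.
have [E2 E2P] := choice (fun n => maximal_weak (bvv n) (fun z => sqr_ge0 _) (m16 _ l2p)).
have mE2 n : measurable (E2 n) by case: (E2P n).
have aE2 n : (area R (E2 n) <= (q / l2 * (Cb ^+ 2 * dot f f))%:E)%E.
  case: (E2P n) => _ aE _; apply: (le_trans aE); rewrite lee_fin ffE.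
  have -> : 36 / (l2 / 16) = q / l2 by rewrite qE; field; rewrite gt_eqF.
  apply: ler_wpM2l; first by apply: divr_ge0 => //; exact: ltW.
  rewrite -!sqr_nrm2 -exprMn lerXn2r ?nnegrE ?mulr_ge0 ?nrm2_ge0//.
  exact: (nrm2_Kt kL _ cK).
have [mF aF] := area_liminf mE2 aE2.
set F := (\bigcup_n _) in mF aF.
exists (E1 `|` F); split; first exact: measurableU.
  apply: (le_trans (measureU2 _ mE1 mF)).
  apply: (@le_trans _ _ ((q / l1 * dot f f)%:E + (q / l2 * (Cb ^+ 2 * dot f f))%:E)%E).
    apply: leeD => //; apply: (le_trans aE1); rewrite lee_fin ffE.
    have -> : 36 / (l1 / 16) = q / l1 by rewrite qE; field; rewrite gt_eqF.
    by [].
  rewrite -EFinD lee_fin le_eqVlt; apply/orP; left; apply/eqP; rewrite /l1 /l2.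
  by field; rewrite !gt_eqF.
move=> z /not_orP[zE1 zF] zr e /andP[e0 e1].
have H1 r : 0 < r -> Int (fun w => f w ^+ 2 * \1_(sq z r) w) <= l1 * r ^+ 2.
  move=> r0; apply: (le_trans (E1P z r zE1 r0)); rewrite le_eqVlt; apply/orP; left; apply/eqP.
  by field.
pose n := Num.bound (4 / e).
have [m nm zE2] : exists2 m, (n <= m)%N & ~ E2 m z.
  apply: contrapT => h; apply: zF; exists n => // m /= nm.
  by apply: contrapT => h2; apply: h; exists m.
have de : 4 * d m <= e.
  have h : 4 / e < n%:R by apply: archi_boundP; rewrite divr_ge0// ltW.
  have h2 : (n%:R : R) <= m.+1%:R by rewrite ler_nat (leq_trans nm).
  rewrite /d ler_pdivrMr// mulrC -ler_pdivrMr//; lra.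
have e8 : 0 < e / 8 by rewrite divr_gt0.
have H2 : Int (fun w => tr K (d m) f w ^+ 2 * \1_(sq z (e / 8)) w) <= l2 * (e / 8) ^+ 2.
  have [_ _ /(_ z (e / 8) zE2 e8)] := E2P m.
  have -> : 16 * (l2 / 16) = l2 by field.
  congr (Int _ <= _); apply/funext => w.
  have [zw|zw] := pselect (sq z (e / 8) w); last by rewrite indicE memNset// !mulr0.
  rewrite /v (tr_loc K (d0 m) fM (n := N m))//; apply: le_trans (NP m).
  by have := sq_en zw; have := en_subl w z; lra.
apply: (le_trans (cotlar_pt cK bf (d0 m) de H1 H2)).
rewrite /l1 /l2 !sqrtr_sqr (gtr0_norm l0) gtr0_norm; last by rewrite divr_gt0// mulr_gt0.
have : (4 * Cb + 4 * A * kap) * (lam / (2 * D)) <= D * (lam / (2 * D)).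
  apply: ler_wpM2r; last by rewrite /D; lra.
  by rewrite ltW// divr_gt0// mulr_gt0.
have -> : D * (lam / (2 * D)) = lam / 2 by field; rewrite gt_eqF.
lra.
Qed.

End weak_type.

(** * Approximation by Lipschitz functions *)

Section lipschitz_approximation.
Context {R : realType}.
Implicit Types (z w : plane R) (f g h : plane R -> R) (A B : set (plane R)).
Notation Ig f := ((area R).-integrable setT (EFin \o f)).

Definition lip g := exists C, forall z w, `|g z - g w| <= C * en ((z : R * R) - w).

Definition unitlip g := [/\ measurable_fun setT g, forall z, 0 <= g z <= 1 & lip g].

(** The sets whose indicator is a limit, in [L^1] on bounded squares, of Lipschitz functions with
    values in [[0, 1]]. They form a sigma-algebra, so half-planes are enough to reach all measurable
    sets. *)
Definition appr A := measurable A /\ forall N eta : R, 0 < N -> 0 < eta ->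
  exists2 g, unitlip g & Int (fun z => `|\1_A z - g z| * \1_(sq 0 N) z) <= eta.

Lemma indic01 A z : 0 <= (\1_A z : R) <= 1.
Proof. by rewrite indicE ler0n lern1 leq_b1. Qed.

Lemma bcs_diff A g N : measurable A -> unitlip g -> bcs (fun z => `|\1_A z - g z| * \1_(sq 0 N) z).
Proof.
move=> mA [mg g01 _]; apply: bdd_indic_bcs; apply: (@bddI _ _ 1).
  apply: measurableT_comp => //; apply: measurable_funB => //; exact: measurable_indic.
move=> z; rewrite normr_id; have := indic01 A z; have := g01 z.
by move=> /andP[a b] /andP[c d]; rewrite ler_norml; apply/andP; split; lra.
Qed.

Lemma appr_setC A : appr A -> appr (~` A).
Proof.
move=> [mA H]; split; first exact: measurableC.
move=> N eta N0 e0; have [g [mg g01 [C gC]] gA] := H N eta N0 e0.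
exists (fun z => 1 - g z).
  split; first by apply: measurable_funB => //; exact: measurable_cst.
    by move=> z; have /andP[a b] := g01 z; apply/andP; split; lra.
  exists C => z w; have -> : 1 - g z - (1 - g w) = - (g z - g w) by ring.
  by rewrite normrN.
apply: le_trans gA; rewrite le_eqVlt; apply/orP; left; apply/eqP; congr Int; apply/funext => z; congr (_ * _).
have -> : \1_(~` A) z = 1 - \1_A z :> R.
  by rewrite !indicE in_setC; case: (_ \in _); rewrite /= ?subr0 ?subrr.
by rewrite -normrN; congr `|_|; ring.
Qed.

Lemma appr_setI A B : appr A -> appr B -> appr (A `&` B).
Proof.
move=> [mA HA] [mB HB]; split; first exact: measurableI.
move=> N eta N0 e0; have e2 : 0 < eta / 2 by lra.
have [g ug gA] := HA N _ N0 e2; have [h uh hB] := HB N _ N0 e2.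
have [mg g01 [C gC]] := ug; have [mh h01 [D hD]] := uh.
have ugh : unitlip (fun z => g z * h z).
  split; first exact: measurable_funM.
    move=> z; have /andP[a b] := g01 z; have /andP[c d] := h01 z.
    by rewrite mulr_ge0//=; apply: mulr_ile1.
  exists (C + D) => z w.
  have -> : g z * h z - g w * h w = (g z - g w) * h z + g w * (h z - h w) by ring.
  apply: (le_trans (ler_normD _ _)); rewrite !normrM mulrDl.
  have /andP[a b] := g01 w; have /andP[c d] := h01 z.
  rewrite (ger0_norm a) (ger0_norm c); apply: lerD.
    by apply: le_trans (gC z w); rewrite ler_piMr.
  by apply: le_trans (hD z w); rewrite ler_piMl.
exists (fun z => g z * h z) => //.
have b1 := bcs_diff N mA ug; have b2 := bcs_diff N mB uh.
apply: (@le_trans _ _ (Int (fun z => `|\1_A z - g z| * \1_(sq 0 N) z) +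
                       Int (fun z => `|\1_B z - h z| * \1_(sq 0 N) z))); last by lra.
rewrite -IntD; [|exact: bcs_Ig..].
apply: Int_le; [apply: bcs_Ig; apply: bcs_diff => //; exact: measurableI|
                by apply: bcs_Ig; exact: bcsD|move=> z].
rewrite -mulrDl; apply: ler_wpM2r; first by case/andP: (indic01 (sq 0 N) z).
have -> : \1_(A `&` B) z = \1_A z * \1_B z :> R by rewrite !indicE in_setI; do 2 case: (_ \in _); rewrite /= ?mulr0 ?mulr1.
have /andP[a b] := g01 z; have /andP[c d] := indic01 B z.
have -> : \1_A z * \1_B z - g z * h z = (\1_A z - g z) * \1_B z + g z * (\1_B z - h z) by ring.
apply: (le_trans (ler_normD _ _)); rewrite !normrM (ger0_norm a) (ger0_norm c).
by apply: lerD; [rewrite ler_piMr|rewrite ler_piMl].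
Qed.

Lemma appr_setU A B : appr A -> appr B -> appr (A `|` B).
Proof.
by move=> aA aB; rewrite -(setCK (A `|` B)) setCU; apply/appr_setC/appr_setI; exact: appr_setC.
Qed.

Lemma appr_setT : appr setT.
Proof.
split; first exact: measurableT.
move=> N eta N0 e0; exists (fun=> 1).
  split; [exact: measurable_cst|by move=> z; rewrite ler01 lexx|exists 0 => z w].
  by rewrite subrr normr0 mul0r.
rewrite (_ : (fun z => _) = fun=> 0) ?Int0 ?ltW//.
by apply/funext => z; rewrite indicE mem_set// subrr normr0 mul0r.
Qed.

Lemma Int_indic A : measurable A -> Int (\1_A : plane R -> R) = fine (area R A).
Proof.
move=> mA; rewrite unlock.
transitivity (Rintegral (area R) A (fun=> 1)).
  rewrite [RHS]Rintegral_mkcond; congr Rintegral; apply/funext => z.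
  by rewrite /patch indicE; case: (_ \in _).
by rewrite Rintegral_cst// mul1r.
Qed.

(** Inside a bounded square a finite union exhausts the countable one up to area [eta / 2]; the
    finite union is approximated within the other half. *)
Lemma appr_bigcup (F : nat -> set (plane R)) : (forall n, appr (F n)) -> appr (\bigcup_n F n).
Proof.
move=> aF; have mF n : measurable (F n) by case: (aF n).
split; first exact: bigcupT_measurable.
pose G n := \big[setU/set0]_(i < n.+1) F i.
have aG n : appr (G n).
  rewrite /G; elim: n => [|n ih]; first by rewrite big_ord1.
  by rewrite big_ord_recr/=; exact: appr_setU.
have mG n : measurable (G n) by case: (aG n).
move=> N eta N0 e0; have e2 : 0 < eta / 2 by lra.
pose D := sq (0 : plane R) N; have mD : measurable D by exact: measurable_sq.
have mU : measurable (\bigcup_n F n `&` D) by apply: measurableI => //; exact: bigcupT_measurable.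
have UE : \bigcup_n (G n `&` D) = \bigcup_n F n `&` D.
  by rewrite -setI_bigcupl; congr (_ `&` _); rewrite /G bigcup_bigsetU_bigcup.
have mGD n : measurable (G n `&` D) by exact: measurableI.
have nd : nondecreasing_seq (fun n => G n `&` D).
  move=> m n mn; apply/subsetPset; apply: setSI; rewrite /G.
  by apply: (@subset_bigsetU _ F m.+1 n.+1); rewrite ltnS.
have cv : (area R \o (fun n => G n `&` D)) @ \oo --> area R (\bigcup_n F n `&` D).
  by rewrite -UE; apply: nondecreasing_cvg_mu => //; rewrite UE.
have fin B : measurable B -> (area R (B `&` D) < +oo)%E.
  move=> mB; apply: (@le_lt_trans _ _ (area R D)); last by rewrite /D area_sq ?ltry// ltW.
  by apply: le_measure; rewrite ?inE//; exact: measurableI.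
have cvf : (fine \o (area R \o (fun n => G n `&` D))) @ \oo --> fine (area R (\bigcup_n F n `&` D)).
  apply: fine_cvg; rewrite fineK// ge0_fin_numE ?measure_ge0//.
  by apply: fin; exact: bigcupT_measurable.
have /cvgrPdist_le/(_ _ e2)[n _ /(_ n (leqnn _))/= Hn] := cvf.
have [g ug gG] := (aG n).2 N _ N0 e2; exists g => //.
have mUF : measurable (\bigcup_n F n) by exact: bigcupT_measurable.
have bI B : measurable B -> bcs (fun z => \1_B z * \1_D z).
  move=> mB; have := bcs_indic (@bcs_indic_sq R 0 N) mB.
  by under eq_fun do rewrite mulrC.
have bF := bI _ mUF; have bG := bI _ (mG n); have bd := bcs_diff N (mG n) ug.
have IE B : measurable B -> Int (fun z => \1_B z * \1_D z) = fine (area R (B `&` D)).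
  move=> mB; rewrite -Int_indic; last exact: measurableI.
  by congr Int; apply/funext => z; rewrite !indicE in_setI; do 2 case: (_ \in _); rewrite /= ?mulr0 ?mulr1.
apply: (@le_trans _ _ ((Int (fun z => \1_(\bigcup_n F n) z * \1_D z) - Int (fun z => \1_(G n) z * \1_D z)) + Int (fun z => `|\1_(G n) z - g z| * \1_D z))); last first.
  rewrite !IE//; have := ler_norm (fine (area R (\bigcup_n F n `&` D)) - fine (area R (G n `&` D))).
  by move=> h; have := le_trans h Hn; move: gG; rewrite -/D; lra.
rewrite -IntB; [|exact: bcs_Ig..]; rewrite -IntD; [|by apply: bcs_Ig => //; exact: bcsB..].
apply: Int_le; [by apply: bcs_Ig; exact: bcs_diff|by apply: bcs_Ig; apply: bcsD => //; exact: bcsB|move=> z].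
rewrite -mulrBl -mulrDl; apply: ler_wpM2r; first by case/andP: (indic01 D z).
have GF : \1_(G n) z <= \1_(\bigcup_n F n) z :> R.
  rewrite !indicE; have [|_] := boolP (z \in G n); last by rewrite ler0n.
  by rewrite inE => Gz; rewrite mem_set//; exact: (bigsetU_bigcup Gz).
have -> : \1_(\bigcup_n F n) z - g z = (\1_(\bigcup_n F n) z - \1_(G n) z) + (\1_(G n) z - g z) by ring.
by apply: (le_trans (ler_normD _ _)); rewrite (ger0_norm (_ : 0 <= \1_(\bigcup_n F n) z - \1_(G n) z)) ?subr_ge0.
Qed.

(** The approximation is a linear ramp, [1] for [p z <= a] and [0] for [p z >= a + d]. It errs only
    in the strip between, whose area [2 N d] in the square is the prescribed [eta]. *)
Lemma appr_halfplane (p : plane R -> R) (a : R) : measurable_fun setT p ->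
  (forall z w, `|p z - p w| <= en ((z : R * R) - w)) ->
  (forall N d : R, 0 < N -> 0 < d -> measurable [set z : plane R | a < p z <= a + d] /\
    (area R ([set z : plane R | (a < p z <= a + d)%R] `&` sq 0%R N) <= (2 * N * d)%:E)%E) ->
  appr [set z | p z <= a].
Proof.
move=> mp plip strip.
have mA : measurable [set z | p z <= a].
  have -> : [set z | p z <= a] = setT `&` p @^-1` `]-oo, a]%classic.
    by rewrite setTI; apply/seteqP; split => z /=; rewrite in_itv/=.
  by apply: mp => //; exact: measurable_itv.
split => // N eta N0 e0; pose d := eta / (2 * N); have d0 : 0 < d by rewrite divr_gt0// mulr_gt0.
have [mS aS] := strip N d N0 d0; set S := [set z | _ < _ <= _] in mS aS.
pose t z := 1 - (p z - a) / d.
pose g z := Num.min 1 (Num.max 0 (t z)).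
have tlip z w : `|t z - t w| <= d^-1 * en ((z : R * R) - w).
  have -> : t z - t w = - ((p z - p w) * d^-1) by rewrite /t; ring.
  rewrite normrN normrM (gtr0_norm (_ : 0 < d^-1)) ?invr_gt0// mulrC ler_wpM2l// invr_ge0 ltW//.
have ug : unitlip g.
  split.
  - apply: measurable_minr; first exact: measurable_cst.
    apply: measurable_maxr; first exact: measurable_cst.
    apply: measurable_funB; first exact: measurable_cst.
    apply: measurable_funM; last exact: measurable_cst.
    by apply: measurable_funB => //; exact: measurable_cst.
  - by move=> z; rewrite /g le_min ler01 le_max lexx/= ge_min lexx.
  - exists d^-1 => z w; apply: le_trans (tlip z w); exact: clamp_lip.
exists g => //.
have mSN : measurable (S `&` sq 0 N) by apply: measurableI => //; exact: measurable_sq.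
have bS : bcs (fun z => \1_(sq 0 N) z * \1_S z) by apply: bcs_indic => //; exact: bcs_indic_sq.
apply: (@le_trans _ _ (Int (fun z => \1_(sq 0 N) z * \1_S z))).
  apply: Int_le; [by apply: bcs_Ig; exact: bcs_diff|exact: bcs_Ig|move=> z].
  rewrite mulrC; apply: ler_wpM2l; first by case/andP: (indic01 (sq 0 N) z).
  rewrite indicE; have [pa|ap] := leP (p z) a.
    rewrite mem_set// /g (_ : Num.min _ _ = 1) ?subrr ?normr0; first by case/andP: (indic01 S z).
    apply/min_idPl; rewrite le_max; apply/orP; right.
    by rewrite /t lerDl oppr_ge0 mulr_le0_ge0 ?subr_le0// invr_ge0 ltW.
  rewrite memNset; last by move=> /=; rewrite leNgt ap.
  rewrite sub0r normrN; have [_ /(_ z)/andP[g0 g1] _] := ug; rewrite ger0_norm//.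
  rewrite indicE; have [|/negP zS] := boolP (z \in S) => //.
  rewrite /g (_ : Num.max 0 (t z) = 0); first by rewrite (min_idPr _).
  apply/max_idPl; rewrite /t subr_le0 ler_pdivlMr// mul1r lerBrDr addrC leNgt.
  by apply/negP => h; apply: zS; rewrite inE /S/= ap ltW.
have -> : (fun z => \1_(sq 0 N) z * \1_S z : R) = \1_(S `&` sq 0 N).
  by apply/funext => z; rewrite !indicE in_setI; do 2 case: (_ \in _); rewrite /= ?mulr0 ?mulr1.
rewrite Int_indic//.
have -> : eta = fine (2 * N * d)%:E by rewrite /d/=; field; rewrite gt_eqF.
apply: fine_le => //; rewrite ge0_fin_numE ?measure_ge0//.
by apply: (le_lt_trans aS); rewrite ltry.
Qed.

End lipschitz_approximation.

(** * Density of Lipschitz functions in [L^2] *)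

Section density.
Context {R : realType}.
Implicit Types (z w : plane R) (f g h : plane R -> R) (A B : set (plane R)).

Lemma appr_sigma_algebra : sigma_algebra setT (@appr R).
Proof.
split.
- by rewrite -setCT; apply: appr_setC; exact: appr_setT.
- by move=> A aA; rewrite setTD; exact: appr_setC.
- by move=> F aF; exact: appr_bigcup.
Qed.

Lemma appr_coord (p : plane R -> measurableTypeR R) : measurable_fun setT p ->
  (forall a, appr [set z | p z <= a :> R]) ->
  forall A : set (measurableTypeR R), measurable A -> appr (p @^-1` A).
Proof.
move=> mp H A mA.
have sub : <<s R.-ocitv.-measurable >> `<=` [set A | appr (p @^-1` A)].
  apply: smallest_sub.
    have [s0 sC sU] := appr_sigma_algebra; split => /=.
    - by rewrite preimage_set0.
    - by move=> B aB; rewrite setTD -preimage_setC; exact: appr_setC.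
    - by move=> F aF; rewrite preimage_bigcup; exact: appr_bigcup.
  move=> _ [[a b] _ <-] /=.
  have -> : p @^-1` `]a, b]%classic = [set z | p z <= b] `&` ~` [set z | p z <= a].
    apply/seteqP; split => z /=; rewrite in_itv/=.
      by move=> /andP[az zb]; split => //; apply/negP; rewrite -ltNge.
    by move=> [zb /negP]; rewrite -ltNge => ->.
  by apply: appr_setI => //; exact: appr_setC.
exact: sub.
Qed.

Lemma strip_bound (a N d : R) (S : set (plane R)) : 0 < N -> 0 < d -> measurable S ->
  (S `&` sq 0 N `<=` `[a, a + d] `*` `[- N, N] \/ S `&` sq 0 N `<=` `[- N, N] `*` `[a, a + d]) ->
  (area R (S `&` sq 0%R N) <= (2 * N * d)%:E)%E.
Proof.
move=> N0 d0 mS sub.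
have mSN : measurable (S `&` sq 0 N) by apply: measurableI => //; exact: measurable_sq.
case: sub => sub.
  apply: (@le_trans _ _ (area R (`[a, a + d] `*` `[- N, N]))).
    by apply: le_measure; rewrite ?inE//; apply: measurableX; exact: measurable_itv.
  by rewrite area_rect ?lee_fin; [rewrite le_eqVlt; apply/orP; left; apply/eqP; ring|lra|lra].
apply: (@le_trans _ _ (area R (`[- N, N] `*` `[a, a + d]))).
  by apply: le_measure; rewrite ?inE//; apply: measurableX; exact: measurable_itv.
by rewrite area_rect ?lee_fin; [rewrite le_eqVlt; apply/orP; left; apply/eqP; ring|lra|lra].
Qed.

Lemma measurable_strip (p : plane R -> R) (a d : R) : measurable_fun setT p ->
  measurable [set z : plane R | a < p z <= a + d].
Proof.
move=> mp; have -> : [set z | a < p z <= a + d] = setT `&` p @^-1` `]a, a + d]%classic.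
  by rewrite setTI; apply/seteqP; split => z /=; rewrite in_itv/=.
by apply: mp => //; exact: measurable_itv.
Qed.

Lemma appr_fst (A : set (measurableTypeR R)) : measurable A -> appr ((fun z : plane R => z.1) @^-1` A).
Proof.
apply: appr_coord => [|a]; first exact: measurable_fst.
have m1 : measurable_fun setT (fun z : plane R => z.1 : R) by exact: measurable_fst.
apply: (@appr_halfplane _ (fun z : plane R => z.1 : R) a) => //.
  by move=> z w; exact: (le_en1 ((z : R * R) - w)).
move=> N d N0 d0; have mS := measurable_strip a d m1; split => //.
apply: (strip_bound (a := a)) => //; left => z [/= /andP[a1 a2]] [_ b2]; split => /=; rewrite in_itv/=.
  by rewrite ltW.
by move: b2; rewrite subr0 ler_norml.
Qed.

Lemma appr_snd (A : set (measurableTypeR R)) : measurable A -> appr ((fun z : plane R => z.2) @^-1` A).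
Proof.
apply: appr_coord => [|a]; first exact: measurable_snd.
have m1 : measurable_fun setT (fun z : plane R => z.2 : R) by exact: measurable_snd.
apply: (@appr_halfplane _ (fun z : plane R => z.2 : R) a) => //.
  by move=> z w; exact: (le_en2 ((z : R * R) - w)).
move=> N d N0 d0; have mS := measurable_strip a d m1; split => //.
apply: (strip_bound (a := a)) => //; right => z [/= /andP[a1 a2]] [b2 _]; split => /=; rewrite in_itv/=.
  by move: b2; rewrite subr0 ler_norml.
by rewrite ltW.
Qed.

Lemma measurable_appr A : measurable A -> appr A.
Proof.
rewrite measurable_prod_measurableType => mA.
have sub : <<s [set A1 `*` A2 | A1 in @measurable _ (measurableTypeR R) & A2 in @measurable _ (measurableTypeR R)] >> `<=` @appr R.
  apply: smallest_sub; first exact: appr_sigma_algebra.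
  move=> _ [A1 mA1 [A2 mA2 <-]].
  have -> : A1 `*` A2 = (fun z : plane R => z.1) @^-1` A1 `&` (fun z : plane R => z.2) @^-1` A2 by [].
  by apply: appr_setI; [exact: appr_fst|exact: appr_snd].
exact: sub.
Qed.

(** The sum counts the positive integers below [x], so it is the integer part of [x]: a discrete
    layer-cake formula. *)
Lemma layer_count (n : nat) (x : R) : 0 <= x <= n%:R ->
  x - 1 <= \sum_(i < n) (if i.+1%:R <= x then 1 else 0) <= x.
Proof.
elim: n x => [|n ih] x /andP[x0 xn].
  have x1 : x <= 0 by exact: xn.
  by rewrite big_ord0; apply/andP; split => //; lra.
rewrite big_ord_recr/=.
have ones (y : R) : n%:R <= y -> \sum_(i < n) (if i.+1%:R <= y then 1 else 0 : R) = n%:R.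
  move=> ny; rewrite (eq_bigr (fun=> 1)) ?sumr_const ?card_ord// => i _.
  by rewrite ifT//; apply: le_trans ny; rewrite ler_nat.
have [nx|xn1] := leP (n.+1%:R) x.
  rewrite ones; last by apply: le_trans nx; rewrite ler_nat.
  by rewrite -natr1 in nx xn *; apply/andP; split; lra.
rewrite addr0; have [xn2|nx2] := leP x n%:R; first by apply: ih; rewrite x0.
by rewrite ones ?(ltW nx2)//; rewrite -natr1 in xn1; apply/andP; split; lra.
Qed.

Lemma lip_sum (n : nat) (g : nat -> plane R -> R) : (forall i, lip (g i)) ->
  lip (fun z => \sum_(i < n) g i z).
Proof.
move=> lg; elim: n => [|n [C HC]].
  by exists 0 => z w; rewrite !big_ord0 subrr normr0 mul0r.
have [D HD] := lg n; exists (C + D) => z w; rewrite !big_ord_recr/= mulrDl.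
rewrite opprD addrACA; apply: (le_trans (ler_normD _ _)); exact: lerD.
Qed.

Lemma lip_density f (eta : R) : bcs f -> 0 < eta ->
  exists g, [/\ bcs g, lip g & dot (fun z => f z - g z) (fun z => f z - g z) <= eta].
Proof.
move=> bf e0; have [M [M0 fM]] := bcs_bound bf.
have mf := bcs_measurable bf.
pose N := 2 * M; have N0 : 0 < N by rewrite /N; lra.
pose S := (2 * N) ^+ 2; have S0 : 0 < S by rewrite exprn_gt0// mulr_gt0.
(* The final error is [8 M^2 S] times [eta']: one half comes from the Lipschitz approximation of the
   level sets, the other from the step [1 / n <= eta'] of the discretisation. *)
pose eta' := eta / (2 * M * (4 * M * S)).
have D0 : 0 < 2 * M * (4 * M * S) by rewrite !mulr_gt0.
have e0' : 0 < eta' by rewrite divr_gt0.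
pose n := (Num.bound eta'^-1).+1.
have n0 : 0 < n%:R :> R by rewrite ltr0n.
have ne : n%:R^-1 <= eta'.
  rewrite -(invrK eta') lef_pV2 ?posrE ?invr_gt0//; apply: ltW.
  apply: (lt_le_trans (archi_boundP _)); first by rewrite invr_ge0 ltW.
  by rewrite ler_nat.
(* [H] rescales the range of [f] to [[0, n]]; by [layer_count] the indicators of the level sets
   [A i] add up to [H] within [1]. *)
pose H z := (f z + M) / (2 * M) * n%:R.
have H01 z : 0 <= H z <= n%:R.
  have := (fM z).1; rewrite ler_norml => /andP[a b].
  have p : 0 <= (f z + M) / (2 * M) by rewrite divr_ge0//; lra.
  rewrite mulr_ge0//= -[leRHS]mul1r ler_wpM2r// ler_pdivrMr; lra.
pose A i := [set z | i.+1%:R <= H z].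
have mH : measurable_fun setT H.
  apply: measurable_funM; last exact: measurable_cst.
  apply: measurable_funM; last exact: measurable_cst.
  by apply: measurable_funD => //; exact: measurable_cst.
have mA i : measurable (A i).
  have -> : A i = setT `&` H @^-1` `[i.+1%:R, +oo[%classic.
    by rewrite setTI; apply/seteqP; split => z /=; rewrite in_itv/= andbT.
  by apply: mH => //; exact: measurable_itv.
have ex i : exists g, unitlip g /\ Int (fun z => `|\1_(A i) z - g z| * \1_(sq 0 N) z) <= S * eta'.
  have [_ /(_ N (S * eta') N0)] := measurable_appr (mA i).
  by move=> /(_ (mulr_gt0 S0 e0'))[g ug gA]; exists g.
have [g gP] := choice ex.
have ug i := (gP i).1; have gA i := (gP i).2.
have mg i : measurable_fun setT (g i) by case: (ug i).
pose G z := - M + 2 * M / n%:R * \sum_(i < n) g i z.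
pose psi z : R := 1 - cut M z.
have psi01 z : 0 <= psi z <= 1.
  by rewrite /psi; have := cut_ge0 M z; have := cut_le1 M z => *; apply/andP; split; lra.
have G01 z : `|G z| <= M.
  have h1 : 0 <= \sum_(i < n) g i z by apply: sumr_ge0 => i _; case: (ug i) => _ /(_ z)/andP[].
  have h2 : \sum_(i < n) g i z <= n%:R.
    apply: (@le_trans _ _ (\sum_(i < n) 1)); last by rewrite sumr_const card_ord.
    by apply: ler_sum => i _; case: (ug i) => _ /(_ z)/andP[].
  have c : 0 <= 2 * M / n%:R by rewrite divr_ge0// ?mulr_ge0// ltW.
  have u1 := mulr_ge0 c h1; have u2 := ler_wpM2l c h2.
  have E : 2 * M / n%:R * n%:R = 2 * M by rewrite divfK// gt_eqF.
  by rewrite /G ler_norml; rewrite E in u2; apply/andP; split; lra.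
have mG : measurable_fun setT G.
  apply: measurable_funD; first exact: measurable_cst.
  apply: measurable_funM; first exact: measurable_cst.
  by apply: measurable_sum => i; exact: mg.
have mpsi : measurable_fun setT psi.
  by apply: measurable_funB; [exact: measurable_cst|exact: measurable_cut].
have bG : bcs (fun z => G z * psi z).
  apply: (@bcsI _ _ (2 * M)); first exact: measurable_funM.
  move=> z; have /andP[p0 p1] := psi01 z; split.
    rewrite normrM (ger0_norm p0); have := G01 z.
    by move=> h; apply: (@le_trans _ _ (`|G z| * 1)); [rewrite ler_wpM2l|lra].
  by move=> h; rewrite /psi cut_eq1 ?subrr ?mulr0// ltW.
have Glip : lip G.
  have [C HC] := @lip_sum n g (fun i => let: And3 _ _ l := ug i in l).
  exists (2 * M / n%:R * C) => z w; rewrite /G opprD addrACA subrr add0r -mulrBr normrM.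
  have c : 0 <= 2 * M / n%:R by rewrite divr_ge0// ?mulr_ge0// ltW.
  by rewrite (ger0_norm c) -[leRHS]mulrA; apply: ler_wpM2l.
have psilip : lip psi.
  exists M^-1 => z w; have -> : psi z - psi w = - (cut M z - cut M w) by rewrite /psi; ring.
  by rewrite normrN mulrC; exact: cut_lip.
exists (fun z => G z * psi z); split => //.
  have [C HC] := Glip; have [D HD] := psilip; exists (C + M * D) => z w.
  have -> : G z * psi z - G w * psi w = (G z - G w) * psi z + G w * (psi z - psi w) by ring.
  apply: (le_trans (ler_normD _ _)); rewrite !normrM mulrDl -mulrA.
  have /andP[p0 p1] := psi01 z; rewrite (ger0_norm p0); apply: lerD.
    by apply: le_trans (HC z w); rewrite ler_piMr.
  by apply: ler_pM.
have fpsi z : f z = f z * psi z.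
  have [h|h] := ltP M (en z); first by rewrite (fM z).2 ?mul0r.
  by rewrite /psi cut_eq0// subr0 mulr1.
have psiD z : psi z <= \1_(sq 0 N) z.
  have [h|h] := pselect (sq 0 N z); first by rewrite indicE mem_set//; case/andP: (psi01 z).
  rewrite indicE memNset// /psi cut_eq1 ?subrr// leNgt; apply/negP => h2; apply: h.
  by apply: en_sq; rewrite subr0 ltW.
have bD i := bcs_diff N (mA i) (ug i).
have bS := @bcs_indic_sq R 0 N.
pose T z := 2 * M / n%:R * (\sum_(i < n) `|\1_(A i) z - g i z| * \1_(sq 0 N) z + \1_(sq 0 N) z).
have bT : bcs T by apply: bcsZ; apply: bcsD => //; apply: bcs_sum => i.
(* Since [f] and [G] are both bounded by [M], one factor is at most [2 M]: the [L^1] approximation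
   of the level sets controls the [L^2] norm. *)
have pt z : (f z - G z * psi z) * (f z - G z * psi z) <= 2 * M * T z.
  have d1 : `|f z - G z| <= 2 * M.
    by apply: (le_trans (ler_normB _ _)); have := (fM z).1; have := G01 z; lra.
  have d2 : `|f z - G z| <= 2 * M / n%:R * (\sum_(i < n) `|\1_(A i) z - g i z| + 1).
    have -> : f z - G z = 2 * M / n%:R * (H z - \sum_(i < n) g i z).
      by rewrite /G /H; field; rewrite !gt_eqF.
    rewrite normrM (ger0_norm (_ : 0 <= 2 * M / n%:R)) ?divr_ge0 ?mulr_ge0 ?(ltW M0)//.
    apply: ler_wpM2l; first by rewrite divr_ge0 ?mulr_ge0 ?(ltW M0).
    pose s : R := \sum_(i < n) \1_(A i) z.
    have sE : s = \sum_(i < n) (if i.+1%:R <= H z then 1 else 0).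
      apply: eq_bigr => i _; rewrite indicE; case: ifPn => h; first by rewrite mem_set.
      by rewrite memNset// /A/=; exact/negP.
    have := layer_count (H01 z); rewrite -sE => /andP[s1 s2].
    have -> : H z - \sum_(i < n) g i z = (s - \sum_(i < n) g i z) + (H z - s) by ring.
    apply: (le_trans (ler_normD _ _)); apply: lerD; last by rewrite ger0_norm; lra.
    by rewrite /s -sumrB; exact: ler_norm_sum.
  have /andP[p0 p1] := psi01 z.
  have -> : (f z - G z * psi z) * (f z - G z * psi z) = (f z - G z) ^+ 2 * psi z * psi z.
    by rewrite {1 2}(fpsi z); ring.
  rewrite -(real_normK (num_real (f z - G z))) expr2.
  have n0' := normr_ge0 (f z - G z).
  apply: (@le_trans _ _ (`|f z - G z| * `|f z - G z| * psi z)).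
    by rewrite ler_piMr ?mulr_ge0.
  rewrite -mulrA; apply: ler_pM => //; first by rewrite mulr_ge0.
  rewrite /T -mulr_suml -{2}(mul1r (\1_(sq 0 N) z)) -mulrDl mulrA.
  by apply: ler_pM.
rewrite dotE; apply: (@le_trans _ _ (Int (fun z => 2 * M * T z))).
  apply: Int_le => //; last exact: (bcs_Ig (bcsZ _ bT)).
  by apply: bcs_Ig; apply: bcs_mul; exact: bcsB.
have bsum : bcs (fun z => \sum_(i < n) `|\1_(A i) z - g i z| * \1_(sq 0 N) z) by apply: bcs_sum => i.
rewrite IntZ ?IntZ; [|by apply: bcs_Ig => //; exact: bcsD..].
rewrite IntD; [|exact: bcs_Ig..]; rewrite Int_sum// Int_indic_sq ?(ltW N0)//.
rewrite -[X in _ + X]/S.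
have s1 : \sum_(i < n) Int (fun z => `|\1_(A i) z - g i z| * \1_(sq 0 N) z) <= n%:R * (S * eta').
  apply: (@le_trans _ _ (\sum_(i < n) S * eta')); first by apply: ler_sum.
  by rewrite sumr_const card_ord mulr_natl.
have c : 0 <= 2 * M / n%:R by rewrite divr_ge0// ?mulr_ge0// ltW.
apply: (@le_trans _ _ (2 * M * (2 * M / n%:R * (n%:R * (S * eta') + S)))).
  apply: ler_wpM2l; first by rewrite mulr_ge0// ltW.
  by apply: ler_wpM2l => //; rewrite lerD2r.
have -> : 2 * M / n%:R * (n%:R * (S * eta') + S) = 2 * M * S * (eta' + n%:R^-1).
  by field; rewrite gt_eqF.
have -> : eta = 2 * M * (2 * M * S * (eta' + eta')) by rewrite /eta'; field; rewrite !gt_eqF.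
apply: ler_wpM2l; first by rewrite mulr_ge0// ltW.
by apply: ler_wpM2l; [rewrite !mulr_ge0// ltW|rewrite lerD2l].
Qed.

End density.

(** * Principal values *)

Section principal_value.
Context {R : realType}.
Implicit Types (z w y : plane R) (f g h K : plane R -> R).
Variables (A kap : R) (L : nat).
Hypothesis kL : kap <= 2 ^+ L.
Notation Cb := (Cb A L).

(** The last index [i] with [r <= e 2^-i] already contributes [2^(i+1) / e > 1 / r]. This serves to
    integrate [1 / |y|] near the origin with indicators of squares. *)
Lemma near_sum (e : R) (n : nat) (r : R) : 0 < e -> e * 2^-1 ^+ n < r -> r <= e ->
  r^-1 <= \sum_(0 <= i < n) 2 ^+ i.+1 / e * (if r <= e * 2^-1 ^+ i then 1 else 0).
Proof.
move=> e0; elim: n => [|n ih] h re.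
  by rewrite expr0 mulr1 ltNge re in h.
have T0 i : 0 <= 2 ^+ i.+1 / e * (if r <= e * 2^-1 ^+ i then 1 else 0).
  apply: mulr_ge0; first by rewrite divr_ge0 ?exprn_ge0// ltW.
  by case: ifP.
rewrite big_nat_recr//=; have [h2|h2] := ltP (e * 2^-1 ^+ n) r.
  by rewrite mulr0 addr0; exact: ih.
apply: ler_wpDl; first exact: sumr_ge0.
have p : 0 < e * 2^-1 ^+ n.+1 by rewrite mulr_gt0// exprn_gt0// invr_gt0.
rewrite mulr1 (_ : 2 ^+ n.+1 / e = (e * 2^-1 ^+ n.+1)^-1).
  by rewrite lef_pV2 ?posrE// ?ltW// (lt_trans p).
by rewrite invfM exprVn invrK mulrC.
Qed.

(** The kernel restricted to [e' < |y| <= e] has mean zero, so [g (z - y)] may be replaced by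
    [g (z - y) - g z], of size at most [C |y|]. The integrand is then at most [A C / |y|], with
    integral [O(e)] over the disc. *)
Lemma tr_lip K g C (e e' : R) z : czk A kap K -> bcs g ->
  (forall z w, `|g z - g w| <= C * en ((z : R * R) - w)) -> 0 < e' -> e' <= e ->
  `|tr K e' g z - tr K e g z| <= 16 * A * C * e.
Proof.
move=> cK bg gC e'0 ee; have e0 : 0 < e by lra.
have A0 := czk_A cK.
have C0 : 0 <= C.
  have := gC (1, 0) (0, 0); have -> : en (((1, 0) : R * R) - (0, 0)) = 1.
    by rewrite enE/= !subr0 expr1n expr0n/= addr0 sqrtr1.
  by rewrite mulr1; exact: le_trans.
have bKe := bdd_Ks cK e0; have bKe' := bdd_Ks cK e'0.
pose chi (r : R) : R := if (e' < r) && (r <= e) then 1 else 0.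
have dE y : Ks K e' y - Ks K e y = K y * chi (en y).
  rewrite !KsE /chi; have [h|h] /= := ltP e' (en y); last by rewrite ifF ?subrr ?mulr0//; apply/negbTE; rewrite -leNgt; lra.
  by rewrite leNgt; case: ifPn => h2; rewrite /= ?subrr ?mulr0 ?subr0 ?mulr1.
have bk : bcs (fun y => K y * chi (en y)).
  apply: (@bcsI _ _ (A / e' ^+ 2 + A / e ^+ 2 + e)).
    rewrite (_ : (fun y => _) = fun y => Ks K e' y - Ks K e y); last by apply/funext => y; rewrite dE.
    by apply: measurable_funB; exact: (measurable_Ks _ cK).
  have p1 : 0 <= A / e' ^+ 2 by rewrite divr_ge0 ?sqr_ge0.
  have p2 : 0 <= A / e ^+ 2 by rewrite divr_ge0 ?sqr_ge0.
  move=> y; split.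
    rewrite -dE; apply: (le_trans (ler_normB _ _)).
    by have := Ks_size y cK e'0; have := Ks_size y cK e0; lra.
  move=> h; rewrite /chi ifF ?mulr0//; apply/negbTE; rewrite negb_and -!ltNge; apply/orP; right; lra.
have k0 : Int (fun y => K y * chi (en y)) = 0 by exact: (czk_annulus cK).
rewrite /tr -cvBl// (_ : (fun w => _) = fun y => K y * chi (en y)); last by apply/funext => y; exact: dE.
rewrite cvC; try exact: bcs_measurable.
have -> : cv g (fun y => K y * chi (en y)) z = Int (fun y => (g ((z : R * R) - y) - g z) * (K y * chi (en y))).
  rewrite cvE -[LHS]subr0 -(mulr0 (g z)) -k0 -IntZ; last exact: bcs_Ig.
  rewrite -IntB; [|by apply: bcs_Ig; apply: bcs_mul => //; exact: bcs_refl|by apply: bcs_Ig; exact: bcsZ].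
  by congr Int; apply/funext => y; ring.
have bd : bcs (fun y => (g ((z : R * R) - y) - g z) * (K y * chi (en y))).
  have [M [M0 gM]] := bcs_bound bg.
  apply: bdd_mul_bcs => //; apply: (@bddI _ _ (2 * M)).
    by apply: measurable_funB; [exact: (bcs_measurable (bcs_refl z bg))|exact: measurable_cst].
  move=> y; apply: (le_trans (ler_normB _ _)).
  by have := (gM ((z : R * R) - y)).1; have := (gM z).1; lra.
have b2 : (2 : R) <= 2 by lra.
have [n ne] := pow_unbounded (2 * e) e'0 b2.
have en' : e * 2^-1 ^+ n < e'.
  rewrite exprVn ltr_pdivrMr ?exprn_gt0//; lra.
pose H i y := 2 ^+ i.+1 / e * \1_(sq 0 (e * 2^-1 ^+ i)) y.
have H0 i y : 0 <= H i y.
  by apply: mulr_ge0; [rewrite divr_ge0 ?exprn_ge0// ltW|case/andP: (indic01 (sq 0 (e * 2^-1 ^+ i)) y)].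
have bH i : bcs (H i) by apply: bcsZ; exact: bcs_indic_sq.
have bsum : bcs (fun y => \sum_(0 <= i < n) H i y) by exact: bcs_sum.
apply: (le_trans (Int_abs (bcs_Ig bd))).
apply: (@le_trans _ _ (A * C * Int (fun y => \sum_(0 <= i < n) H i y))).
  rewrite -IntZ; last exact: bcs_Ig.
  apply: Int_le => [||y]; [by apply: bcs_Ig; exact: bcs_norm|by apply: bcs_Ig; exact: bcsZ|].
  have AC : 0 <= A * C by exact: mulr_ge0.
  rewrite normrM /chi; case: ifPn => [/andP[h1 h2]|_]; last first.
    by rewrite mulr0 normr0 mulr0; apply: mulr_ge0 => //; exact: sumr_ge0.
  rewrite mulr1; have y0 : 0 < en y by lra.
  apply: (@le_trans _ _ ((C * en y) * (A / en y ^+ 2))).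
    apply: ler_pM => //; last exact: (czk_size cK).
    apply: (le_trans (gC _ _)); rewrite ler_wpM2l//.
    by rewrite addrAC subrr add0r enN.
  have -> : C * en y * (A / en y ^+ 2) = A * C * (en y)^-1 by field; rewrite gt_eqF.
  apply: ler_wpM2l => //; apply: (le_trans (near_sum e0 (lt_trans en' h1) h2)).
  apply: ler_sum => i _; rewrite /H; apply: ler_wpM2l; first by rewrite divr_ge0 ?exprn_ge0// ltW.
  case: ifPn => h; last by case/andP: (indic01 (sq 0 (e * 2^-1 ^+ i)) y).
  by rewrite indicE mem_set//; apply: en_sq; rewrite subr0.
rewrite Int_sum//.
have -> : \sum_(0 <= i < n) Int (H i) = 8 * e * \sum_(0 <= i < n) (2^-1 : R) ^+ i.
  rewrite mulr_sumr; apply: eq_bigr => i _; rewrite IntZ; last by apply: bcs_Ig; exact: bcs_indic_sq.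
  rewrite Int_indic_sq; last by rewrite mulr_ge0 ?(ltW e0)// exprn_ge0// invr_ge0.
  have p0 : (2 : R) ^+ i != 0 by rewrite expf_neq0.
  have e00 : e != 0 by rewrite gt_eqF.
  by rewrite exprS exprVn; field; rewrite e00 p0.
have -> : 16 * A * C * e = A * C * (8 * e * 2) by ring.
apply: ler_wpM2l; first exact: mulr_ge0.
by apply: ler_wpM2l; [lra|exact: sum_half].
Qed.

Lemma tr_sub K e f g z : czk A kap K -> 0 < e -> bcs f -> bcs g ->
  tr K e f z = tr K e g z + tr K e (fun w => f w - g w) z.
Proof.
move=> cK e0 bf bg; have bK := bdd_Ks cK e0; rewrite /tr -cvDr//; last exact: bcsB.
by congr (cv _ _ z); apply/funext => w; ring.
Qed.

(** Write [f] as a Lipschitz function plus an error small in [L^2]. The truncations of the former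
    are Cauchy by [tr_lip], those of the latter are small off a set of area at most [1 / (j + 1)] by
    [tr_weak]; the intersection of these sets over [j] is null. The index [m] sets both the region
    and the tolerance. *)
Lemma tr_cauchy_ae K f (m : nat) : czk A kap K -> bcs f ->
  (area R).-negligible [set z | en z <= m%:R /\
    ~ exists2 d, 0 < d & forall e e', 0 < e <= d -> 0 < e' <= d -> `|tr K e f z - tr K e' f z| <= m.+1%:R^-1].
Proof.
move=> cK bf; have [C [C0 HC]] := tr_weak kL cK.
have A0 := czk_A cK.
(* Three terms of size [lam] occur: the truncations of the error at [e] and at [e'], and the
   difference for the Lipschitz part. *)
pose lam : R := m.+1%:R^-1 / 4; have l0 : 0 < lam by rewrite divr_gt0// invr_gt0.
have ex (j : nat) : exists E, [/\ measurable E, (area R E <= (j.+1%:R^-1)%:E)%E &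
   forall z, ~ E z -> en z <= m%:R -> exists2 d, 0 < d &
     forall e e', 0 < e <= d -> 0 < e' <= d -> `|tr K e f z - tr K e' f z| <= m.+1%:R^-1].
  pose eta := j.+1%:R^-1 * lam ^+ 2 / (C + 1).
  have C1 : 0 < C + 1 by lra.
  have eta0 : 0 < eta by rewrite !divr_gt0// mulr_gt0 ?invr_gt0// exprn_gt0.
  have [g [bg [D gD] fg]] := lip_density bf eta0.
  have bfg := bcsB bf bg.
  have [E [mE aE EP]] := HC _ lam m%:R bfg l0.
  exists E; split => //.
    apply: (le_trans aE); rewrite lee_fin.
    have l2 : 0 < lam ^+ 2 by rewrite exprn_gt0.
    apply: (@le_trans _ _ (C / lam ^+ 2 * eta)).
      by apply: ler_wpM2l => //; rewrite divr_ge0// ltW.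
    have -> : C / lam ^+ 2 * eta = j.+1%:R^-1 * (C / (C + 1)) by rewrite /eta; field; rewrite !gt_eqF.
    rewrite ler_piMr ?invr_ge0// ler_pdivrMr// mul1r; lra.
  move=> z zE zm.
  pose D' := `|D| + 1; have D'0 : 0 < D' by rewrite /D'; have := normr_ge0 D; lra.
  have gD' z1 w : `|g z1 - g w| <= D' * en ((z1 : R * R) - w).
    apply: (le_trans (gD z1 w)); apply: ler_wpM2r; first exact: en_ge0.
    by rewrite /D'; have := ler_norm D; lra.
  have P0 : 0 <= 16 * A * D' by apply: mulr_ge0; [exact: mulr_ge0|exact: ltW].
  pose B := 16 * A * D' + 1; have B0 : 0 < B by rewrite /B; lra.
  have lB : 0 < lam / B by rewrite divr_gt0.
  have BE e : 0 < e -> e <= lam / B -> 16 * A * D' * e <= lam.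
    move=> e0 eB; apply: (@le_trans _ _ (B * (lam / B))); last by rewrite mulrC divfK// gt_eqF.
    by apply: ler_pM => //; [exact: ltW|rewrite /B; lra].
  exists (Num.min 1 (lam / B)); first by rewrite lt_min ltr01.
  move=> e e' /andP[e0]; rewrite le_min => /andP[e1 eB] /andP[e'0]; rewrite le_min => /andP[e'1 e'B].
  rewrite (tr_sub z cK e0 bf bg) (tr_sub z cK e'0 bf bg).
  have h1 := EP z zE zm e; have h2 := EP z zE zm e'.
  rewrite e0 e1 in h1; rewrite e'0 e'1 in h2.
  have {}h1 := h1 isT; have {}h2 := h2 isT.
  have h3 : `|tr K e g z - tr K e' g z| <= lam.
    have [ee|/ltW ee] := leP e e'; last first.
      by rewrite distrC; apply: (le_trans (tr_lip z cK bg gD' e'0 ee)); exact: BE.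
    by apply: (le_trans (tr_lip z cK bg gD' e0 ee)); exact: BE.
  have -> : (m.+1%:R^-1 : R) = lam + lam + lam + lam by rewrite /lam; field.
  move: h1 h2 h3; move: (tr K e (fun w => _) z) (tr K e' (fun w => _) z) (tr K e g z) (tr K e' g z) => a b c d h1 h2 h3.
  have -> : c + a - (d + b) = (c - d) + (a - b) by ring.
  by apply: (le_trans (ler_normD _ _)); have := ler_normB a b; lra.
have [E EP] := choice ex.
have mE j : measurable (E j) by case: (EP j).
have mI : measurable (\bigcap_j E j) by exact: bigcapT_measurable.
exists (\bigcap_j E j); split => //.
  apply/eqP; rewrite eq_le measure_ge0 andbT; apply/lee_addgt0Pr => x x0; rewrite add0e.
  pose j := Num.bound x^-1.
  apply: (@le_trans _ _ (area R (E j))).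
    by apply: le_measure; rewrite ?inE// => z; apply.
  have [_ aE _] := EP j; apply: (le_trans aE); rewrite lee_fin.
  rewrite -(invrK x) lef_pV2 ?posrE ?invr_gt0//; apply: ltW.
  apply: (lt_trans (archi_boundP _)); first by rewrite invr_ge0 ltW.
  by rewrite ltr_nat.
move=> z [zm h] j _; apply: contrapT => zE; apply: h.
by have [_ _ H] := EP j; exact: H.
Qed.

Lemma tr_cvg_ae K f : czk A kap K -> bcs f ->
  {ae area R, forall z, cvg (tr K e f z @[e --> 0^'+])}.
Proof.
move=> cK bf.
pose B m := [set z | en z <= m%:R /\
    ~ exists2 d, 0 < d & forall e e', 0 < e <= d -> 0 < e' <= d -> `|tr K e f z - tr K e' f z| <= m.+1%:R^-1].
have nB : (area R).-negligible (\bigcup_m B m).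
  by apply: negligible_bigcup => m; exact: tr_cauchy_ae.
apply: negligibleS nB => z /= nc; apply: contrapT => zB; apply: nc.
apply/cauchy_cvgP/cauchy_exP => eps eps0.
pose m := maxn (Num.bound eps^-1) (Num.bound (en z)).
have zm : en z <= m%:R.
  apply: ltW; apply: (lt_le_trans (archi_boundP (en_ge0 z))).
  by rewrite ler_nat leq_maxr.
have me : m.+1%:R^-1 < eps.
  rewrite -(invrK eps) ltf_pV2 ?posrE ?invr_gt0//.
  apply: (lt_trans (archi_boundP _)); first by rewrite invr_ge0 ltW.
  by rewrite ltr_nat ltnS leq_maxl.
have [d d0 H] : exists2 d, 0 < d & forall e e', 0 < e <= d -> 0 < e' <= d -> `|tr K e f z - tr K e' f z| <= m.+1%:R^-1.
  by apply: contrapT => h; apply: zB; exists m.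
exists (tr K d f z).
suff : \forall e \near 0^'+, ball (tr K d f z) eps (tr K e f z) by [].
near=> e; rewrite -ball_normE/=; apply: le_lt_trans me; apply: H; first by rewrite d0 lexx.
by apply/andP; split; near: e; [exact: nbhs_right_gt|exact: nbhs_right_le].
Unshelve. all: by end_near.
Qed.

End principal_value.

(** * Principal values as measurable functions *)

Section pv.
Context {R : realType}.
Implicit Types (z w y : plane R) (f g h K : plane R -> R).
Notation Ig f := ((area R).-integrable setT (EFin \o f)).

Lemma EFin_Int f : Ig f -> (\int[area R]_z (f z)%:E = (Int f)%:E)%E.
Proof. by move=> If; rewrite unlock /Rintegral fineK//; exact: integrable_fin_num. Qed.

Lemma IgZ (c : R) f : Ig f -> Ig (fun z => c * f z).
Proof.
move=> If; have := integrableZl measurableT c If.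
by congr (integrable _ _ _); apply/funext => z /=; rewrite EFinM.
Qed.

(** Used along the truncation radii [epsn n]; some bounds hold only once these are small, which [n0]
    allows for. *)
Lemma fatou_ae (F : nat -> plane R -> R) (H : plane R -> R) (c : R) (n0 : nat) :
  (forall n, Ig (F n)) -> measurable_fun setT H ->
  (forall n z, 0 <= F n z) -> (forall z, 0 <= H z) ->
  {ae area R, forall z, F n z @[n --> \oo] --> H z} ->
  (forall n, (n0 <= n)%N -> Int (F n) <= c) -> Ig H /\ Int H <= c.
Proof.
move=> bF mH F0 H0 FH Fc.
pose G n z := (F n z)%:E.
have mG n : measurable_fun setT (G n) by have /integrableP[] := bF n.
have G0 n z : (0 <= G n z)%E by rewrite lee_fin.
have mHE : measurable_fun setT (EFin \o H) by exact/measurable_EFinP.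
have le : (\int[area R]_z (H z)%:E <= c%:E)%E.
  have -> : (\int[area R]_z (H z)%:E = \int[area R]_z limn_einf (G ^~ z))%E.
    apply: ae_eq_integral => //.
      by apply: (eq_measurable_fun (fun z => - limn_esup (fun n => - G n z))%E) => //; apply: measurableT_comp => //; apply: measurable_fun_limn_esup => n; exact: measurableT_comp.
    apply: filterS FH => z Fz _.
    have cv : (G n z @[n --> \oo] --> (H z)%:E)%E by apply: cvg_EFin => //; exact: nearW.
    by have [-> _] := cvg_limn_einf_sup cv.
  apply: (le_trans (@fatou _ _ _ (area R) setT measurableT G mG (fun n z _ => G0 n z))).
  rewrite limn_einf_lim; apply: lime_le; first exact: is_cvg_einfs.
  near=> n; apply: (@le_trans _ _ (\int[area R]_z G (maxn n n0) z)%E).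
    by apply: ereal_inf_lbound => /=; exists (maxn n n0) => //=; exact: leq_maxl.
  rewrite EFin_Int ?lee_fin//.
  by apply: Fc; exact: leq_maxr.
have IH : Ig H.
  apply/integrableP; split => //.
  under eq_integral do rewrite /= ger0_norm//.
  by apply: le_lt_trans le _; rewrite ltry.
split => //; rewrite -lee_fin -EFin_Int//.
Unshelve. all: by end_near.
Qed.

Definition epsn (n : nat) : R := n.+1%:R^-1.

Lemma epsn_gt0 n : 0 < epsn n.
Proof. by rewrite invr_gt0. Qed.

Lemma epsn_small (d : R) : 0 < d -> exists n0, forall n, (n0 <= n)%N -> epsn n <= d.
Proof.
move=> d0; exists (Num.bound d^-1) => n nn; rewrite /epsn -(invrK d) lef_pV2 ?posrE ?invr_gt0//.
apply/ltW/(lt_trans (archi_boundP _)); first by rewrite invr_ge0 ltW.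
by rewrite ltr_nat.
Qed.

Lemma epsn_cvg : epsn n @[n --> \oo] --> (0 : R).
Proof.
apply/cvgrPdist_le => e e0; have [n0 H] := epsn_small e0.
exists n0 => // n /= nn; rewrite sub0r normrN ger0_norm ?H//; exact: ltW (epsn_gt0 n).
Qed.

(** An upper limit along a sequence is measurable in [z], and it equals the principal value wherever
    this exists, by [pvE]. *)
Definition pv K f z : R := fine (limn_esup (fun n => (tr K (epsn n) f z)%:E)).

Lemma pvE K f z (l : R) : tr K e f z @[e --> 0^'+] --> l -> pv K f z = l.
Proof.
move=> /cvg_at_rightP/(_ epsn) H.
have cv : tr K (epsn n) f z @[n --> \oo] --> l by apply: H; split; [exact: epsn_gt0|exact: epsn_cvg].
have cvE : ((tr K (epsn n) f z)%:E @[n --> \oo] --> l%:E)%E by apply: cvg_EFin => //; exact: nearW.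
by rewrite /pv; have [_ ->] := cvg_limn_einf_sup cvE.
Qed.

Variables (A kap : R) (L : nat).
Hypothesis kL : kap <= 2 ^+ L.
Notation Cb := (Cb A L).

Lemma measurable_tr K e f : czk A kap K -> 0 < e -> bcs f -> measurable_fun setT (tr K e f).
Proof. by move=> cK e0 bf; apply: bdd_measurable; exact: (tr_bdd cK). Qed.

Lemma measurable_pv K f : czk A kap K -> bcs f -> measurable_fun setT (pv K f).
Proof.
move=> cK bf; apply: (measurableT_comp (@fine_measurable R setT measurableT)).
apply: measurable_fun_limn_esup => n; apply/measurable_EFinP.
exact: (measurable_tr cK (epsn_gt0 n) bf).
Qed.

Lemma pv_ae K f : czk A kap K -> bcs f ->
  {ae area R, forall z, tr K e f z @[e --> 0^'+] --> pv K f z}.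
Proof.
move=> cK bf; apply: filterS (tr_cvg_ae kL cK bf) => z cv.
by have /cvg_ex[l cl] := cv; rewrite (pvE cl).
Qed.

Lemma pv_seq_ae K f : czk A kap K -> bcs f ->
  {ae area R, forall z, tr K (epsn n) f z @[n --> \oo] --> pv K f z}.
Proof.
move=> cK bf; apply: filterS (pv_ae cK bf) => z /cvg_at_rightP; apply.
by split; [exact: epsn_gt0|exact: epsn_cvg].
Qed.

Lemma bcs_tr_sq K e f (a : plane R) r : czk A kap K -> 0 < e -> bcs f ->
  bcs (fun z => tr K e f z * \1_(sq a r) z).
Proof. by move=> cK e0 bf; apply: bdd_indic_bcs; exact: (tr_bdd cK). Qed.

Lemma norm_indic f (B : set (plane R)) z : `|f z| * \1_B z = `|f z * \1_B z|.
Proof. by rewrite normrM (ger0_norm (_ : 0 <= \1_B z)) // indicE ler0n. Qed.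

Lemma pv_bound K f (a : plane R) r : czk A kap K -> bcs f -> 0 <= r ->
  Ig (fun z => `|pv K f z| * \1_(sq a r) z) /\
  Int (fun z => `|pv K f z| * \1_(sq a r) z) <= Cb * nrm2 f * (2 * r).
Proof.
move=> cK bf r0.
apply: (@fatou_ae (fun n z => `|tr K (epsn n) f z| * \1_(sq a r) z) _ _ 0).
- move=> n; under eq_fun do rewrite norm_indic.
  by apply: bcs_Ig; apply: bcs_norm; exact: (bcs_tr_sq _ _ cK (epsn_gt0 n)).
- apply: measurable_funM; last exact: measurable_indic_sq.
  by apply: measurableT_comp => //; exact: (measurable_pv cK).
- by move=> n z; rewrite mulr_ge0// indicE ler0n.
- by move=> z; rewrite mulr_ge0// indicE ler0n.
- apply: filterS (pv_seq_ae cK bf) => z cv; apply: cvgM; last exact: cvg_cst.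
  exact: cvg_norm.
- by move=> n _; exact: (tr_L1_sq kL _ cK (epsn_gt0 n)).
Qed.

(** The splitting of [tr_cauchy_ae], now in the mean over a square: the Lipschitz part is uniformly
    Cauchy by [tr_lip], and [tr_L1_sq] bounds the truncations of the error by its [L^2] norm. *)
Lemma tr_cauchy_L1 K f (a : plane R) r (eta : R) : czk A kap K -> bcs f -> 0 <= r -> 0 < eta ->
  exists2 d, 0 < d & forall e e', 0 < e <= d -> 0 < e' <= d ->
    Int (fun z => `|tr K e f z - tr K e' f z| * \1_(sq a r) z) <= eta.
Proof.
move=> cK bf r0 eta0; have A0 := czk_A cK; have C0 := Cb_ge0 L A0.
pose e1 := eta / (4 * (Cb * (2 * r) + 1)).
have P0 : 0 <= Cb * (2 * r) by apply: mulr_ge0 => //; exact: mulr_ge0.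
have P1 : 0 < 4 * (Cb * (2 * r) + 1) by lra.
have e10 : 0 < e1 by rewrite divr_gt0.
have e12 : 0 < e1 ^+ 2 by rewrite exprn_gt0.
have [g [bg [D gD] fg]] := lip_density bf e12.
have bh := bcsB bf bg; set h := (fun z => f z - g z) in bh fg.
have nh : nrm2 h <= e1.
  by rewrite nrm2E; apply: (le_trans (ler_wsqrtr fg)); rewrite sqrtr_sqr gtr0_norm.
pose D' := `|D| + 1; have D'0 : 0 < D' by rewrite /D'; have := normr_ge0 D; lra.
have gD' z1 w : `|g z1 - g w| <= D' * en ((z1 : R * R) - w).
  apply: (le_trans (gD z1 w)); apply: ler_wpM2r; first exact: en_ge0.
  by rewrite /D'; have := ler_norm D; lra.
pose c := 16 * A * D'; have c0 : 0 <= c by rewrite /c; apply: mulr_ge0; [exact: mulr_ge0|exact: ltW].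
pose S := (2 * r) ^+ 2; have S0 : 0 <= S by exact: sqr_ge0.
have cS : 0 <= c * S by exact: mulr_ge0.
pose d := eta / (2 * (c * S + 1)); have d0 : 0 < d by rewrite divr_gt0//; lra.
exists d => // e e' /andP[e0 ed] /andP[e'0 e'd].
have gg z : `|tr K e g z - tr K e' g z| <= c * d.
  have [ee|/ltW ee] := leP e e'.
    by apply: (le_trans (tr_lip z cK bg gD' e0 ee)); apply: ler_wpM2l.
  by rewrite distrC; apply: (le_trans (tr_lip z cK bg gD' e'0 ee)); apply: ler_wpM2l.
have b1 := bcs_tr_sq a r cK e0 bh; have b2 := bcs_tr_sq a r cK e'0 bh.
have bQ := @bcs_indic_sq R a r.
have bd : bcs (fun z => `|tr K e f z - tr K e' f z| * \1_(sq a r) z).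
  under eq_fun do rewrite (norm_indic (fun z => tr K e f z - tr K e' f z)) mulrBl.
  by apply: bcs_norm; apply: bcsB; exact: (bcs_tr_sq _ _ cK).
have n1 := bcs_norm b1; have n2 := bcs_norm b2; have n3 := bcsZ (c * d) bQ.
apply: (@le_trans _ _ (Int (fun z => `|tr K e h z * \1_(sq a r) z|) +
   Int (fun z => `|tr K e' h z * \1_(sq a r) z|) + Int (fun z => c * d * \1_(sq a r) z))).
  rewrite -IntD; [|exact: bcs_Ig..]; rewrite -IntD; [|by apply: bcs_Ig => //; exact: bcsD..].
  apply: Int_le => [||z]; [exact: bcs_Ig|by apply: bcs_Ig; apply: bcsD => //; exact: bcsD|].
  rewrite -!norm_indic -!mulrDl; apply: ler_wpM2r; first by rewrite indicE ler0n.
  rewrite (tr_sub z cK e0 bf bg) (tr_sub z cK e'0 bf bg) -/h.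
  have := gg z; move: (tr K e h z) (tr K e' h z) (tr K e g z) (tr K e' g z) => x y u v uv.
  have -> : u + x - (v + y) = (u - v) + (x - y) by ring.
  by apply: (le_trans (ler_normD _ _)); have := ler_normB x y; lra.
have h1 : Int (fun z => `|tr K e h z * \1_(sq a r) z|) <= eta / 4.
  under eq_fun do rewrite -norm_indic.
  apply: (le_trans (tr_L1_sq kL a cK e0 bh r0)).
  rewrite mulrAC; apply: (le_trans (ler_wpM2l P0 nh)).
  by rewrite /e1 mulrA ler_pdivrMr//; have := ltW eta0; nra.
have h2 : Int (fun z => `|tr K e' h z * \1_(sq a r) z|) <= eta / 4.
  under eq_fun do rewrite -norm_indic.
  apply: (le_trans (tr_L1_sq kL a cK e'0 bh r0)).
  rewrite mulrAC; apply: (le_trans (ler_wpM2l P0 nh)).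
  by rewrite /e1 mulrA ler_pdivrMr//; have := ltW eta0; nra.
have h3 : Int (fun z => c * d * \1_(sq a r) z) <= eta / 2.
  rewrite IntZ; last exact: bcs_Ig.
  rewrite Int_indic_sq// -/S /d.
  have -> : c * (eta / (2 * (c * S + 1))) * S = eta / 2 * (c * S / (c * S + 1)).
    by field; rewrite gt_eqF//; lra.
  apply: ler_piMr; first by apply: divr_ge0 => //; exact: ltW.
  by rewrite ler_pdivrMr; lra.
lra.
Qed.

Lemma tr_pv_L1 K f (a : plane R) r (eta : R) : czk A kap K -> bcs f -> 0 <= r -> 0 < eta ->
  exists2 d, 0 < d & forall e, 0 < e <= d ->
    Ig (fun z => `|tr K e f z - pv K f z| * \1_(sq a r) z) /\
    Int (fun z => `|tr K e f z - pv K f z| * \1_(sq a r) z) <= eta.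
Proof.
move=> cK bf r0 eta0; have [d d0 H] := tr_cauchy_L1 a cK bf r0 eta0.
exists d => // e ed; have [n0 nP] := epsn_small d0; have /andP[e0 _] := ed.
apply: (@fatou_ae (fun n z => `|tr K e f z - tr K (epsn n) f z| * \1_(sq a r) z) _ _ n0).
- move=> n; under eq_fun do rewrite (norm_indic (fun z => tr K e f z - tr K (epsn n) f z)) mulrBl.
  by apply: bcs_Ig; apply: bcs_norm; apply: bcsB; apply: (bcs_tr_sq _ _ cK) => //; exact: epsn_gt0.
- apply: measurable_funM; last exact: measurable_indic_sq.
  apply: measurableT_comp => //; apply: measurable_funB; first exact: (measurable_tr cK).
  exact: (measurable_pv cK).
- by move=> n z; rewrite mulr_ge0// indicE ler0n.
- by move=> z; rewrite mulr_ge0// indicE ler0n.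
- apply: filterS (pv_seq_ae cK bf) => z cv; apply: cvgM; last exact: cvg_cst.
  by apply: cvg_norm; apply: cvgB => //; exact: cvg_cst.
- by move=> n nn; apply: H => //; rewrite epsn_gt0 nP.
Qed.

Lemma Ig_pv_mul K f h : czk A kap K -> bcs f -> bcs h -> Ig (fun z => pv K f z * h z).
Proof.
move=> cK bf bh; have [M [M0 hM]] := bcs_bound bh.
have [I1 _] := pv_bound 0 cK bf (ltW M0).
apply: (@le_integrable _ _ _ (area R) setT measurableT _ (EFin \o (fun z => M * (`|pv K f z| * \1_(sq 0 M) z)))).
- apply/measurable_EFinP; apply: measurable_funM; last exact: bcs_measurable.
  exact: (measurable_pv cK).
- move=> z _; rewrite lee_fin; have [h1 h2] := hM z.
  have [zM|zM] := pselect (sq 0 M z).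
    rewrite indicE mem_set// mulr1 !normrM normr_id (gtr0_norm M0) mulrC.
    by apply: ler_wpM2r.
  rewrite h2 ?mulr0 ?normr0// ltNge; apply/negP => h3; apply: zM.
  by apply: en_sq; rewrite subr0.
- exact: IgZ.
Qed.

(** For truncations this is the adjoint identity [dot_cv]; both sides pass to the limit by
    convergence in [L^1] on a square containing the support of the other factor. *)
Lemma pv_pairing K f h : czk A kap K -> bcs f -> bcs h ->
  Int (fun z => pv K f z * h z) = Int (fun z => f z * pv (rf K) h z).
Proof.
move=> cK bf bh; have crK := czk_rf cK.
have key K' u v (eta : R) : czk A kap K' -> bcs u -> bcs v -> 0 < eta ->
    exists2 d, 0 < d & forall e, 0 < e <= d ->
      `|dot (tr K' e u) v - Int (fun z => pv K' u z * v z)| <= eta.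
  move=> cK' bu bv eta0; have [M [M0 vM]] := bcs_bound bv.
  have e0' : 0 < eta / M by rewrite divr_gt0.
  have [d d0 H] := tr_pv_L1 0 cK' bu (ltW M0) e0'.
  exists d => // e ed; have /andP[e0 _] := ed; have [Ie He] := H e ed.
  have I1 : Ig (fun z => tr K' e u z * v z).
    by apply: bcs_Ig; apply: bdd_mul_bcs => //; exact: (tr_bdd cK').
  have I2 := Ig_pv_mul cK' bu bv.
  rewrite dotE -IntB//.
  have I3 : Ig (fun z => tr K' e u z * v z - pv K' u z * v z).
    by have := integrableB measurableT I1 I2.
  apply: (le_trans (Int_abs I3)).
  apply: (@le_trans _ _ (M * Int (fun z => `|tr K' e u z - pv K' u z| * \1_(sq 0 M) z))); last first.
    by rewrite mulrC -ler_pdivlMr.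
  rewrite -IntZ//; apply: Int_le.
  - exact: integrable_norm.
  - exact: IgZ.
  - move=> z; have [h1 h2] := vM z; rewrite -mulrBl normrM.
    have [zM|zM] := pselect (sq 0 M z).
      by rewrite indicE mem_set// mulr1 mulrC; apply: ler_wpM2r.
    rewrite h2 ?normr0 ?mulr0; first by rewrite mulr_ge0 ?(ltW M0)// mulr_ge0// indicE ler0n.
    rewrite ltNge; apply/negP => h3; apply: zM; by apply: en_sq; rewrite subr0.
apply/eqP; rewrite eq_le; apply/andP.
have main (eta : R) : 0 < eta -> `|Int (fun z => pv K f z * h z) - Int (fun z => f z * pv (rf K) h z)| <= eta.
  move=> eta0; have eta2 : 0 < eta / 2 by rewrite divr_gt0.
  have [d1 d10 H1] := key K f h _ cK bf bh eta2.
  have [d2 d20 H2] := key (rf K) h f _ crK bh bf eta2.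
  pose d := Num.min d1 d2; have d0 : 0 < d by rewrite lt_min d10.
  have := H1 d; rewrite d0 ge_min lexx => /(_ isT) {}H1.
  have := H2 d; rewrite d0 ge_min lexx orbT => /(_ isT) {}H2.
  have E : dot (tr K d f) h = dot (tr (rf K) d h) f.
    by rewrite /tr dot_cv//; [rewrite Ks_rf dotC|exact: (bdd_Ks cK)].
  have C : Int (fun z => f z * pv (rf K) h z) = Int (fun z => pv (rf K) h z * f z).
    by congr Int; apply/funext => z; rewrite mulrC.
  rewrite C; rewrite E in H1; rewrite distrC in H1.
  have tri (x y w : R) : `|y - x| <= eta / 2 -> `|x - w| <= eta / 2 -> `|y - w| <= eta.
    move=> h1 h2; have -> : y - w = (y - x) + (x - w) by ring.
    by apply: (le_trans (ler_normD _ _)); lra.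
  exact: (tri _ _ _ H1 H2).
have : `|Int (fun z => pv K f z * h z) - Int (fun z => f z * pv (rf K) h z)| <= 0.
  by apply/ler_addgt0Pr => e e0; rewrite add0r; exact: main.
by rewrite normr_le0 subr_eq0 => /eqP ->; rewrite lexx.
Qed.

End pv.

(** * Oscillation of principal values *)

Section local_estimates.
Context {R : realType}.
Implicit Types (z w y : plane R) (f g h K u : plane R -> R).
Notation Ig f := ((area R).-integrable setT (EFin \o f)).

Lemma bdd_fark_shift (G : R -> R) (e : R) z : measurable_fun setT G -> 0 < e ->
  (forall r s, e <= r -> r <= s -> 0 <= G s <= G r) ->
  bdd (fun w => fark G e ((w : R * R) - z)).
Proof.
move=> mG e0 anti; have [C [_ HC]] := bdd_bound (bdd_fark mG e0 anti).
apply: (@bddI _ _ C) => //; apply: (measurableT_comp (measurable_fark e mG)).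
by apply: measurable_sub => //; exact: measurable_cst.
Qed.

Lemma Int_far_le (G : R -> R) (e c F S : R) z g u : measurable_fun setT G -> 0 < e ->
  (forall r s, e <= r -> r <= s -> 0 <= G s <= G r) ->
  (forall n, \sum_(0 <= i < n) G (e * 2 ^+ i) * (e * 2 ^+ i) ^+ 2 <= S) ->
  bcs g -> (forall w, `|g w| <= F) -> bcs u -> 0 <= c ->
  (forall w, `|u w| <= c * (fark G e ((w : R * R) - z) * `|g w|)) ->
  `|Int u| <= c * (16 * F * S).
Proof.
move=> mG e0 anti GS bg gF bu c0 ug.
have F0 : 0 <= F by apply: le_trans (gF 0).
have bn := bcs_norm bg.
have b1 := bdd_mul_bcs (bdd_fark_shift z mG e0 anti) bn.
apply: (le_trans (Int_abs (bcs_Ig bu))).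
apply: (@le_trans _ _ (Int (fun w => c * (fark G e ((w : R * R) - z) * `|g w|)))).
  by apply: Int_le => //; apply: bcs_Ig; [exact: bcs_norm|exact: bcsZ].
rewrite IntZ; last exact: bcs_Ig.
apply: ler_wpM2l => //; have -> : 16 * F * S = 4 * (4 * F) * S by ring.
apply: Int_far => //; first by rewrite mulr_ge0.
move=> r er; apply: Int_sq_bound => //; first by move=> w; rewrite gF normr_ge0.
lra.
Qed.

Lemma Int_le_ae (u v : plane R -> R) : measurable_fun setT u -> Ig v ->
  (forall z, 0 <= u z) -> (forall z, 0 <= v z) ->
  {ae area R, forall z, u z <= v z} -> Ig u /\ Int u <= Int v.
Proof.
move=> mu Iv u0 v0 uv.
have le : (\int[area R]_z (u z)%:E <= \int[area R]_z (v z)%:E)%E.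
  apply: ae_ge0_le_integral => //.
  - by move=> z _; rewrite lee_fin.
  - exact/measurable_EFinP.
  - by move=> z _; rewrite lee_fin.
  - by have /integrableP[] := Iv.
  - by apply: filterS uv => z h _; rewrite lee_fin.
have Iu : Ig u.
  apply/integrableP; split; first exact/measurable_EFinP.
  under eq_integral do rewrite /= ger0_norm//.
  by apply: le_lt_trans le _; rewrite EFin_Int// ltry.
by split => //; rewrite -lee_fin -!EFin_Int.
Qed.

Lemma Int_ae_eq (u v : plane R -> R) : measurable_fun setT u -> measurable_fun setT v ->
  {ae area R, forall z, u z = v z} -> Int u = Int v.
Proof.
move=> mu mv uv; rewrite unlock /Rintegral; congr fine.
apply: ae_eq_integral => //; [exact/measurable_EFinP|exact/measurable_EFinP|].
by apply: filterS uv => z h _; rewrite h.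
Qed.

Lemma indic_ge0 (B : set (plane R)) z : 0 <= \1_B z :> R.
Proof. by rewrite indicE ler0n. Qed.

Lemma Ig_exhaust (p : plane R -> R) (C : R) : measurable_fun setT p ->
  (forall n : nat, Ig (fun z => `|p z| * \1_(sq 0 n%:R) z)) ->
  (forall n : nat, Int (fun z => `|p z| * \1_(sq 0 n%:R) z) <= C) -> Ig p.
Proof.
move=> mp Ip IpC.
have mn : measurable_fun setT (fun z => `|p z|) by exact: measurableT_comp.
have [||||H _] := @fatou_ae R (fun n z => `|p z| * \1_(sq 0 n%:R) z) (fun z => `|p z|) C 0 Ip mn.
- by move=> n z; rewrite mulr_ge0// indicE ler0n.
- by [].
- apply: aeW => z; apply: cvg_near_cst; near=> n.
  rewrite indicE mem_set ?mulr1//; apply: en_sq; rewrite subr0.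
  near: n; exact: nbhs_infty_ger.
- by move=> n _; exact: IpC.
apply: le_integrable H => //; first exact/measurable_EFinP.
by move=> z _; rewrite lee_fin normr_id.
Unshelve. all: by end_near.
Qed.

Variables (A kap : R) (L : nat).
Hypothesis kL : kap <= 2 ^+ L.
Notation Cb := (Cb A L).

Lemma bcs_away K g (e : R) z : czk A kap K -> bcs g -> 0 < e ->
  (forall w, en ((z : R * R) - w) <= e -> g w = 0) ->
  bcs (fun w => K ((z : R * R) - w) * g w).
Proof.
move=> cK bg e0 g0.
have -> : (fun w => K ((z : R * R) - w) * g w) = (fun w => Ks K e ((z : R * R) - w) * g w).
  by apply/funext => w; rewrite KsE; case: ltP => // h; rewrite g0 ?mulr0.
by apply: bdd_mul_bcs => //; apply: bdd_shift; exact: bdd_Ks cK e0.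
Qed.

Lemma pv_away K g (e : R) z : czk A kap K -> bcs g -> 0 < e ->
  (forall w, en ((z : R * R) - w) <= e -> g w = 0) ->
  pv K g z = Int (fun w => K ((z : R * R) - w) * g w).
Proof.
move=> cK bg e0 g0; apply: pvE; apply: cvg_near_cst; near=> d.
rewrite /tr cvE; congr Int; apply/funext => w; rewrite KsE; case: ltP => // h.
rewrite g0 ?mulr0//; apply: (le_trans h); near: d; exact: nbhs_right_le.
Unshelve. all: by end_near.
Qed.

(** The second bound takes the better of smoothness and size. The size bound adds the two values of
    [K], at distances [r] and at least [r / 2], whence [5 = 1 + 4]. *)
Lemma kernel_diff K z z0 w (e : R) : czk A kap K -> 0 < e ->
  2 * en ((z : R * R) - z0) <= e -> e < en ((w : R * R) - z0) ->
  `|K ((z : R * R) - w) - K ((z0 : R * R) - w)| <=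
    A * kap * en ((z : R * R) - z0) * G3 (en ((w : R * R) - z0)) /\
  `|K ((z : R * R) - w) - K ((z0 : R * R) - w)| <= 5 * A * Gm kap e (en ((w : R * R) - z0)).
Proof.
move=> cK e0 ze wz; have A0 := czk_A cK; have k1 := czk_kap cK.
have r0 : 0 < en ((w : R * R) - z0) by lra.
have t0 := en_ge0 ((z : R * R) - z0).
have hz : 2 * en ((z0 : R * R) - z) <= en ((z0 : R * R) - w).
  by rewrite (enB z0 z) (enB z0 w); lra.
have H1 : `|K ((z : R * R) - w) - K ((z0 : R * R) - w)| <=
    A * kap * en ((z : R * R) - z0) * G3 (en ((w : R * R) - z0)).
  have := czk_smooth cK hz.
  have -> : (z0 : R * R) - w - ((z0 : R * R) - z) = (z : R * R) - w.
    by rewrite opprB addrC addrA subrK.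
  by rewrite /G3 (enB w z0) (enB z z0).
split=> //.
have H2 : `|K ((z : R * R) - w) - K ((z0 : R * R) - w)| <= 5 * A / en ((w : R * R) - z0) ^+ 2.
  apply: (le_trans (ler_normB _ _)).
  have h1 := czk_size cK ((z0 : R * R) - w).
  have r2 : 0 < en ((w : R * R) - z0) / 2 by lra.
  have h3 : en ((w : R * R) - z0) / 2 <= en ((z : R * R) - w).
    have := enD ((w : R * R) - z) ((z : R * R) - z0); rewrite addrA subrK (enB w z); lra.
  have h2 := size_away cK r2 h3.
  rewrite (enB z0 w) in h1; move: h1 h2; set r := en ((w : R * R) - z0) => h1 h2.
  have E : A / (r / 2) ^+ 2 = 4 * (A / r ^+ 2) by field; rewrite gt_eqF.
  have -> : 5 * A / r ^+ 2 = 5 * (A / r ^+ 2) by ring.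
  by rewrite E in h2; lra.
move: H1 H2; set r := en ((w : R * R) - z0) => H1 H2; rewrite /Gm.
have ir : 0 <= (r ^+ 2)^-1 by rewrite invr_ge0 sqr_ge0.
have [h|h] := leP 1 (kap * (e / r)); first by rewrite mul1r.
apply: (le_trans H1).
have -> : 5 * A * (kap * (e / r) / r ^+ 2) = 5 * (A * kap * e * G3 r).
  by rewrite /G3; field; rewrite gt_eqF.
have g0 : 0 <= G3 r by rewrite /G3 invr_ge0 exprn_ge0// ltW.
have Ak : 0 <= A * kap by rewrite mulr_ge0//; lra.
apply: (@le_trans _ _ (A * kap * e * G3 r)).
  by apply: ler_wpM2r => //; apply: ler_wpM2l => //; lra.
apply: ler_peMl; [by apply: mulr_ge0 => //; apply: mulr_ge0 => //; exact: ltW|lra].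
Qed.

(** Two estimates for two purposes: the first is small when [|z - z0|] is small against [e / kap]
    and gives the convergence of the extension to bounded functions; the second is merely bounded,
    but with a logarithm in place of [kap], and gives the BMO bound. *)
Lemma pv_farB K g z z0 (e F : R) : czk A kap K -> bcs g -> 0 < e -> (forall w, `|g w| <= F) ->
  2 * en ((z : R * R) - z0) <= e -> (forall w, en ((w : R * R) - z0) <= e -> g w = 0) ->
  `|pv K g z - pv K g z0| <= A * kap * en ((z : R * R) - z0) * (16 * F * (2 / e)) /\
  `|pv K g z - pv K g z0| <= 5 * A * (16 * F * (L%:R + 2)).
Proof.
move=> cK bg e0 gF ze g0; have A0 := czk_A cK; have k1 := czk_kap cK.
have t0 := en_ge0 ((z : R * R) - z0).
have e2 : 0 < e / 2 by lra.
have g1 w : en ((z : R * R) - w) <= e / 2 -> g w = 0.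
  move=> h; apply: g0; have := enD ((w : R * R) - z) ((z : R * R) - z0).
  rewrite addrA subrK (enB w z); lra.
have g2 w : en ((z0 : R * R) - w) <= e -> g w = 0 by rewrite enB; exact: g0.
have b1 := bcs_away cK bg e2 g1; have b2 := bcs_away cK bg e0 g2.
rewrite (pv_away cK bg e2 g1) (pv_away cK bg e0 g2) -IntB; [|exact: bcs_Ig..].
have bD := bcsB b1 b2.
have k0 : 0 <= kap by lra.
split.
- apply: (@Int_far_le (@G3 R) e _ F (2 / e) z0 g) => //.
  + exact: measurable_G3.
  + by move=> r s; exact: G3_anti.
  + by move=> n; exact: G3_sum.
  + by rewrite !mulr_ge0.
  + move=> w; rewrite -mulrBl normrM farkE mulrA; case: ifPn => h.
      by apply: ler_wpM2r => //; exact: (kernel_diff cK e0 ze h).1.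
    by rewrite g0 ?normr0 ?mulr0// leNgt.
- apply: (@Int_far_le (Gm kap e) e _ F (L%:R + 2) z0 g) => //.
  + exact: measurable_Gm.
  + by move=> r s; exact: Gm_anti.
  + by move=> n; exact: Gm_sum.
  + by rewrite !mulr_ge0.
  + move=> w; rewrite -mulrBl normrM farkE mulrA; case: ifPn => h.
      by apply: ler_wpM2r => //; exact: (kernel_diff cK e0 ze h).2.
    by rewrite g0 ?normr0 ?mulr0// leNgt.
Qed.

Lemma pvD_ae K f g : czk A kap K -> bcs f -> bcs g ->
  {ae area R, forall z, pv K (fun w => f w + g w) z = pv K f z + pv K g z}.
Proof.
move=> cK bf bg.
apply: filterS2 (pv_ae kL cK bf) (pv_ae kL cK bg) => z cf cg; apply: pvE.
apply: cvg_trans (cvgD cf cg); apply: near_eq_cvg; near=> e.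
have e0 : 0 < e by near: e; exact: nbhs_right_gt.
by rewrite /tr cvDr//; exact: bdd_Ks cK e0.
Unshelve. all: by end_near.
Qed.

Definition disk (z0 : plane R) (e : R) : set (plane R) := [set w | en ((w : R * R) - z0) <= e].

Lemma measurable_disk z0 e : measurable (disk z0 e).
Proof.
have -> : disk z0 e = setT `&` (fun w : plane R => en ((w : R * R) - z0)) @^-1` `]-oo, e]%classic.
  by rewrite setTI; apply/seteqP; split => z /=; rewrite in_itv.
have me : measurable_fun setT (fun w : plane R => en ((w : R * R) - z0)).
  apply: (measurableT_comp (@measurable_en R)).
  by apply: measurable_sub => //; exact: measurable_cst.
by apply: me => //; exact: measurable_itv.
Qed.

Lemma bcs_disk g z0 (e : R) : bcs g -> bcs (fun w => g w * \1_(disk z0 e) w).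
Proof. by move=> bg; apply: bcs_indic => //; exact: measurable_disk. Qed.

Lemma nrm2_disk g z0 (e F : R) : bcs g -> (forall w, `|g w| <= F) -> 0 <= e ->
  nrm2 (fun w => g w * \1_(disk z0 e) w) <= F * (2 * e).
Proof.
move=> bg gF e0; have F0 : 0 <= F by apply: le_trans (gF 0).
have bd := bcs_disk z0 e bg.
rewrite nrm2E dotE -(ger0_norm (_ : 0 <= F * (2 * e))); last by rewrite !mulr_ge0.
rewrite -sqrtr_sqr; apply: ler_wsqrtr.
have E : (F * (2 * e)) ^+ 2 = F ^+ 2 * (2 * e) ^+ 2 by rewrite exprMn.
rewrite E; apply: le_trans (@Int_le_sq _ _ z0 e (F ^+ 2) (bcs_measurable (bcs_mul bd bd)) e0 _ _).
- by apply: Int_le => [||z]; [apply: bcs_Ig; exact: bcs_mul|apply: bcs_Ig; apply: bcs_norm; exact: bcs_mul|exact: ler_norm].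
- move=> z; rewrite -expr2 normrX; apply: lerXn2r; rewrite ?nnegrE ?normr_ge0//.
  rewrite normrM indicE; case: (_ \in _); rewrite ?normr1 ?mulr1// normr0 mulr0//.
- move=> z zs; rewrite indicE memNset ?mulr0// => zd; apply: zs; exact: en_sq.
Qed.

Lemma pv_bmo K g z0 (r F : R) : czk A kap K -> bcs g -> (forall w, `|g w| <= F) -> 0 < r ->
  exists c : R, Ig (fun z => `|pv K g z - c| * \1_(sq z0 r) z) /\
    Int (fun z => `|pv K g z - c| * \1_(sq z0 r) z) <= 17 * Cb * F * r ^+ 2.
Proof.
move=> cK bg gF r0; have A0 := czk_A cK; have C0 := Cb_ge0 L A0.
have F0 : 0 <= F by apply: le_trans (gF 0).
(* Points of the square are within [2 r] of its centre, and [pv_farB] asks for twice that distance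
   to be at most [e]. *)
pose e := 4 * r; have e0 : 0 < e by rewrite /e; lra.
have b1 := bcs_disk z0 e bg; set g1 := (fun w => _) in b1.
have b2 : bcs (fun w => g w - g1 w) := bcsB bg b1.
set g2 := (fun w => g w - g1 w) in b2.
pose c := pv K g2 z0; exists c.
have g20 w : en ((w : R * R) - z0) <= e -> g2 w = 0.
  by move=> h; rewrite /g2 /g1 indicE mem_set// mulr1 subrr.
have g2F w : `|g2 w| <= F.
  rewrite /g2 /g1 indicE; case: (_ \in _); rewrite ?mulr1 ?subrr ?normr0//.
  by rewrite mulr0 subr0.
pose T := 5 * A * (16 * F * (L%:R + 2)).
have far z : sq z0 r z -> `|pv K g2 z - c| <= T.
  move=> /sq_en h; apply: (pv_farB cK b2 e0 g2F _ g20).2.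
  by rewrite /e; lra.
have [I1 B1] := pv_bound kL z0 cK b1 (ltW r0).
have I2 : Ig (fun z => T * \1_(sq z0 r) z) by apply: IgZ; apply: Ig_indic_sq; exact: ltW.
have L2 : 0 <= L%:R + 2 :> R by have := ler0n R L; lra.
have T0 : 0 <= T by rewrite /T; apply: mulr_ge0; apply: mulr_ge0 => //; exact: mulr_ge0.
have mpv : measurable_fun setT (fun z => `|pv K g z - c| * \1_(sq z0 r) z).
  apply: measurable_funM; last exact: measurable_indic_sq.
  apply: measurableT_comp => //; apply: measurable_funB; last exact: measurable_cst.
  exact: (measurable_pv cK).
have I3 : Ig (fun z => `|pv K g1 z| * \1_(sq z0 r) z + T * \1_(sq z0 r) z).
  by have := integrableD measurableT I1 I2.
have ae : {ae area R, forall z, `|pv K g z - c| * \1_(sq z0 r) z <=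
    `|pv K g1 z| * \1_(sq z0 r) z + T * \1_(sq z0 r) z}.
  have := pvD_ae cK b1 b2.
  have -> : (fun w => g1 w + g2 w) = g by apply/funext => w; rewrite /g2 addrC subrK.
  apply: filterS => z ->; rewrite -mulrDl indicE.
  have [|_] := boolP (z \in _); last by rewrite !mulr0.
  rewrite inE !mulr1 => /far h; rewrite -addrA; apply: (le_trans (ler_normD _ _)).
  by rewrite lerD2l.
have p0 z : 0 <= `|pv K g1 z| * \1_(sq z0 r) z + T * \1_(sq z0 r) z.
  by rewrite addr_ge0// mulr_ge0// indic_ge0.
have [Ig3 H] := Int_le_ae mpv I3 (fun z => mulr_ge0 (normr_ge0 _) (indic_ge0 _ _)) p0 ae.
split => //; apply: (le_trans H).
rewrite IntD// IntZ; last by apply: Ig_indic_sq; exact: ltW.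
rewrite Int_indic_sq; last exact: ltW.
have n1 := nrm2_disk z0 bg gF (ltW e0).
(* Of the [17], the near part takes [16] through its [L^2] norm [F * 2 e]; the far part takes [1],
   since its constant [320] is below [2^17]. *)
have B2 : Int (fun z => `|pv K g1 z| * \1_(sq z0 r) z) <= 16 * Cb * F * r ^+ 2.
  apply: (le_trans B1); have -> : 16 * Cb * F * r ^+ 2 = Cb * (F * (2 * e)) * (2 * r).
    by rewrite /e; ring.
  apply: ler_wpM2r; first lra.
  exact: ler_wpM2l.
have B3 : T * (2 * r) ^+ 2 <= Cb * F * r ^+ 2.
  have -> : T * (2 * r) ^+ 2 = 320 * (A * (F * (L%:R + 2)) * r ^+ 2) by rewrite /T; ring.
  have -> : Cb * F * r ^+ 2 = 2 ^+ 17 * (A * (F * (L%:R + 2)) * r ^+ 2).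
    by rewrite /Cb /Vc (exprS _ 16); ring.
  have P0 : 0 <= A * (F * (L%:R + 2)) * r ^+ 2.
    by apply: mulr_ge0; [apply: mulr_ge0 => //; exact: mulr_ge0|exact: sqr_ge0].
  apply: ler_wpM2r => //; lra.
move: B2 B3; move: (Int _) => x; lra.
Qed.

(** As [h] has mean zero, [K z] may be subtracted from the kernel, and smoothness gives decay of
    order [|z|^-3]. *)
Lemma pv_decay K h (M : R) z : czk A kap K -> bcs h -> Int h = 0 -> 0 < M -> bcsM M h -> 2 * M < en z ->
  `|pv K h z| <= A * kap * M * nrm1 h * G3 (en z).
Proof.
move=> cK bh h0 M0 hM zM; have A0 := czk_A cK; have k1 := czk_kap cK.
have near0 w : en ((z : R * R) - w) <= M -> h w = 0.
  by move=> zw; apply: (hM w).2; have := en_subl z w; lra.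
have b1 := bcs_away cK bh M0 near0; have b2 := bcsZ (K z) bh.
rewrite (pv_away cK bh M0 near0).
have -> : Int (fun w => K ((z : R * R) - w) * h w) = Int (fun w => K ((z : R * R) - w) * h w - K z * h w).
  by rewrite IntB ?IntZ ?h0 ?mulr0 ?subr0//; exact: bcs_Ig.
have bD := bcsB b1 b2.
apply: (le_trans (Int_abs (bcs_Ig bD))).
have -> : A * kap * M * nrm1 h * G3 (en z) = A * kap * M * G3 (en z) * nrm1 h by ring.
rewrite nrm1E -IntZ; last by apply: bcs_Ig; exact: bcs_norm.
apply: Int_le => [||w]; [by apply: bcs_Ig; exact: bcs_norm|by apply: bcs_Ig; apply: bcsZ; exact: bcs_norm|].
rewrite -mulrBl normrM.
have [wM|wM] := ltP M (en w); first by rewrite (hM w).2// normr0 !mulr0.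
apply: ler_wpM2r => //.
have zw : 2 * en w <= en z by lra.
apply: (le_trans (czk_smooth cK zw)); apply: ler_wpM2r; first by rewrite invr_ge0 exprn_ge0 ?en_ge0.
by apply: ler_wpM2l; [rewrite mulr_ge0//; lra|].
Qed.

(** Integrable near the origin by [pv_bound] and at infinity by [pv_decay]. This gives a meaning to
    the pairing of [pv K h] with a function that is only bounded. *)
Lemma Ig_pv K h : czk A kap K -> bcs h -> Int h = 0 -> Ig (pv K h).
Proof.
move=> cK bh h0; have A0 := czk_A cK; have k1 := czk_kap cK.
have [M [M0 hM]] := bcs_bound bh; have m0 : 0 <= 2 * M by lra. have m1 : 0 < 2 * M by lra.
pose c := A * kap * M * nrm1 h.
have c0 : 0 <= c by rewrite /c !mulr_ge0 ?nrm1_ge0//; lra.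
have [I1 _] := pv_bound kL 0 cK bh m0.
have anti s t : 2 * M <= s -> s <= t -> 0 <= G3 t <= G3 s by exact: G3_anti.
have bf := bdd_fark_shift 0 (@measurable_G3 R) m1 anti.
have ind n : bcs (\1_(sq 0 n%:R) : plane R -> R) := bcs_indic_sq 0 n%:R.
have bfn n := bcsZ c (bdd_mul_bcs bf (ind n)).
pose C := Int (fun z => `|pv K h z| * \1_(sq 0 (2 * M)) z) + c * (4 * 4 * (2 / (2 * M))).
have main (n : nat) : Ig (fun z => `|pv K h z| * \1_(sq 0 n%:R) z) /\
    Int (fun z => `|pv K h z| * \1_(sq 0 n%:R) z) <=
    Int (fun z => `|pv K h z| * \1_(sq 0 (2 * M)) z +
      c * (fark (@G3 R) (2 * M) ((z : R * R) - 0) * \1_(sq 0 n%:R) z)).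
  have f0 z : 0 <= fark (@G3 R) (2 * M) z.
    rewrite farkE; case: ifPn => // zM; have /andP[] := anti (en z) (en z) (ltW zM) (lexx _); lra.
  have fi z : 0 <= c * (fark (@G3 R) (2 * M) z * \1_(sq 0 n%:R) z).
    by apply: mulr_ge0 => //; apply: mulr_ge0; [exact: f0|exact: indic_ge0].
  apply: Int_le_ae.
  - apply: measurable_funM; last exact: measurable_indic_sq.
    by apply: measurableT_comp => //; exact: (measurable_pv cK).
  - by have := integrableD measurableT I1 (bcs_Ig (bfn n)).
  - by move=> z; rewrite mulr_ge0 ?indic_ge0 //.
  - by move=> z; rewrite subr0; apply: addr_ge0 => //; apply: mulr_ge0 => //; exact: indic_ge0.
  - apply: aeW => z; rewrite subr0; have [zM|zM] := leP (en z) (2 * M).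
      apply: (@le_trans _ _ (`|pv K h z| * \1_(sq 0 (2 * M)) z)).
        apply: ler_wpM2l => //; rewrite [leRHS]indicE mem_set; last by apply: en_sq; rewrite subr0.
        by rewrite indicE lern1 leq_b1.
      by rewrite lerDl.
    apply: (@le_trans _ _ (c * (fark (@G3 R) (2 * M) z * \1_(sq 0 n%:R) z))); last first.
      by rewrite lerDr mulr_ge0 ?indic_ge0 //.
    rewrite mulrA; apply: ler_wpM2r; first exact: indic_ge0.
    by rewrite farkE zM; exact: pv_decay.
apply: (@Ig_exhaust _ C); first exact: (measurable_pv cK).
  by move=> n; case: (main n).
move=> n; apply: (le_trans (main n).2); rewrite IntD ?lerD2l//; [|exact: bcs_Ig].
rewrite IntZ; last by apply: bcs_Ig; exact: bdd_mul_bcs.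
apply: ler_wpM2l => //.
apply: (Int_far (@measurable_G3 R) m1 anti (ind n)) => //.
- move=> s Ms; rewrite -[4]mulr1; apply: Int_sq_bound => //; last lra.
  by move=> w; rewrite indicE ler0n lern1 leq_b1.
- by move=> k; exact: G3_sum.
Qed.

End local_estimates.

(** * Extension to bounded functions *)

Section extension.
Context {R : realType}.
Implicit Types (z w y : plane R) (g h : plane R -> R).
Notation Ig f := ((area R).-integrable setT (EFin \o f)).
Variables (A kap : R) (L : nat) (K f : plane R -> R) (F : R).
Hypothesis kL : kap <= 2 ^+ L.
Hypothesis cK : czk A kap K.
Hypothesis mf : measurable_fun setT f.
Hypothesis fF : forall w, `|f w| <= F.
Notation Cb := (Cb A L).

Definition fdisk (n : nat) w : R := f w * \1_(disk 0 (2 ^+ n)) w.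

Lemma fdiskE n w : fdisk n w = if en w <= 2 ^+ n then f w else 0.
Proof.
rewrite /fdisk indicE; case: ifPn => h; first by rewrite mem_set ?mulr1// /disk /= subr0.
by rewrite memNset ?mulr0// /disk /= subr0; apply/negP.
Qed.

Lemma bound_ge0 : 0 <= F. Proof. by apply: le_trans (fF 0). Qed.

Lemma bcs_fdisk n : bcs (fdisk n).
Proof.
have F0 := bound_ge0; have n0 : 0 <= 2 ^+ n :> R by exact: exprn_ge0.
apply: (@bcsI _ _ (F + 2 ^+ n)).
  by apply: measurable_fun_cond => //; exact: measurable_disk.
move=> w; have fw := fF w; rewrite fdiskE; have [wn|wn] := leP (en w) (2 ^+ n).
  by split => [|h]; [apply: (le_trans fw); rewrite lerDl|exfalso; lra].
by rewrite normr0; split => //; exact: addr_ge0.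
Qed.

Lemma fdisk_cvg w : fdisk n w @[n --> \oo] --> f w.
Proof.
apply: cvg_near_cst; have [N wN] := pow_unbounded (en w) ltr01 (lexx 2).
exists N => // n /= Nn; rewrite fdiskE ifT//; apply: (le_trans wN); rewrite mul1r.
by rewrite ler_eXn2l// ltr1n.
Qed.

Lemma fdiskB_eq0 n m w : (n <= m)%N -> en w <= 2 ^+ n -> fdisk m w - fdisk n w = 0.
Proof.
move=> nm wn; rewrite !fdiskE wn ifT ?subrr//; apply: (le_trans wn).
by rewrite ler_eXn2l// ltr1n.
Qed.

Lemma fdiskB_le n m w : (n <= m)%N -> `|fdisk m w - fdisk n w| <= F.
Proof.
move=> nm; have F0 := bound_ge0; have [h|h] := leP (en w) (2 ^+ n).
  by rewrite fdiskB_eq0// normr0.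
rewrite (fdiskE n) [X in if X then _ else _]leNgt h /= subr0 fdiskE; case: ifP => _ //; by rewrite normr0.
Qed.

(* Subtracting the value at the origin of the far part makes the sequence converge locally uniformly. *)
Definition ren (n : nat) z : R := pv K (fdisk n) z - pv K (fun w => fdisk n w - fdisk 0 w) 0.

Lemma measurable_ren n : measurable_fun setT (ren n).
Proof.
apply: measurable_funB; last exact: measurable_cst.
by apply: (measurable_pv cK); exact: bcs_fdisk.
Qed.

Let D := 32 * A * kap * F.

Lemma D_ge0 : 0 <= D.
Proof.
have A0 := czk_A cK; have k1 := czk_kap cK; have F0 := bound_ge0.
by rewrite /D; apply: mulr_ge0 => //; apply: mulr_ge0; [exact: mulr_ge0|lra].
Qed.

(** The function [fdisk m - fdisk n] vanishes for [|w| <= 2^n], and [ren m z - ren n z] is the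
    difference of its principal values at [z] and at [0]; apply the first estimate of [pv_farB] with
    [e = 2^n]. *)
Lemma ren_diff n m : (n <= m)%N -> {ae area R, forall z, 2 * en z <= 2 ^+ n ->
  `|ren m z - ren n z| <= D * en z / 2 ^+ n}.
Proof.
move=> nm; have bn := bcs_fdisk n; have bm := bcs_fdisk m; have b0 := bcs_fdisk 0.
have bg := bcsB bm bn.
have e0 : 0 < 2 ^+ n :> R by exact: exprn_gt0.
have gF w := fdiskB_le w nm.
have g0 w : en ((w : R * R) - 0) <= 2 ^+ n -> fdisk m w - fdisk n w = 0.
  by rewrite subr0; exact: fdiskB_eq0.
have one : (1 : R) <= 2 ^+ n by apply: exprn_ege1; lra.
have aw a b : (a <= b)%N -> pv K (fun w => fdisk b w - fdisk a w) 0 =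
    Int (fun w => K (- (w : R * R)) * (fdisk b w - fdisk a w)) /\
    bcs (fun w => K (- (w : R * R)) * (fdisk b w - fdisk a w)).
  move=> ab; have bab := bcsB (bcs_fdisk b) (bcs_fdisk a).
  have v w : en ((0 : R * R) - w) <= 1 -> fdisk b w - fdisk a w = 0.
    by rewrite sub0r enN => h; apply: fdiskB_eq0 => //; apply: (le_trans h); apply: exprn_ege1; lra.
  have := pv_away cK bab ltr01 v; have := bcs_away cK bab ltr01 v.
  by under eq_fun do rewrite sub0r; move=> ? ->; split => //; congr Int; apply/funext => w; rewrite sub0r.
have E0 : pv K (fun w => fdisk m w - fdisk 0 w) 0 =
    pv K (fun w => fdisk n w - fdisk 0 w) 0 + pv K (fun w => fdisk m w - fdisk n w) 0.
  have [-> b1] := aw _ _ (leq0n m); have [-> b2] := aw _ _ (leq0n n); have [-> b3] := aw _ _ nm.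
  rewrite -IntD; [|exact: bcs_Ig..]; congr Int; apply/funext => w; ring.
have := pvD_ae kL cK bn bg.
have -> : (fun w => fdisk n w + (fdisk m w - fdisk n w)) = fdisk m by apply/funext => w; ring.
apply: filterS => z E zn; rewrite /ren E E0.
have zn0 : 2 * en ((z : R * R) - 0) <= 2 ^+ n by rewrite subr0.
have [+ _] := pv_farB kL cK bg e0 gF zn0 g0; rewrite subr0.
have -> : A * kap * en z * (16 * F * (2 / 2 ^+ n)) = D * en z / 2 ^+ n by rewrite /D; ring.
by apply: le_trans; rewrite le_eqVlt; apply/orP; left; apply/eqP; congr `|_|; ring.
Qed.

(** An upper limit for the sake of measurability, as in [pv]; [ext_ren] shows that it is a limit
    almost everywhere. *)
Definition ext z : R := fine (limn_esup (fun n => (ren n z)%:E)).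

Lemma measurable_ext : measurable_fun setT ext.
Proof.
apply: (measurableT_comp (@fine_measurable R setT measurableT)).
by apply: measurable_fun_limn_esup => n; apply/measurable_EFinP; exact: measurable_ren.
Qed.

Lemma ext_ren : {ae area R, forall z, forall n, 2 * en z <= 2 ^+ n ->
  `|ext z - ren n z| <= D * en z / 2 ^+ n}.
Proof.
have D0 := D_ge0.
have H : {ae area R, forall z, forall n i, 2 * en z <= 2 ^+ n ->
    `|ren (n + i) z - ren n z| <= D * en z / 2 ^+ n}.
  by apply: ae_foralln => n; apply: ae_foralln => i; apply: ren_diff; exact: leq_addr.
apply: filterS H => z H.
have p2 n : 0 < 2 ^+ n :> R by exact: exprn_gt0.
have cv : cvg (ren n z @[n --> \oo]).
  apply: cauchy_cvg; apply/cauchy_exP => e e0.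
  have [N1 h1] := pow_unbounded (2 * en z) ltr01 (lexx 2).
  have [N2 h2] := pow_unbounded (D * en z / e + 1) ltr01 (lexx 2).
  rewrite mul1r in h1; rewrite mul1r in h2.
  pose N := (N1 + N2)%N; exists (ren N z); exists N => // n /= Nn.
  have l1 : 2 ^+ N1 <= 2 ^+ N :> R by rewrite ler_eXn2l ?ltr1n// leq_addr.
  have l2 : 2 ^+ N2 <= 2 ^+ N :> R by rewrite ler_eXn2l ?ltr1n// leq_addl.
  rewrite -ball_normE /= distrC; have := H N (n - N)%N; rewrite subnKC//.
  move=> /(_ (le_trans h1 l1)) h; apply: (le_lt_trans h).
  rewrite ltr_pdivrMr// [e * _]mulrC -ltr_pdivrMr//; lra.
have /cvg_ex[l cl] := cv.
have -> : ext z = l.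
  have cvE : ((ren n z)%:E @[n --> \oo] --> l%:E)%E by apply: cvg_EFin => //; exact: nearW.
  by rewrite /ext; have [_ ->] := cvg_limn_einf_sup cvE.
move=> n zn.
have c2 : `|ren m z - ren n z| @[m --> \oo] --> `|l - ren n z|.
  by apply: cvg_norm; apply: cvgB => //; exact: cvg_cst.
rewrite -(cvg_lim _ c2)//; apply: limr_le; first by apply/cvg_ex; eexists; exact: c2.
by exists n => // m /= nm; have := H n (m - n)%N; rewrite subnKC//; apply.
Qed.

Lemma Ig_bounded_sq (u : plane R -> R) z0 (r c : R) : 0 <= r -> measurable_fun setT u ->
  Ig (fun z => `|u z - c| * \1_(sq z0 r) z) -> Ig (fun z => u z * \1_(sq z0 r) z).
Proof.
move=> r0 mu I1.
have I2 : Ig (fun z => `|u z - c| * \1_(sq z0 r) z + `|c| * \1_(sq z0 r) z).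
  by have := integrableD measurableT I1 (IgZ `|c| (Ig_indic_sq z0 r0)).
apply: le_integrable I2 => //.
  by apply/measurable_EFinP; apply: measurable_funM => //; exact: measurable_indic_sq.
move=> z _; rewrite lee_fin -mulrDl !normrM (ger0_norm (indic_ge0 _ _)).
apply: ler_wpM2r; first exact: indic_ge0.
rewrite [leRHS]ger0_norm; last by rewrite addr_ge0.
by have := ler_normD (u z - c) c; rewrite subrK.
Qed.

Lemma ext_bmo z0 (r : R) : 0 < r ->
  exists c : R, Ig (fun z => `|ext z - c| * \1_(sq z0 r) z) /\
    Int (fun z => `|ext z - c| * \1_(sq z0 r) z) <= 21 * Cb * F * r ^+ 2.
Proof.
move=> r0; have A0 := czk_A cK; have C0 := Cb_ge0 L A0; have k1 := czk_kap cK.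
have F0 := bound_ge0; have D0 := D_ge0.
have s0 : 0 <= en z0 + 2 * r by have := en_ge0 z0; lra.
have ks : 0 <= kap * (en z0 + 2 * r) by rewrite mulr_ge0//; lra.
(* This [n] makes the error [D |z| / 2^n] of [ext_ren] at most [A F <= Cb F] on the square.
   Integrated, it adds [4] to the [17] of [pv_bmo]. *)
have [n hn] := pow_unbounded (32 * (kap * (en z0 + 2 * r))) ltr01 (lexx 2); rewrite mul1r in hn.
have p2 : 0 < 2 ^+ n :> R by exact: exprn_gt0.
have sk : en z0 + 2 * r <= kap * (en z0 + 2 * r) by apply: ler_peMl.
have nF w : `|fdisk n w| <= F by rewrite fdiskE; case: ifP => _ //; rewrite normr0.
have [c [I1 B1]] := pv_bmo kL z0 cK (bcs_fdisk n) nF r0.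
pose c' := c - pv K (fun w => fdisk n w - fdisk 0 w) 0; exists c'.
have I2 : Ig (fun z => Cb * F * \1_(sq z0 r) z) by apply: IgZ; apply: Ig_indic_sq; exact: ltW.
have I3 : Ig (fun z => `|pv K (fdisk n) z - c| * \1_(sq z0 r) z + Cb * F * \1_(sq z0 r) z).
  by have := integrableD measurableT I1 I2.
have CF : 0 <= Cb * F by exact: mulr_ge0.
have AC := le_Cb L A0.
have [] := @Int_le_ae R (fun z => `|ext z - c'| * \1_(sq z0 r) z) _ _ I3.
- apply: measurable_funM; last exact: measurable_indic_sq.
  apply: measurableT_comp => //; apply: measurable_funB; last exact: measurable_cst.
  exact: measurable_ext.
- by move=> z; rewrite mulr_ge0// indic_ge0.
- by move=> z; apply: addr_ge0; apply: mulr_ge0 => //; exact: indic_ge0.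
- apply: filterS ext_ren => z /(_ n) H; rewrite -mulrDl indicE.
  have [|_] := boolP (z \in _); last by rewrite !mulr0.
  rewrite inE !mulr1 => /sq_en zr.
  have ez : en z <= en z0 + 2 * r.
    by have := enD ((z : R * R) - z0) z0; rewrite subrK; lra.
  have ez0 := en_ge0 z.
  have zn : 2 * en z <= 2 ^+ n by lra.
  have {H}zn' := H zn.
  have -> : ext z - c' = (pv K (fdisk n) z - c) + (ext z - ren n z) by rewrite /ren /c'; ring.
  apply: (le_trans (ler_normD _ _)); rewrite lerD2l; apply: (le_trans zn').
  rewrite ler_pdivrMr//; apply: (@le_trans _ _ (A * F * 2 ^+ n)); last first.
    by apply: ler_wpM2r; [exact: ltW|exact: ler_wpM2r].
  have -> : D * en z = A * F * (32 * (kap * en z)) by rewrite /D; ring.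
  apply: ler_wpM2l; first exact: mulr_ge0.
  apply: le_trans hn; rewrite ler_wpM2l// ler_wpM2l//; lra.
move=> I4 H; split => //; apply: (le_trans H).
rewrite IntD// IntZ; last by apply: Ig_indic_sq; exact: ltW.
rewrite Int_indic_sq; last exact: ltW.
move: B1; move: (Int _) => x; rewrite exprMn; lra.
Qed.

Lemma Ig_ext_sq z0 (r : R) : 0 < r -> Ig (fun z => ext z * \1_(sq z0 r) z).
Proof.
move=> r0; have [c [I1 _]] := ext_bmo z0 r0.
by apply: Ig_bounded_sq I1; [exact: ltW|exact: measurable_ext].
Qed.

Lemma Ig_mul_bcs (u : plane R -> R) h : measurable_fun setT u ->
  (forall r, 0 < r -> Ig (fun z => u z * \1_(sq 0 r) z)) -> bcs h -> Ig (fun z => u z * h z).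
Proof.
move=> mu Iu bh; have [M [M0 hM]] := bcs_bound bh.
apply: (@le_integrable _ _ _ (area R) setT measurableT _ (EFin \o (fun z => M * (u z * \1_(sq 0 M) z)))).
- by apply/measurable_EFinP; apply: measurable_funM => //; exact: bcs_measurable.
- move=> z _; rewrite lee_fin; have [h1 h2] := hM z.
  have [zM|zM] := pselect (sq 0 M z).
    rewrite indicE mem_set// mulr1 !normrM (gtr0_norm M0) mulrC.
    by apply: ler_wpM2r.
  rewrite h2 ?mulr0 ?normr0// ltNge; apply/negP => h3; apply: zM.
  by apply: en_sq; rewrite subr0.
- by apply: IgZ; exact: Iu.
Qed.

Lemma Ig_mul_bounded (u : plane R -> R) : Ig u -> Ig (fun z => f z * u z).
Proof.
move=> Iu; have F0 := bound_ge0.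
apply: le_integrable (IgZ F Iu) => //.
  apply/measurable_EFinP; apply: measurable_funM => //.
  by have /integrableP[/measurable_EFinP] := Iu.
by move=> z _; rewrite lee_fin !normrM (ger0_norm F0); apply: ler_wpM2r.
Qed.

(** The constants subtracted in [ren] vanish against [h], so the identity for [fdisk n] is
    [pv_pairing]. On the left [ren n] converges uniformly on the support of [h], up to a null set;
    on the right the integrable function [pv (rf K) h] dominates. *)
Lemma ext_pairing h : bcs h -> Int h = 0 ->
  Int (fun z => ext z * h z) = Int (fun z => f z * pv (rf K) h z).
Proof.
move=> bh h0; have D0 := D_ge0; have [M [M0 hM]] := bcs_bound bh.
have crK := czk_rf cK.
have Iq : Ig (pv (rf K) h) := Ig_pv kL crK bh h0.
have mq : measurable_fun setT (pv (rf K) h) by have /integrableP[/measurable_EFinP] := Iq.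
have Ie := Ig_mul_bcs measurable_ext (fun r r0 => Ig_ext_sq 0 r0) bh.
have In n : Ig (fun z => ren n z * h z).
  have := integrableB measurableT (Ig_pv_mul kL cK (bcs_fdisk n) bh)
    (IgZ (pv K (fun w => fdisk n w - fdisk 0 w) 0) (bcs_Ig bh)).
  by congr (integrable _ _ _); apply/funext => z /=; rewrite /ren mulrBl EFinB.
have En n : Int (fun z => ren n z * h z) = Int (fun z => fdisk n z * pv (rf K) h z).
  rewrite -(pv_pairing kL cK (bcs_fdisk n) bh).
  have -> : (fun z => ren n z * h z) = (fun z => pv K (fdisk n) z * h z -
     pv K (fun w => fdisk n w - fdisk 0 w) 0 * h z) by apply/funext => z; rewrite /ren mulrBl.
  rewrite IntB; [|exact: (Ig_pv_mul kL cK (bcs_fdisk n) bh)|exact: IgZ (bcs_Ig bh)].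
  by rewrite (IntZ _ (bcs_Ig bh)) h0 mulr0 subr0.
have c1 : Int (fun z => ren n z * h z) @[n --> \oo] --> Int (fun z => ext z * h z).
  apply/cvgrPdist_le => e e0.
  pose T := D * M * nrm1 h; have M0' := ltW M0; have DM : 0 <= D * M by exact: mulr_ge0.
  have T0 : 0 <= T by apply: mulr_ge0 => //; exact: nrm1_ge0.
  have [N1 h1] := pow_unbounded (2 * M) ltr01 (lexx 2).
  have [N2 h2] := pow_unbounded (T / e) ltr01 (lexx 2).
  rewrite mul1r in h1; rewrite mul1r in h2.
  exists (N1 + N2)%N => // n /= Nn.
  have l1 : 2 ^+ N1 <= 2 ^+ n :> R.
    by rewrite ler_eXn2l ?ltr1n//; apply: leq_trans Nn; exact: leq_addr.
  have l2 : 2 ^+ N2 <= 2 ^+ n :> R.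
    by rewrite ler_eXn2l ?ltr1n//; apply: leq_trans Nn; exact: leq_addl.
  have p2 : 0 < 2 ^+ n :> R by exact: exprn_gt0.
  rewrite -IntB//.
  have ID : Ig (fun z => ext z * h z - ren n z * h z) by have := integrableB measurableT Ie (In n).
  apply: (le_trans (Int_abs ID)).
  apply: (@le_trans _ _ (T / 2 ^+ n)); last first.
    by rewrite ler_pdivrMr// [e * _]mulrC -ler_pdivrMr//; exact: le_trans l2.
  have -> : T / 2 ^+ n = Int (fun z => D * M / 2 ^+ n * `|h z|).
    rewrite (IntZ _ (bcs_Ig (bcs_norm bh))).
    by rewrite /T -nrm1E; ring.
  apply: (@Int_le_ae R _ _ _ _ _ _ _).2.
  - by have /integrableP[/measurable_EFinP mm _] := ID; exact: measurableT_comp.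
  - by apply: IgZ; apply: bcs_Ig; exact: bcs_norm.
  - by [].
  - by move=> z; apply: mulr_ge0 => //; apply: divr_ge0 => //; exact: ltW.
  apply: filterS ext_ren => z /(_ n) H; rewrite -mulrBl normrM.
  have [Mz|zM] := ltP M (en z); first by rewrite (hM z).2// normr0 !mulr0.
  apply: ler_wpM2r => //; have zn : 2 * en z <= 2 ^+ n by lra.
  apply: (le_trans (H zn)); apply: ler_wpM2r; first by rewrite invr_ge0 ltW.
  exact: ler_wpM2l.
have c2 : Int (fun z => fdisk n z * pv (rf K) h z) @[n --> \oo] --> Int (fun z => f z * pv (rf K) h z).
  have [] := @dominated_convergence _ _ _ (area R) setT measurableT
    (fun n z => (fdisk n z * pv (rf K) h z)%:E) (fun z => (f z * pv (rf K) h z)%:E)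
    (fun z => (F * `|pv (rf K) h z|)%:E).
  - move=> n; apply/measurable_EFinP; apply: measurable_funM => //; exact: bcs_measurable (bcs_fdisk n).
  - by apply/measurable_EFinP; apply: measurable_funM.
  - apply: aeW => z _; apply: cvg_EFin; first exact: nearW.
    by apply: cvgM; [exact: fdisk_cvg|exact: cvg_cst].
  - by apply: IgZ; exact: integrable_norm.
  - apply: aeW => z n _; rewrite lee_fin normrM; apply: ler_wpM2r => //.
    by rewrite fdiskE; case: ifP => _ //; rewrite normr0 bound_ge0.
  move=> I1 _ cv.
  have I2 n : Ig (fun z => fdisk n z * pv (rf K) h z).
    have := Ig_pv_mul kL crK bh (bcs_fdisk n).
    by congr (integrable _ _ _); apply/funext => z /=; rewrite mulrC.
    have := cv; rewrite (EFin_Int I1).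
  move=> /fine_cvg; apply: cvg_trans; apply: near_eq_cvg; apply: nearW => n /=.
  by rewrite EFin_Int.
have c3 : Int (fun z => ren n z * h z) @[n --> \oo] --> Int (fun z => f z * pv (rf K) h z).
  by under eq_fun do rewrite En.
by apply: cvg_unique c1 c3.
Qed.

End extension.

(** * The kernel of R^k *)

Local Open Scope complex_scope.

Section modulus.
Context {R : realType}.
Implicit Types (v w x y : R[i]).

Lemma modulus_norm w : `|w| = (modulus w)%:C. Proof. by []. Qed.

Lemma modulus_real (a : R) : modulus a%:C = `|a|.
Proof. by rewrite /= expr0n/= addr0 sqrtr_sqr. Qed.

Lemma modulus_ge0 w : 0 <= modulus w. Proof. by case: w => a b; exact: sqrtr_ge0. Qed.

Lemma modulusX w n : modulus (w ^+ n) = modulus w ^+ n.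
Proof. by elim: n => [|n ih]; rewrite ?Normc.normc1// !exprS Normc.normcM ih. Qed.

Lemma modulusJ w : modulus w^* = modulus w.
Proof. by case: w => a b /=; rewrite sqrrN. Qed.

Lemma modulus_i : modulus ('i%C : R[i]) = 1.
Proof. by rewrite /= expr0n/= expr1n add0r sqrtr1. Qed.

Lemma Re_le_modulus w : `|complex.Re w| <= modulus w.
Proof.
case: w => a b /=; rewrite -(ler_pXn2r (_ : 0 < 2)%N) ?nnegrE ?sqrtr_ge0//.
by rewrite real_normK ?num_real// sqr_sqrtr ?addr_ge0 ?sqr_ge0// lerDl sqr_ge0.
Qed.

Lemma Im_le_modulus w : `|complex.Im w| <= modulus w.
Proof.
case: w => a b /=; rewrite -(ler_pXn2r (_ : 0 < 2)%N) ?nnegrE ?sqrtr_ge0//.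
by rewrite real_normK ?num_real// sqr_sqrtr ?addr_ge0 ?sqr_ge0// lerDr sqr_ge0.
Qed.

Lemma modulus_le_ReIm w : modulus w <= `|complex.Re w| + `|complex.Im w|.
Proof. by case: w => a b; exact: (en_le (a, b)). Qed.

Lemma le_modulusB x y : `|modulus x - modulus y| <= modulus (x - y).
Proof.
have h1 := le_normcD (x - y) y; have h2 := le_normcD (y - x) x.
rewrite !subrK -(normcN (y - x)) opprB in h1 h2; rewrite ler_norml; lra.
Qed.

Lemma modulusX_sub x y k : modulus x <= 1 -> modulus y <= 1 ->
  modulus (x ^+ k - y ^+ k) <= k%:R * modulus (x - y).
Proof.
move=> x1 y1; elim: k => [|k ih]; first by rewrite subrr Normc.normc0 mul0r.
have -> : x ^+ k.+1 - y ^+ k.+1 = x * (x ^+ k - y ^+ k) + (x - y) * y ^+ k.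
  by rewrite !exprS; ring.
apply: (le_trans (le_normcD _ _)); rewrite !Normc.normcM modulusX -natr1 mulrDl mul1r.
have yk : modulus y ^+ k <= 1 by apply: exprn_ile1 => //; exact: modulus_ge0.
have := modulus_ge0 (x - y); have := modulus_ge0 (x ^+ k - y ^+ k); have := modulus_ge0 x.
move=> x0 d0 e0; apply: lerD; last by apply: ler_piMr.
by apply: le_trans ih; apply: ler_piMl.
Qed.

(** The conjugate phase, equal to [(w / |w|)^-1] and to [0] at the origin. In this form the kernel
    involves only a nonnegative power, see [OmegaJ]. *)
Definition uconj w : R[i] := w^* / `|w|.

Lemma uconjE w : uconj w = w^* * ((modulus w)^-1)%:C.
Proof. by rewrite /uconj modulus_norm fmorphV. Qed.

Lemma modulus_uconj w : w != 0 -> modulus (uconj w) = 1.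
Proof.
move=> w0; rewrite uconjE Normc.normcM modulusJ modulus_real ger0_norm ?invr_ge0 ?modulus_ge0//.
by rewrite divff//; apply: contra w0 => /eqP/Normc.eq0_normc ->.
Qed.

Lemma modulus_uconj_le w : modulus (uconj w) <= 1.
Proof.
have [->|/modulus_uconj->//] := eqVneq w 0.
by rewrite /uconj normr0 invr0 mulr0 Normc.normc0.
Qed.

Definition Oc (k : nat) : R[i] := 'i%C ^+ k * k%:R / (2 * pi)%:C.

Lemma OmegaJ k w : Omega k w = Oc k * uconj w ^+ k / `|w| ^+ 2.
Proof.
rewrite /Omega; congr (_ * _ / _); rewrite -exprVn; congr (_ ^+ _).
rewrite /uconj invfM invrK invc_norm.
have [->|w0] := eqVneq `|w| 0; first by rewrite invr0 !mulr0.
by field.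
Qed.

Lemma modulus_Oc k : modulus (Oc k) = k%:R / (2 * pi).
Proof.
have p0 : 0 < 2 * pi :> R by rewrite mulr_gt0// pi_gt0.
rewrite /Oc !Normc.normcM modulusX modulus_i expr1n mul1r Normc.normcV modulus_real (gtr0_norm p0).
have -> : (k%:R : R[i]) = (k%:R)%:C by rewrite rmorph_nat.
by rewrite modulus_real ger0_norm.
Qed.

Lemma modulus_Oc_le k : modulus (Oc k) <= k%:R / 4.
Proof.
rewrite modulus_Oc; apply: ler_wpM2l => //; rewrite lef_pV2 ?posrE ?mulr_gt0 ?pi_gt0//.
have := @pi_ge2 R; lra.
Qed.

Lemma modulus_Omega_le k w : modulus (Omega k w) <= 5 * k%:R / modulus w ^+ 2.
Proof.
rewrite OmegaJ 2!Normc.normcM modulusX Normc.normcV modulusX modulus_norm modulus_real.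
rewrite (ger0_norm (modulus_ge0 _)); apply: ler_wpM2r; first by rewrite invr_ge0 sqr_ge0.
have h1 := modulus_Oc_le k; have k0 := ler0n R k.
have h2 : modulus (uconj w) ^+ k <= 1 by apply: exprn_ile1; [exact: modulus_ge0|exact: modulus_uconj_le].
apply: (@le_trans _ _ (modulus (Oc k))); last lra.
by apply: ler_piMr => //; exact: modulus_ge0.
Qed.

Lemma uconj_sub x y : 0 < modulus x -> 0 < modulus y ->
  modulus (uconj x - uconj y) <= 2 * modulus (x - y) / modulus y.
Proof.
move=> m0 n0; have mn := le_modulusB x y; set d := modulus (x - y) in mn *.
have -> : uconj x - uconj y = (x - y)^* * ((modulus y)^-1)%:C + x^* * ((modulus x)^-1 - (modulus y)^-1)%:C.
  by rewrite !uconjE rmorphB /= rmorphB /=; ring.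
apply: (le_trans (le_normcD _ _)); rewrite !Normc.normcM !modulusJ !modulus_real -/d.
have -> : (modulus x)^-1 - (modulus y)^-1 = (modulus y - modulus x) / (modulus x * modulus y).
  by field; rewrite !gt_eqF.
rewrite normrM distrC (gtr0_norm (_ : 0 < (modulus y)^-1)) ?invr_gt0//.
rewrite (gtr0_norm (_ : 0 < (modulus x * modulus y)^-1)) ?invr_gt0 ?mulr_gt0//.
have -> : modulus x * (`|modulus x - modulus y| / (modulus x * modulus y)) = `|modulus x - modulus y| / modulus y.
  by field; rewrite !gt_eqF.
by rewrite -mulrDl; apply: ler_wpM2r; [rewrite invr_ge0 ltW|lra].
Qed.

(** One factor [k] is the size of the constant [Oc k], the other the Lipschitz constant of the
    [k]-th power on the unit disc. The variation of [|w|^-2] costs no further [k]. *)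
Lemma Omega_smooth k x y : (0 < k)%N -> 2 * modulus (x - y) <= modulus y ->
  modulus (Omega k x - Omega k y) <= 5 * k%:R * k%:R * modulus (x - y) / modulus y ^+ 3.
Proof.
move=> k0 xy; have k1 : 1 <= k%:R :> R by rewrite ler1n.
have [y0|y0] := eqVneq y 0.
  move: xy; rewrite y0 subr0 Normc.normc0 => h.
  have x0 : x = 0 by apply: Normc.eq0_normc; apply: le_anti; rewrite modulus_ge0 andbT; lra.
  by rewrite x0 subrr Normc.normc0 mulr0 mul0r.
have n0 : 0 < modulus y.
  by rewrite lt_neqAle modulus_ge0 andbT eq_sym; apply: contra y0 => /eqP/Normc.eq0_normc ->.
have := le_modulusB x y; have := modulus_ge0 (x - y).
set d := modulus (x - y) in xy *; move=> d0 mn.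
have /andP[mn1 mn2] : modulus y - d <= modulus x <= modulus y + d by move: mn; rewrite ler_distl.
have m0 : 0 < modulus x by lra.
have hU := uconj_sub m0 n0; rewrite -/d in hU.
have hp := modulusX_sub k (modulus_uconj_le x) (modulus_uconj_le y).
have hq : modulus (uconj y ^+ k) <= 1.
  by rewrite modulusX; apply: exprn_ile1; [exact: modulus_ge0|exact: modulus_uconj_le].
have -> : Omega k x - Omega k y = Oc k * ((uconj x ^+ k - uconj y ^+ k) * ((modulus x ^+ 2)^-1)%:C +
    uconj y ^+ k * ((modulus x ^+ 2)^-1 - (modulus y ^+ 2)^-1)%:C).
  by rewrite !OmegaJ !modulus_norm rmorphB /= !fmorphV !rmorphXn /=; ring.
rewrite Normc.normcM.
have hc := modulus_Oc_le k; have c0 := modulus_ge0 (Oc k).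
set X := modulus (_ + _).
have hX : X <= 18 * k%:R * (d / modulus y ^+ 3).
  rewrite /X; apply: (le_trans (le_normcD _ _)); rewrite !Normc.normcM !modulus_real.
  have y3 : 0 <= d / modulus y ^+ 3 by rewrite divr_ge0// exprn_ge0// ltW.
  have im : (modulus x ^+ 2)^-1 <= 4 / modulus y ^+ 2.
    rewrite -[4]invrK -invfM lef_pV2 ?posrE ?mulr_gt0 ?invr_gt0 ?exprn_gt0//; nra.
  have im0 : 0 < (modulus x ^+ 2)^-1 by rewrite invr_gt0 exprn_gt0.
  have h1 : modulus (uconj x ^+ k - uconj y ^+ k) * `|(modulus x ^+ 2)^-1| <= 8 * k%:R * (d / modulus y ^+ 3).
    rewrite (gtr0_norm im0).
    have -> : 8 * k%:R * (d / modulus y ^+ 3) = k%:R * (2 * d / modulus y) * (4 / modulus y ^+ 2).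
      by field; rewrite gt_eqF.
    apply: ler_pM => //; [exact: modulus_ge0|exact: ltW|].
    by apply: (le_trans hp); apply: ler_wpM2l.
  have h2 : `|(modulus x ^+ 2)^-1 - (modulus y ^+ 2)^-1| <= 10 * (d / modulus y ^+ 3).
    have -> : (modulus x ^+ 2)^-1 - (modulus y ^+ 2)^-1 =
        (modulus y - modulus x) * ((modulus y + modulus x) * (modulus x ^+ 2)^-1 / modulus y ^+ 2).
      by field; rewrite !gt_eqF.
    have -> : 10 * (d / modulus y ^+ 3) = d * (5 / 2 * modulus y * (4 / modulus y ^+ 2) / modulus y ^+ 2).
      by field; rewrite gt_eqF.
    have i2 : 0 <= (modulus y ^+ 2)^-1 by rewrite invr_ge0 sqr_ge0.
    have s0 : 0 <= modulus y + modulus x by lra.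
    have t0 : 0 <= (modulus y + modulus x) * (modulus x ^+ 2)^-1 by rewrite mulr_ge0// ltW.
    rewrite normrM distrC; apply: ler_pM => //.
    rewrite ger0_norm; last exact: mulr_ge0.
    apply: ler_wpM2r => //; apply: ler_pM => //; [exact: ltW|lra].
  have h3 : modulus (uconj y ^+ k) * `|(modulus x ^+ 2)^-1 - (modulus y ^+ 2)^-1| <= 10 * (d / modulus y ^+ 3).
    by apply: le_trans h2; apply: ler_piMl.
  apply: (le_trans (lerD h1 h3)); rewrite -mulrDl; apply: ler_wpM2r => //; lra.
have X0 : 0 <= X by exact: modulus_ge0.
have y3 : 0 <= d / modulus y ^+ 3 by rewrite divr_ge0// exprn_ge0// ltW.
apply: (le_trans (ler_pM c0 X0 hc hX)).
have -> : 5 * k%:R * k%:R * d / modulus y ^+ 3 = 5 * (k%:R * k%:R * (d / modulus y ^+ 3)) by ring.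
have -> : k%:R / 4 * (18 * k%:R * (d / modulus y ^+ 3)) = 18 / 4 * (k%:R * k%:R * (d / modulus y ^+ 3)).
  by field; rewrite gt_eqF.
apply: ler_wpM2r; last lra.
by apply: mulr_ge0 => //; exact: mulr_ge0.
Qed.

End modulus.

(** * Real and imaginary parts of the kernel *)

Section kernels.
Context {R : realType}.
Implicit Types (z w : plane R) (k : nat).

Lemma toCB z w : toC ((z : R * R) - w) = toC z - toC w. Proof. by []. Qed.

Lemma cmeasurable_mul (f g : plane R -> R[i]) : cmeasurable f -> cmeasurable g ->
  cmeasurable (fun z => f z * g z).
Proof.
move=> [f1 f2] [g1 g2]; have E z : f z * g z =
    (complex.Re (f z) * complex.Re (g z) - complex.Im (f z) * complex.Im (g z)) +i*
    (complex.Re (f z) * complex.Im (g z) + complex.Im (f z) * complex.Re (g z)).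
  by case: (f z) => a b; case: (g z).
split; under eq_fun do rewrite E /=.
- by apply: measurable_funB; exact: measurable_funM.
- by apply: measurable_funD; exact: measurable_funM.
Qed.

Lemma cmeasurable_cst (c : R[i]) : cmeasurable (fun _ : plane R => c).
Proof. by split; exact: measurable_cst. Qed.

Lemma cmeasurableX (f : plane R -> R[i]) n : cmeasurable f -> cmeasurable (fun z => f z ^+ n).
Proof.
move=> mf; elim: n => [|n ih]; first by under eq_fun do rewrite expr0; exact: cmeasurable_cst.
by under eq_fun do rewrite exprS; exact: cmeasurable_mul.
Qed.

Lemma cmeasurable_real (f : plane R -> R) : measurable_fun setT f -> cmeasurable (fun z => (f z)%:C).
Proof. by split => //=; exact: measurable_cst. Qed.

Lemma cmeasurable_Omega k : cmeasurable (fun z => Omega k (toC z)).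
Proof.
have mi : measurable_fun setT (fun z : plane R => (en z)^-1).
  by apply: (measurableT_comp (@measurable_invr R)); exact: measurable_en.
have E z : Omega k (toC z) = Oc k * (toC z)^* ^+ k * ((en z)^-1 ^+ (k + 2))%:C.
  by rewrite OmegaJ uconjE modulus_norm rmorphXn /= !fmorphV /= exprMn exprD !exprVn !mulrA.
under eq_fun do rewrite E.
apply: cmeasurable_mul; last by apply: cmeasurable_real; exact: measurable_funX.
apply: cmeasurable_mul; first exact: cmeasurable_cst.
apply: cmeasurableX; split => /=; first exact: measurable_fst.
by apply: measurable_funN; exact: measurable_snd.
Qed.

Definition Kre k z : R := complex.Re (Omega k (toC z)).
Definition Kim k z : R := complex.Im (Omega k (toC z)).

Lemma deMoivre (t : R) n : (cos t +i* sin t) ^+ n = cos (t *+ n) +i* sin (t *+ n).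
Proof.
elim: n => [|n ih]; first by rewrite !mulr0n cos0 sin0.
by rewrite exprS ih mulrS cosD sinD; simpc; congr Complex; ring.
Qed.

Lemma Omega_rot k (e w : R[i]) : modulus e = 1 -> Omega k (e * w) = e^* ^+ k * Omega k w.
Proof.
move=> e1; have ne : `|e * w| = `|w| by rewrite normrM (modulus_norm e) e1 mul1r.
have u : uconj (e * w) = e^* * uconj w by rewrite /uconj ne rmorphM /= mulrA.
by rewrite !OmegaJ u ne exprMn mulrCA !mulrA.
Qed.

Lemma antirotation k : (0 < k)%N -> exists phi : plane R -> plane R, area_preserving phi /\
  forall z, en (phi z) = en z /\ Omega k (toC (phi z)) = - Omega k (toC z).
Proof.
(* For [k = 1] the angle is [pi], whose sine vanishes, and the decomposition into shears breaks
   down; the rotation is then the map [z -> - z]. *)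
move=> k0; have [->|k1] := eqVneq k 1%N.
  exists (fun z => - (z : R * R)); split; first exact: area_preserving_opp.
  move=> z; split; first exact: enN.
  have := OmegaN 1 (toC z); rewrite expr1 mulN1r => <-; by congr Omega.
pose t : R := pi / k%:R; pose e := cos t +i* sin t.
have kk : (1 < k)%N by rewrite ltn_neqAle eq_sym k1.
have kp : 0 < k%:R :> R by rewrite ltr0n.
have t0 : 0 < t by rewrite divr_gt0// pi_gt0.
have tpi : t < pi by rewrite ltr_pdivrMr// ltr_pMr ?pi_gt0// ltr1n.
have s0 : sin t != 0 by rewrite gt_eqF// sin_gt0_pi// t0.
have cs : cos t ^+ 2 + sin t ^+ 2 = 1 := cos2Dsin2 t.
have e1 : modulus e = 1 by rewrite /= cs sqrtr1.
have ek : e ^+ k = -1.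
  rewrite deMoivre -mulr_natr divfK ?gt_eqF// cospi sinpi.
  by apply/eqP; rewrite eq_complex /= oppr0 !eqxx.
have E z : toC (rot (cos t) (sin t) z) = e * toC z.
  by case: z => x y; rewrite /rot /toC /e; simpc => /=; congr Complex; ring.
exists (rot (cos t) (sin t)); split; first exact: area_preserving_rot.
move=> z; split; first by rewrite /en E Normc.normcM e1 mul1r.
by rewrite E Omega_rot// -rmorphXn ek rmorphN rmorph1 mulN1r.
Qed.

Lemma czk_Kre k : (0 < k)%N -> czk (5 * k%:R) k%:R (Kre k).
Proof.
move=> k0; split.
- by rewrite mulr_ge0.
- by rewrite ler1n.
- by case: (cmeasurable_Omega k).
- by move=> z; apply: (le_trans (Re_le_modulus _)); exact: modulus_Omega_le.
- move=> z w zw; rewrite /Kre -raddfB /=; apply: (le_trans (Re_le_modulus _)).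
  have := @Omega_smooth R k (toC ((z : R * R) - w)) (toC z) k0.
  have -> : modulus (toC ((z : R * R) - w) - toC z) = en w.
    by rewrite toCB addrAC subrr add0r normcN.
  by apply.
- have [phi [ap H]] := antirotation k0; exists phi; split => // z; have [-> E] := H z.
  by rewrite /Kre E raddfN.
Qed.

Lemma czk_Kim k : (0 < k)%N -> czk (5 * k%:R) k%:R (Kim k).
Proof.
move=> k0; split.
- by rewrite mulr_ge0.
- by rewrite ler1n.
- by case: (cmeasurable_Omega k).
- by move=> z; apply: (le_trans (Im_le_modulus _)); exact: modulus_Omega_le.
- move=> z w zw; rewrite /Kim -raddfB /=; apply: (le_trans (Im_le_modulus _)).
  have := @Omega_smooth R k (toC ((z : R * R) - w)) (toC z) k0.
  have -> : modulus (toC ((z : R * R) - w) - toC z) = en w.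
    by rewrite toCB addrAC subrr add0r normcN.
  by apply.
- have [phi [ap H]] := antirotation k0; exists phi; split => // z; have [-> E] := H z.
  by rewrite /Kim E raddfN.
Qed.

Lemma rf_Kre k : rf (Kre k) = fun z => (-1) ^+ k * Kre k z.
Proof.
apply/funext => z; rewrite /rf /Kre.
have -> : toC (- (z : R * R)) = - toC z by [].
rewrite OmegaN -signr_odd -[in RHS]signr_odd.
by case: (odd k); rewrite ?expr1 ?expr0 ?mul1r// !mulN1r raddfN.
Qed.

Lemma rf_Kim k : rf (Kim k) = fun z => (-1) ^+ k * Kim k z.
Proof.
apply/funext => z; rewrite /rf /Kim.
have -> : toC (- (z : R * R)) = - toC z by [].
rewrite OmegaN -signr_odd -[in RHS]signr_odd.
by case: (odd k); rewrite ?expr1 ?expr0 ?mul1r// !mulN1r raddfN.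
Qed.

End kernels.

(** * Integrals of functions equal almost everywhere *)

Section ae_integrals.
Context {d} {T : measurableType d} {R : realType}.
Variable mu : {measure set T -> \bar R}.
Import HBNNSimple.

(* Applied to integrands containing [Rk], whose measurability is not known, hence the arbitrary [u]. *)
Lemma ge0_integral_ae (u v : T -> \bar R) : measurable_fun setT v ->
  (forall x, 0 <= u x)%E -> (forall x, 0 <= v x)%E -> {ae mu, forall x, u x = v x} ->
  (\int[mu]_x u x = \int[mu]_x v x)%E.
Proof.
move=> mv u0 v0 uv; apply/eqP; rewrite eq_le; apply/andP; split.
  (* The integral of [u] is a supremum over the simple functions below [u]; each of them is almost
     everywhere below the measurable [v]. *)
  rewrite (ge0_integralTE _ u0); apply: ge_ereal_sup => _ [s /= su <-].
  rewrite -integralT_nnsfun; apply: ae_ge0_le_integral => //.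
  - by move=> x _; rewrite lee_fin.
  - exact/measurable_EFinP.
  - by apply: filterS uv => x <- _; exact: su.
(* Conversely, set [v] to zero on a null set [N] containing the points where [u] and [v] differ: a
   simple function below the result is everywhere below [u], which is nonnegative on [N]. *)
have [N [mN N0 uvN]] := uv.
have mNc : measurable (~` N) by exact: measurableC.
have v'0 x : (0 <= (v \_ (~` N)) x)%E by rewrite /patch; case: ifP.
have -> : (\int[mu]_x v x = \int[mu]_x (v \_ (~` N)) x)%E.
  apply: ge0_ae_eq_integral => //.
  - by apply/(measurable_restrictT _ _).1 => //; exact: measurable_funS mv.
  - exists N; split => // x /= h; apply: contrapT => Nx; apply: h => _.
    by rewrite /patch mem_set.
rewrite (ge0_integralTE _ u0) (ge0_integralTE _ v'0); apply: ereal_sup_le => _ [s /= sv <-].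
exists s => //= x; apply: (le_trans (sv x)); rewrite /patch.
have [xN|//] := ifP; rewrite inE in xN.
have -> // : u x = v x by apply: contrapT => h; apply: xN; exact: uvN.
Qed.

Lemma integral_ae (u v : T -> \bar R) : measurable_fun setT v ->
  {ae mu, forall x, u x = v x} -> (\int[mu]_x u x = \int[mu]_x v x)%E.
Proof.
move=> mv uv; rewrite integralE [RHS]integralE; congr (_ - _)%E; apply: ge0_integral_ae => //.
- exact: measurable_funepos.
- by apply: filterS uv => x; rewrite !funeposE => ->.
- exact: measurable_funeneg.
- by apply: filterS uv => x; rewrite !funenegE => ->.
Qed.

End ae_integrals.

(** * Complex functions, atoms and [Rk] *)

Section complex_functions.
Context {R : realType}.
Implicit Types (f g h : plane R -> R[i]) (z w : plane R).
Notation Ig f := ((area R).-integrable setT (EFin \o f)).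
Notation Re := complex.Re.
Notation Im := complex.Im.

Lemma Rintegral_ae (u v : plane R -> R) : measurable_fun setT v ->
  {ae area R, forall z, u z = v z} -> Rintegral (area R) setT u = Int v.
Proof.
move=> mv uv; rewrite unlock /Rintegral; congr fine; apply: integral_ae.
  exact/measurable_EFinP.
by apply: filterS uv => z ->.
Qed.

(** The definition of [Lnorm] at [+oo] is the essential supremum only on a space of positive
    measure. *)
Lemma area_setT_gt0 : (0 < area R [set: plane R])%E.
Proof.
apply: (@lt_le_trans _ _ (area R (sq 0 1))); last first.
  by apply: le_measure; rewrite ?inE//; exact: measurable_sq.
by rewrite [X in (0 < X)%E](area_sq 0 ler01) lte_fin exprn_gt0// mulr_gt0.
Qed.

Lemma Linfty_normP f (S : R) :
  (Linfty_norm f <= S%:E)%E <-> {ae area R, forall z, modulus (f z) <= S}.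
Proof.
rewrite /Linfty_norm unlock area_setT_gt0; split => [/ess_supP|] H.
  by apply: filterS H => z /=; rewrite lee_fin ger0_norm// modulus_ge0.
by apply/ess_supP; apply: filterS H => z h /=; rewrite lee_fin ger0_norm// modulus_ge0.
Qed.

Lemma Linfty_norm_fin f : in_Linfty f -> exists S, [/\ 0 <= S, Linfty_norm f = S%:E &
  {ae area R, forall z, modulus (f z) <= S}].
Proof.
move=> [_ fin]; have f0 : (0 <= Linfty_norm f)%E by exact: Lnorm_ge0.
have ff : Linfty_norm f \is a fin_num by rewrite ge0_fin_numE.
exists (fine (Linfty_norm f)); split.
- exact: fine_ge0.
- by rewrite fineK.
- by apply/Linfty_normP; rewrite fineK.
Qed.

Lemma measurable_modulus f : cmeasurable f -> measurable_fun setT (fun z => modulus (f z)).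
Proof.
move=> [m1 m2]; have -> : (fun z => modulus (f z)) = fun z => Num.sqrt (Re (f z) ^+ 2 + Im (f z) ^+ 2).
  by apply/funext => z; case: (f z).
by apply: (measurableT_comp (@measurable_sqrtr R)); apply: measurable_funD; exact: measurable_funX.
Qed.

(** With [S] an essential bound of [f], a representative bounded everywhere. *)
Definition ccut (S : R) f z : R[i] := if modulus (f z) <= S then f z else 0.

Lemma cmeasurable_ccut (S : R) f : cmeasurable f -> cmeasurable (ccut S f).
Proof.
move=> mf; have mm := measurable_modulus mf.
have mS : measurable [set z | modulus (f z) <= S].
  have -> : [set z | modulus (f z) <= S] = setT `&` (fun z => modulus (f z)) @^-1` `]-oo, S]%classic.
    by rewrite setTI; apply/seteqP; split => z /=; rewrite in_itv.
  by apply: mm => //; exact: measurable_itv.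
have E z : ccut S f z = f z * (\1_[set z | modulus (f z) <= S] z)%:C.
  rewrite /ccut indicE; case: ifPn => h; first by rewrite mem_set// mulr1.
  by rewrite memNset ?mulr0//; exact/negP.
have -> : ccut S f = fun z => f z * (\1_[set z | modulus (f z) <= S] z)%:C by exact/funext.
apply: cmeasurable_mul => //.
by apply: cmeasurable_real; exact: measurable_indic.
Qed.

Lemma ccut_le (S : R) f z : 0 <= S -> modulus (ccut S f z) <= S.
Proof. by move=> S0; rewrite /ccut; case: ifP => // _; rewrite Normc.normc0. Qed.

Lemma ccut_ae (S : R) f : {ae area R, forall z, modulus (f z) <= S} ->
  {ae area R, forall z, f z = ccut S f z}.
Proof. by apply: filterS => z h; rewrite /ccut h. Qed.

Definition cbcs f := bcs (fun z => Re (f z)) /\ bcs (fun z => Im (f z)).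

Lemma cbcs_cmeasurable f : cbcs f -> cmeasurable f.
Proof. by move=> [b1 b2]; split; exact: bcs_measurable. Qed.

Lemma complex_ReM (v w : R[i]) : Re (v * w) = Re v * Re w - Im v * Im w.
Proof. by case: v => a b; case: w. Qed.

Lemma complex_ImM (v w : R[i]) : Im (v * w) = Re v * Im w + Im v * Re w.
Proof. by case: v => a b; case: w. Qed.

Lemma cbcsZ (c : R[i]) f : cbcs f -> cbcs (fun z => c * f z).
Proof.
move=> [b1 b2]; split.
- by under eq_fun do rewrite complex_ReM; apply: bcsB; exact: bcsZ.
- by under eq_fun do rewrite complex_ImM; apply: bcsD; exact: bcsZ.
Qed.

Lemma cbcsD f g : cbcs f -> cbcs g -> cbcs (fun z => f z + g z).
Proof.
move=> [b1 b2] [c1 c2]; split.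
- by under eq_fun do rewrite raddfD; exact: bcsD.
- by under eq_fun do rewrite raddfD; exact: bcsD.
Qed.

(* Atoms are bounded almost everywhere only; [h'] is a bounded representative. *)
Definition mean_zero h := cmeasurable h /\ exists h', [/\ cbcs h',
  {ae area R, forall z, h z = h' z}, Int (fun z => Re (h' z)) = 0 & Int (fun z => Im (h' z)) = 0].

Lemma cmeasurableD f g : cmeasurable f -> cmeasurable g -> cmeasurable (fun z => f z + g z).
Proof.
by move=> [f1 f2] [g1 g2]; split; under eq_fun do rewrite raddfD; exact: measurable_funD.
Qed.

Lemma mean_zeroD f g : mean_zero f -> mean_zero g -> mean_zero (fun z => f z + g z).
Proof.
move=> [mf [f' [bf ff f1 f2]]] [mg [g' [bg gg g1 g2]]]; split; first exact: cmeasurableD.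
have [[b1 b2] [c1 c2]] := (bf, bg).
exists (fun z => f' z + g' z); split.
- exact: cbcsD.
- by apply: filterS2 ff gg => z -> ->.
- under [X in Int X]eq_fun do rewrite raddfD.
  by rewrite /= IntD ?f1 ?g1 ?addr0//; exact: bcs_Ig.
- under [X in Int X]eq_fun do rewrite raddfD.
  by rewrite /= IntD ?f2 ?g2 ?addr0//; exact: bcs_Ig.
Qed.

Lemma mean_zeroZ (c : R[i]) f : mean_zero f -> mean_zero (fun z => c * f z).
Proof.
move=> [mf [f' [bf ff f1 f2]]]; split.
  by apply: cmeasurable_mul => //; exact: cmeasurable_cst.
have [b1 b2] := bf.
exists (fun z => c * f' z); split.
- exact: cbcsZ.
- by apply: filterS ff => z ->.
- under [X in Int X]eq_fun do rewrite complex_ReM.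
  rewrite IntB; [|by apply: bcs_Ig; exact: bcsZ..].
  by rewrite !IntZ ?f1 ?f2 ?mulr0 ?subr0//; exact: bcs_Ig.
- under [X in Int X]eq_fun do rewrite complex_ImM.
  rewrite IntD; [|by apply: bcs_Ig; exact: bcsZ..].
  by rewrite !IntZ ?f1 ?f2 ?mulr0 ?addr0//; exact: bcs_Ig.
Qed.

Lemma mean_zero0 : mean_zero (fun=> 0).
Proof.
have b0 : cbcs (fun=> 0) by split => /=; exact: bcs_cst0.
split; first exact: cbcs_cmeasurable.
by exists (fun=> 0); split => //; [exact: aeW|exact: Int0|exact: Int0].
Qed.

Lemma mean_zero_sum n (c : 'I_n -> R[i]) (g : 'I_n -> plane R -> R[i]) :
  (forall j, mean_zero (g j)) -> mean_zero (fun z => \sum_(j < n) c j * g j z).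
Proof.
move=> mg; elim: (index_enum _) => [|j s ih].
  by under eq_fun do rewrite big_nil; exact: mean_zero0.
by under eq_fun do rewrite big_cons; apply: mean_zeroD => //; exact: mean_zeroZ.
Qed.

Lemma Rintegral_sq (u : plane R -> R) z0 (r : R) :
  Rintegral (area R) (sq z0 r) u = Int (fun z => u z * \1_(sq z0 r) z).
Proof.
rewrite Rintegral_mkcond unlock; congr Rintegral; apply/funext => z.
by rewrite /patch indicE; case: ifP => _; rewrite ?mulr1 ?mulr0.
Qed.

Lemma atom_mean_zero h : atom h -> mean_zero h.
Proof.
move=> [mh [a [l [l0 [h0 [hl hI]]]]]]; split => //.
have S0 : 0 <= l ^- 2 :> R by rewrite invr_ge0 sqr_ge0.
have ae := ccut_ae ((Linfty_normP h _).1 hl).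
have mc := cmeasurable_ccut (l ^- 2) mh; set h' := ccut _ h in ae mc.
set z0 := ((a.1 : R) + l / 2, (a.2 : R) + l / 2) : plane R.
have sE : square a l = sq z0 (l / 2) by exact: square_sq.
have out z : ~ sq z0 (l / 2) z -> h' z = 0.
  by rewrite -sE => /h0 hz; rewrite /h' /ccut hz; case: ifP.
have bs z : en z0 + 2 * (l / 2) + l ^- 2 < en z -> h' z = 0.
  move=> H; apply: out => /sq_en H2.
  by have := enD ((z : R * R) - z0) z0; rewrite subrK; lra.
have z00 := en_ge0 z0.
have bh : cbcs h'.
  have [m1 m2] := mc; split.
  - apply: (@bcsI _ _ (en z0 + 2 * (l / 2) + l ^- 2)) => // z; split; last by move=> /bs ->.
    by apply: (le_trans (Re_le_modulus _)); apply: (le_trans (ccut_le _ _ S0)); lra.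
  - apply: (@bcsI _ _ (en z0 + 2 * (l / 2) + l ^- 2)) => // z; split; last by move=> /bs ->.
    by apply: (le_trans (Im_le_modulus _)); apply: (le_trans (ccut_le _ _ S0)); lra.
have [m1 m2] := mc; have [n1 n2] := mh.
have mi := @measurable_indic_sq R z0 (l / 2).
have hsq u z : ~ sq z0 (l / 2) z \/ u * \1_(sq z0 (l / 2)) z = u :> R.
  have [zs|] := pselect (sq z0 (l / 2) z); last by left.
  by right; rewrite indicE mem_set// mulr1.
exists h'; split => //.
- have := congr1 (@complex.Re R) hI; rewrite /cintegral sE /= Rintegral_sq => <-.
  apply: Int_ae_eq => //; first exact: measurable_funM.
  by apply: filterS ae => z E; rewrite E; have [/out hz|->] := hsq (Re (h' z)) z; rewrite ?hz ?mul0r.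
- have := congr1 (@complex.Im R) hI; rewrite /cintegral sE /= Rintegral_sq => <-.
  apply: Int_ae_eq => //; first exact: measurable_funM.
  by apply: filterS ae => z E; rewrite E; have [/out hz|->] := hsq (Im (h' z)) z; rewrite ?hz ?mul0r.
Qed.

Lemma atomic_sum_mean_zero h : atomic_sum h -> mean_zero h.
Proof. by move=> [n [c [g [ag ->]]]]; apply: mean_zero_sum => j; exact: atom_mean_zero. Qed.

Variable k : nat.
Hypothesis k0 : (0 < k)%N.

Let cR : czk (5 * k%:R) k%:R (@Kre R k) := czk_Kre k0.
Let cI : czk (5 * k%:R) k%:R (@Kim R k) := czk_Kim k0.

Lemma Rk_truncE h h' (e : R) z : 0 < e -> cmeasurable h -> cbcs h' ->
  {ae area R, forall w, h w = h' w} ->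
  Rk_trunc k e h z =
    (tr (Kre k) e (fun w => Re (h' w)) z - tr (Kim k) e (fun w => Im (h' w)) z) +i*
    (tr (Kre k) e (fun w => Im (h' w)) z + tr (Kim k) e (fun w => Re (h' w)) z).
Proof.
move=> e0 mh [b1 b2] hh.
have bR := bdd_Ks cR e0; have bI := bdd_Ks cI e0.
have D w : [set w | e < modulus (toC z - toC w)] w <-> e < en ((z : R * R) - w) by [].
have E1 w u v : Kre k ((z : R * R) - w) * u - Kim k ((z : R * R) - w) * v =
   Re (Omega k (toC z - toC w) * (u +i* v)) by rewrite complex_ReM.
have K1 := cv_Ig z bR b1; have K2 := cv_Ig z bI b2.
have K3 := cv_Ig z bR b2; have K4 := cv_Ig z bI b1.
rewrite /Rk_trunc /cintegral; congr Complex; rewrite Rintegral_mkcond.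
- rewrite /tr !cvE -IntB//; apply: Rintegral_ae.
    by have /integrableP[/measurable_EFinP] := integrableB measurableT K1 K2.
  apply: filterS hh => w E; rewrite /patch !KsE E complex_ReM.
  have [h1|h1] := boolP (e < _); last by rewrite memNset ?mul0r ?subr0//=; exact/negP.
  by rewrite mem_set.
- rewrite /tr !cvE -IntD//; apply: Rintegral_ae.
    by have /integrableP[/measurable_EFinP] := integrableD measurableT K3 K4.
  apply: filterS hh => w E; rewrite /patch !KsE E complex_ImM.
  have [h1|h1] := boolP (e < _); last by rewrite memNset ?mul0r ?addr0//=; exact/negP.
  by rewrite mem_set.
Qed.

Lemma kap_log : (k%:R : R) <= 2 ^+ (trunc_log 2 k).+1.
Proof. by rewrite -natrX ler_nat ltnW// trunc_log_ltn. Qed.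

(** The truncated integrals do not see the null set where [h] and [h'] differ, and their real and
    imaginary parts are combinations of real truncations that converge almost everywhere. *)
Lemma Rk_ae h h' : cmeasurable h -> cbcs h' -> {ae area R, forall w, h w = h' w} ->
  {ae area R, forall z, Rk k h z =
    (pv (Kre k) (fun w => Re (h' w)) z - pv (Kim k) (fun w => Im (h' w)) z) +i*
    (pv (Kre k) (fun w => Im (h' w)) z + pv (Kim k) (fun w => Re (h' w)) z)}.
Proof.
move=> mh bh hh; have [b1 b2] := bh.
have HR : {ae area R, forall z, lim (Re (Rk_trunc k e h z) @[e --> 0^'+]) =
    pv (Kre k) (fun w => Re (h' w)) z - pv (Kim k) (fun w => Im (h' w)) z}.
  apply: filterS2 (pv_ae kap_log cR b1) (pv_ae kap_log cI b2) => z c1 c2; apply: cvg_lim => //.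
  apply: cvg_trans (cvgB c1 c2); apply: near_eq_cvg; near=> e.
  by rewrite (Rk_truncE z _ mh bh hh)//; near: e; exact: nbhs_right_gt.
have HI : {ae area R, forall z, lim (Im (Rk_trunc k e h z) @[e --> 0^'+]) =
    pv (Kre k) (fun w => Im (h' w)) z + pv (Kim k) (fun w => Re (h' w)) z}.
  apply: filterS2 (pv_ae kap_log cR b2) (pv_ae kap_log cI b1) => z c1 c2; apply: cvg_lim => //.
  apply: cvg_trans (cvgD c1 c2); apply: near_eq_cvg; near=> e.
  by rewrite (Rk_truncE z _ mh bh hh)//; near: e; exact: nbhs_right_gt.
by apply: filterS2 HR HI => z E1 E2; rewrite /Rk E1 E2.
Unshelve. all: by end_near.
Qed.

End complex_functions.

(** * The upper bound *)

Section oscillation.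
Context {R : realType}.
Implicit Types (z w : plane R).
Notation Ig f := ((area R).-integrable setT (EFin \o f)).
Notation Re := complex.Re.
Notation Im := complex.Im.

(** The average [m] is within the mean of [|u - c|] of [c], so using it in place of [c] at most
    doubles the oscillation. *)
Lemma mean_osc (u : plane R -> R) z0 (r c : R) : measurable_fun setT u -> 0 < r ->
  Ig (fun z => `|u z - c| * \1_(sq z0 r) z) ->
  let m := ((2 * r) ^+ 2)^-1 * Int (fun z => u z * \1_(sq z0 r) z) in
  Ig (fun z => `|u z - m| * \1_(sq z0 r) z) /\
  Int (fun z => `|u z - m| * \1_(sq z0 r) z) <= 2 * Int (fun z => `|u z - c| * \1_(sq z0 r) z).
Proof.
move=> mu r0 Ic m; have r0' := ltW r0.
have Iu := Ig_bounded_sq r0' mu Ic.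
have I1 := Ig_indic_sq z0 r0'; have I2 := IgZ c I1.
have r2 : 0 < (2 * r) ^+ 2 by rewrite exprn_gt0// mulr_gt0.
have mi := @measurable_indic_sq R z0 r.
have mcE : (m - c) * (2 * r) ^+ 2 = Int (fun z => u z * \1_(sq z0 r) z - c * \1_(sq z0 r) z).
  rewrite IntB// IntZ// Int_indic_sq// /m mulrBl; congr (_ - _).
  by rewrite mulrAC mulVf ?mul1r// gt_eqF.
have mc : `|m - c| * (2 * r) ^+ 2 <= Int (fun z => `|u z - c| * \1_(sq z0 r) z).
  rewrite -[X in _ * X](gtr0_norm r2) -normrM mcE.
  have I3 : Ig (fun z => u z * \1_(sq z0 r) z - c * \1_(sq z0 r) z).
    by have := integrableB measurableT Iu I2.
  apply: (le_trans (Int_abs I3)); apply: Int_le => //; first exact: integrable_norm.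
  by move=> z; rewrite -mulrBl normrM (ger0_norm (indic_ge0 _ _)).
have I4 : Ig (fun z => `|u z - c| * \1_(sq z0 r) z + `|m - c| * \1_(sq z0 r) z).
  by have := integrableD measurableT Ic (IgZ `|m - c| I1).
have [||||J H] := @Int_le_ae R (fun z => `|u z - m| * \1_(sq z0 r) z) _ _ I4.
- apply: measurable_funM => //; apply: measurableT_comp => //.
  by apply: measurable_funB => //; exact: measurable_cst.
- by move=> z; rewrite mulr_ge0// indic_ge0.
- by move=> z; apply: addr_ge0; apply: mulr_ge0 => //; exact: indic_ge0.
- apply: aeW => z; rewrite -mulrDl; apply: ler_wpM2r; first exact: indic_ge0.
  have -> : u z - m = (u z - c) - (m - c) by ring.
  exact: ler_normB.
split => //; apply: (le_trans H); rewrite (IntD Ic (IgZ _ I1)) (IntZ _ I1) Int_indic_sq//.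
by move: mc; move: (Int _) => x; lra.
Qed.

(** BMO with a free constant on each square, a form stable under sums. The area being [4 r^2], the
    mean oscillation about [c] is at most [B / 4]. *)
Definition osc_le (u : plane R -> R) (B : R) := measurable_fun setT u /\
  forall z0 (r : R), 0 < r -> exists c : R,
    Ig (fun z => `|u z - c| * \1_(sq z0 r) z) /\
    Int (fun z => `|u z - c| * \1_(sq z0 r) z) <= B * r ^+ 2.

Lemma osc_leD (u v : plane R -> R) (B C : R) : osc_le u B -> osc_le v C ->
  osc_le (fun z => u z + v z) (B + C).
Proof.
move=> [mu hu] [mv hv]; have muv := measurable_funD mu mv; split => // z0 r r0.
have [c [Iu Bu]] := hu z0 r r0; have [d [Iv Bv]] := hv z0 r r0; exists (c + d).
have I4 : Ig (fun z => `|u z - c| * \1_(sq z0 r) z + `|v z - d| * \1_(sq z0 r) z).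
  by have := integrableD measurableT Iu Iv.
have [||||J H] := @Int_le_ae R (fun z => `|u z + v z - (c + d)| * \1_(sq z0 r) z) _ _ I4.
- apply: measurable_funM; last exact: measurable_indic_sq.
  by apply: measurableT_comp => //; apply: measurable_funB => //; exact: measurable_cst.
- by move=> z; rewrite mulr_ge0// indic_ge0.
- by move=> z; apply: addr_ge0; apply: mulr_ge0 => //; exact: indic_ge0.
- apply: aeW => z; rewrite -mulrDl; apply: ler_wpM2r; first exact: indic_ge0.
  have -> : u z + v z - (c + d) = (u z - c) + (v z - d) by ring.
  exact: ler_normD.
split => //; apply: (le_trans H); rewrite IntD// mulrDl; exact: lerD.
Qed.

Lemma osc_leN (u : plane R -> R) (B : R) : osc_le u B -> osc_le (fun z => - u z) B.
Proof.
move=> [mu hu]; split; first exact: measurable_funN.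
move=> z0 r r0; have [c [Iu Bu]] := hu z0 r r0; exists (- c).
have E : (fun z => `|- u z - - c| * \1_(sq z0 r) z) = (fun z => `|u z - c| * \1_(sq z0 r) z).
  by apply/funext => z; rewrite -opprD normrN.
by rewrite E.
Qed.

Lemma Ig_sqP (u : plane R -> R) z0 (r : R) : measurable_fun setT u ->
  Ig (fun z => u z * \1_(sq z0 r) z) -> (area R).-integrable (sq z0 r) (EFin \o u).
Proof.
move=> mu Iu; apply/(integrable_mkcond _ (measurable_sq z0 r)).
move: Iu; congr (integrable _ _ _); apply/funext => z.
by rewrite /patch /= indicE; case: ifP => _; rewrite ?mulr1 ?mulr0.
Qed.

(** A factor [2] for passing to averages and a factor [2] for the two parts compensate
    [r^2 = l^2 / 4]. *)
Lemma osc_in_BMO (b : plane R -> R[i]) (B : R) : osc_le (fun z => Re (b z)) B ->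
  osc_le (fun z => Im (b z)) B -> in_BMO b /\ (BMO_norm b <= B%:E)%E.
Proof.
move=> [m1 h1] [m2 h2].
suff H : (BMO_norm b <= B%:E)%E.
  split => //; split => //; split; last by apply: le_lt_trans H _; rewrite ltry.
  move=> a l l0; rewrite square_sq; have r0 : 0 < l / 2 by rewrite divr_gt0.
  have [c1 [I1 _]] := h1 ((a.1 : R) + l / 2, (a.2 : R) + l / 2) _ r0.
  have [c2 [I2 _]] := h2 ((a.1 : R) + l / 2, (a.2 : R) + l / 2) _ r0.
  split; apply: Ig_sqP => //; [exact: Ig_bounded_sq (ltW r0) m1 I1|exact: Ig_bounded_sq (ltW r0) m2 I2].
apply: ge_ereal_sup => _ [a [l [l0 ->]]].
rewrite /average /cintegral square_sq.
set z0 : plane R := ((a.1 : R) + l / 2, (a.2 : R) + l / 2).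
have r0 : 0 < l / 2 by rewrite divr_gt0.
have lE : 2 * (l / 2) = l by field.
have [c1 [I1 B1]] := h1 z0 _ r0; have [c2 [I2 B2]] := h2 z0 _ r0.
have := mean_osc m1 r0 I1; have := mean_osc m2 r0 I2; rewrite lE.
set n1 := _ * Int (fun z => Re (b z) * _); set n2 := _ * Int (fun z => Im (b z) * _).
move=> [J2 K2] [J1 K1].
rewrite !Rintegral_sq.
have -> : (l ^- 2)%:C * (Int (fun z => Re (b z) * \1_(sq z0 (l / 2)) z) +i*
    Int (fun z => Im (b z) * \1_(sq z0 (l / 2)) z)) = n1 +i* n2.
  by rewrite /n1 /n2; simpc.
have mb : measurable_fun setT (fun z => modulus (b z - (n1 +i* n2))).
  apply: measurable_modulus; split; under eq_fun do rewrite raddfB /=.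
  - by apply: measurable_funB => //; exact: measurable_cst.
  - by apply: measurable_funB => //; exact: measurable_cst.
have I4 : Ig (fun z => `|Re (b z) - n1| * \1_(sq z0 (l / 2)) z + `|Im (b z) - n2| * \1_(sq z0 (l / 2)) z).
  by have := integrableD measurableT J1 J2.
have [||||J H] := @Int_le_ae R (fun z => modulus (b z - (n1 +i* n2)) * \1_(sq z0 (l / 2)) z) _ _ I4.
- by apply: measurable_funM => //; exact: measurable_indic_sq.
- by move=> z; rewrite mulr_ge0 ?modulus_ge0// indic_ge0.
- by move=> z; apply: addr_ge0; apply: mulr_ge0 => //; exact: indic_ge0.
- apply: aeW => z; rewrite -mulrDl; apply: ler_wpM2r; first exact: indic_ge0.
  by apply: (le_trans (modulus_le_ReIm _)); rewrite !raddfB.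
have -> : (\int[area R]_(z in sq z0 (l / 2)) (modulus (b z - (n1 +i* n2)))%:E =
    (Int (fun z => modulus (b z - (n1 +i* n2)) * \1_(sq z0 (l / 2)) z))%:E)%E.
  rewrite -EFin_Int// integral_mkcond; apply: eq_integral => z _.
  by rewrite /patch indicE; case: ifP => _; rewrite ?mulr1 ?mulr0.
rewrite -EFinM lee_fin mulrC ler_pdivrMr ?exprn_gt0//.
apply: (le_trans H); rewrite IntD//.
move: K1 K2 B1 B2; rewrite exprMn.
move: (Int _) (Int _) (Int _) (Int _) => x1 x2 x3 x4.
rewrite exprVn; lra.
Qed.

End oscillation.

Section upper_bound.
Context {R : realType}.
Implicit Types (z w : plane R) (K g : plane R -> R).
Notation Ig f := ((area R).-integrable setT (EFin \o f)).
Notation Re := complex.Re.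
Notation Im := complex.Im.

Lemma pvKZ_ae (A kap : R) (L : nat) (c : R) K g : kap <= 2 ^+ L -> czk A kap K -> bcs g ->
  {ae area R, forall z, pv (fun w => c * K w) g z = c * pv K g z}.
Proof.
move=> kL cK bg; apply: filterS (pv_ae kL cK bg) => z cg; apply: pvE.
apply: cvg_trans (cvgM (cvg_cst c) cg); apply: near_eq_cvg; near=> e.
have e0 : 0 < e by near: e; exact: nbhs_right_gt.
transitivity (c * tr K e g z) => //.
rewrite /tr !cvE -IntZ; last by apply: cv_Ig => //; exact: bdd_Ks cK e0.
by congr Int; apply/funext => w; rewrite /Ks; ring.
Unshelve. all: by end_near.
Qed.

Variables (k : nat) (f : plane R -> R[i]) (S : R).
Hypothesis k0 : (0 < k)%N.
Hypothesis mf : cmeasurable f.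
Hypothesis fS : forall z, modulus (f z) <= S.

Let L := (trunc_log 2 k).+1.
Let sg : R := (-1) ^+ k.
Let cR : czk (5 * k%:R) k%:R (@Kre R k) := czk_Kre k0.
Let cI : czk (5 * k%:R) k%:R (@Kim R k) := czk_Kim k0.
Let kL : (k%:R : R) <= 2 ^+ L := @kap_log R k.
Let fr z := Re (f z).
Let fi z := Im (f z).
Let mr : measurable_fun setT fr. Proof. by case: mf. Qed.
Let mi : measurable_fun setT fi. Proof. by case: mf. Qed.
Let frS z : `|fr z| <= S. Proof. exact: le_trans (Re_le_modulus _) (fS z). Qed.
Let fiS z : `|fi z| <= S. Proof. exact: le_trans (Im_le_modulus _) (fS z). Qed.

Definition cext z : R[i] :=
  (ext (Kre k) fr z - ext (Kim k) fi z) +i* (ext (Kre k) fi z + ext (Kim k) fr z).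

Lemma cext_BMO : in_BMO cext /\ (BMO_norm cext <= (42 * Cb (5 * k%:R) L * S)%:E)%E.
Proof.
have o K (u : plane R -> R) : czk (5 * k%:R) k%:R K -> measurable_fun setT u ->
    (forall z, `|u z| <= S) -> osc_le (ext K u) (21 * Cb (5 * k%:R) L * S).
  move=> cK mu uS; split; first exact: (measurable_ext cK).
  by move=> z0 r r0; exact: (ext_bmo kL cK).
have -> : 42 * Cb (5 * k%:R) L * S = 21 * Cb (5 * k%:R) L * S + 21 * Cb (5 * k%:R) L * S by ring.
apply: osc_in_BMO => /=.
- by apply: osc_leD; [exact: o|apply: osc_leN; exact: o].
- by apply: osc_leD; exact: o.
Qed.

Lemma ext_pairing_sign K (u h : plane R -> R) : czk (5 * k%:R) k%:R K ->
  rf K = (fun z => sg * K z) -> measurable_fun setT u -> (forall z, `|u z| <= S) ->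
  bcs h -> Int h = 0 ->
  [/\ Ig (fun z => ext K u z * h z), Ig (fun z => u z * pv K h z) &
    Int (fun z => ext K u z * h z) = sg * Int (fun z => u z * pv K h z)].
Proof.
move=> cK rK mu uS bh h0.
have I1 : Ig (fun z => u z * pv K h z) := Ig_mul_bounded mu uS (Ig_pv kL cK bh h0).
split => //.
  apply: Ig_mul_bcs => //; first exact: (measurable_ext cK).
  by move=> r r0; exact: (Ig_ext_sq kL cK mu uS).
rewrite (ext_pairing kL cK mu uS bh h0) -IntZ//.
apply: Int_ae_eq.
- apply: measurable_funM => //; exact: (measurable_pv (czk_rf cK)).
- apply: measurable_funM => //.
  apply: measurable_funM => //; exact: (measurable_pv cK).
- by rewrite rK; apply: filterS (pvKZ_ae sg kL cK bh) => z ->; rewrite mulrCA.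
Qed.

Lemma cext_is_Rk (f0 : plane R -> R[i]) : {ae area R, forall z, f0 z = f z} -> is_Rk k f0 cext.
Proof.
move=> ff; split; first by case: cext_BMO.
move=> h /atomic_sum_mean_zero[mh [h' [bh hh z1 z2]]].
have [b1 b2] := bh.
have rR : rf (@Kre R k) = (fun z => sg * Kre k z) := rf_Kre k.
have rI : rf (@Kim R k) = (fun z => sg * Kim k z) := rf_Kim k.
(* The product of a complex kernel and two complex functions splits into eight real pairings, four
   for the real and four for the imaginary part; each yields the sign [(-1)^k] by the parity of the
   kernel. *)
have [Ia Ja Ea] := ext_pairing_sign cR rR mr frS b1 z1.
have [Ib Jb Eb] := ext_pairing_sign cI rI mi fiS b1 z1.
have [Ic Jc Ec] := ext_pairing_sign cR rR mi fiS b2 z2.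
have [Id Jd Ed] := ext_pairing_sign cI rI mr frS b2 z2.
have [Ie Je Ee] := ext_pairing_sign cR rR mr frS b2 z2.
have [If Jf Ef] := ext_pairing_sign cI rI mi fiS b2 z2.
have [Ih Jh Eh] := ext_pairing_sign cR rR mi fiS b1 z1.
have [Ii Ji Ei] := ext_pairing_sign cI rI mr frS b1 z1.
have RkE := Rk_ae k0 mh bh hh.
have IgD u v : Ig u -> Ig v -> Ig (fun z => u z + v z) by move=> Iu Iv; have := integrableD measurableT Iu Iv.
have IgB u v : Ig u -> Ig v -> Ig (fun z => u z - v z) by move=> Iu Iv; have := integrableB measurableT Iu Iv.
have mI u : Ig u -> measurable_fun setT u by move=> /integrableP[/measurable_EFinP].
have -> : (-1 : R[i]) ^+ k = sg%:C by rewrite /sg rmorphXn rmorphN rmorph1.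
pose h1 z := Re (h' z); pose h2 z := Im (h' z).
have aux1 (a b c d x y : R) : (a - b) * x - (c + d) * y = (a * x - b * x) - (c * y + d * y) by ring.
have aux2 (a b c d x y : R) : (a - b) * y + (c + d) * x = (a * y - b * y) + (c * x + d * x) by ring.
have aux3 (p q a b c d : R) : p * (a - b) - q * (c + d) = (p * a - q * d) - (q * c + p * b) by ring.
have aux4 (p q a b c d : R) : p * (c + d) + q * (a - b) = (p * c - q * b) + (q * a + p * d) by ring.
have aux5 (t a b c d a' b' c' d' A B C D A' B' C' D' : R) : A = t * a -> B = t * b -> C = t * c ->
    D = t * d -> A' = t * a' -> B' = t * b' -> C' = t * c' -> D' = t * d' ->
    (A - B - (C + D)) +i* (A' - B' + (C' + D')) =
    t%:C * ((a - b - (c + d)) +i* (a' - b' + (c' + d'))).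
  by move=> -> -> -> -> -> -> -> ->; simpc; congr Complex; ring.
have L1 : Rintegral (area R) setT (fun z => Re (cext z * h z)) =
    Int (fun z => (ext (Kre k) fr z * h1 z - ext (Kim k) fi z * h1 z) -
                  (ext (Kre k) fi z * h2 z + ext (Kim k) fr z * h2 z)).
  apply: Rintegral_ae; first exact: (mI _ (IgB _ _ (IgB _ _ Ia Ib) (IgD _ _ Ic Id))).
  by apply: filterS hh => z ->; rewrite complex_ReM; exact: aux1.
have L2 : Rintegral (area R) setT (fun z => Im (cext z * h z)) =
    Int (fun z => (ext (Kre k) fr z * h2 z - ext (Kim k) fi z * h2 z) +
                  (ext (Kre k) fi z * h1 z + ext (Kim k) fr z * h1 z)).
  apply: Rintegral_ae; first exact: (mI _ (IgD _ _ (IgB _ _ Ie If) (IgD _ _ Ih Ii))).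
  by apply: filterS hh => z ->; rewrite complex_ImM; exact: aux2.
have R1 : Rintegral (area R) setT (fun z => Re (f0 z * Rk k h z)) =
    Int (fun z => (fr z * pv (Kre k) h1 z - fi z * pv (Kim k) h1 z) -
                  (fi z * pv (Kre k) h2 z + fr z * pv (Kim k) h2 z)).
  apply: Rintegral_ae; first exact: (mI _ (IgB _ _ (IgB _ _ Ja Jb) (IgD _ _ Jc Jd))).
  by apply: filterS2 ff RkE => z -> ->; rewrite complex_ReM; exact: aux3.
have R2 : Rintegral (area R) setT (fun z => Im (f0 z * Rk k h z)) =
    Int (fun z => (fr z * pv (Kre k) h2 z - fi z * pv (Kim k) h2 z) +
                  (fi z * pv (Kre k) h1 z + fr z * pv (Kim k) h1 z)).
  apply: Rintegral_ae; first exact: (mI _ (IgD _ _ (IgB _ _ Je Jf) (IgD _ _ Jh Ji))).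
  by apply: filterS2 ff RkE => z -> ->; rewrite complex_ImM; exact: aux4.
rewrite /cintegral L1 L2 R1 R2.
rewrite (IntB (IgB _ _ Ia Ib) (IgD _ _ Ic Id)) (IntB Ia Ib) (IntD Ic Id).
rewrite (IntD (IgB _ _ Ie If) (IgD _ _ Ih Ii)) (IntB Ie If) (IntD Ih Ii).
rewrite (IntB (IgB _ _ Ja Jb) (IgD _ _ Jc Jd)) (IntB Ja Jb) (IntD Jc Jd).
rewrite (IntD (IgB _ _ Je Jf) (IgD _ _ Jh Ji)) (IntB Je Jf) (IntD Jh Ji).
exact: (aux5 _ _ _ _ _ _ _ _ _ _ _ _ _ _ _ _ _ Ea Eb Ec Ed Ee Ef Eh Ei).
Qed.

End upper_bound.

Section operator_norm_upper.
Context {R : realType}.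

Lemma Rk_bound (k : nat) (f : plane R -> R[i]) : (0 < k)%N -> in_Linfty f ->
  exists b, is_Rk k f b /\
    (BMO_norm b <= (42 * Cb (5 * k%:R) (trunc_log 2 k).+1)%:E * Linfty_norm f)%E.
Proof.
move=> k0 fL; have [S [S0 E aeS]] := Linfty_norm_fin fL; have [mf _] := fL.
have mc := cmeasurable_ccut S mf; have cS z := ccut_le f z S0.
have ff := ccut_ae aeS.
exists (cext k (ccut S f)); split; first exact: (cext_is_Rk k0 mc cS).
by rewrite E -EFinM; have [_] := cext_BMO k0 mc cS.
Qed.

(** The left side is [t + 3] with [2^t <= k]; both [t * ln 2] and [ln 2] are at most
    [ln (k + 1)]. *)
Lemma log_bound (k : nat) : (0 < k)%N ->
  (trunc_log 2 k).+1%:R + 2 <= 4 / ln 2 * ln k.+1%:R :> R.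
Proof.
move=> k0; have l2 : 0 < ln 2 :> R by rewrite ln_gt0// ltr1n.
have h1 : ln 2 <= ln k.+1%:R :> R by rewrite ler_ln ?posrE// ler_nat.
have h2 : (trunc_log 2 k)%:R * ln 2 <= ln k.+1%:R :> R.
  rewrite mulr_natl -lnXn// -natrX ler_ln ?posrE ?ltr0n ?expn_gt0// ler_nat.
  by apply: leqW; exact: trunc_logP.
rewrite -(ler_pM2r l2) -natr1.
have -> : 4 / ln 2 * ln k.+1%:R * ln 2 = 4 * ln k.+1%:R :> R by field; rewrite gt_eqF.
lra.
Qed.

Lemma opnorm_upper : exists2 C : R, 0 <= C & forall k : nat, (0 < k)%N ->
  (Rk_opnorm R k <= (C * k%:R * ln k.+1%:R)%:E)%E.
Proof.
have l2 : 0 < ln 2 :> R by rewrite ln_gt0// ltr1n.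
(* From [42 * Cb], with [Cb = 2^16 A Vc], [A = 5 k] and [Vc = 2 (L + 2)]. *)
pose N : R := 42 * 2 ^+ 16 * 5 * 2.
have N0 : 0 <= N by rewrite /N !mulr_ge0// exprn_ge0.
exists (N * (4 / ln 2)); first by rewrite mulr_ge0// divr_ge0// ltW.
move=> k k0; pose M : R := 42 * Cb (5 * k%:R) (trunc_log 2 k).+1.
have M0 : 0 <= M by rewrite mulr_ge0// Cb_ge0// mulr_ge0.
apply: (@le_trans _ _ M%:E).
  by apply: ereal_inf_lbound; exists M => //; split => // f fL; exact: Rk_bound.
rewrite lee_fin.
have -> : M = N * k%:R * ((trunc_log 2 k).+1%:R + 2) by rewrite /M /N /Cb /Vc; ring.
have -> : N * (4 / ln 2) * k%:R * ln k.+1%:R = N * k%:R * (4 / ln 2 * ln k.+1%:R) by ring.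
by apply: ler_wpM2l; [exact: mulr_ge0|exact: log_bound].
Qed.

End operator_norm_upper.

(** * The lower bound *)

Section lower_bound.
Context {R : realType}.
Implicit Types (z w : plane R) (k : nat).
Notation Ig f := ((area R).-integrable setT (EFin \o f)).
Notation Re := complex.Re.
Notation Im := complex.Im.

(** Second-order Taylor remainder of the power on the unit circle. Passing from [k] to [k + 1] adds
    [k (a - 1)^2], and [k^2 / 2 + k <= (k + 1)^2 / 2]. *)
Lemma modulusX_taylor (a : R[i]) k : modulus a = 1 ->
  modulus (a ^+ k - 1 - k%:R * (a - 1)) <= k%:R ^+ 2 / 2 * modulus (a - 1) ^+ 2.
Proof.
move=> a1; elim: k => [|k ih].
  by rewrite expr0 subrr mul0r subrr Normc.normc0 expr0n /= !mul0r.
have -> : a ^+ k.+1 - 1 - k.+1%:R * (a - 1) =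
    a * (a ^+ k - 1 - k%:R * (a - 1)) + k%:R * (a - 1) ^+ 2.
  by rewrite exprS -natr1; ring.
apply: (le_trans (le_normcD _ _)); rewrite (Normc.normcM a) (Normc.normcM k%:R) a1 mul1r modulusX.
have -> : modulus (k%:R : R[i]) = k%:R.
  have -> : (k%:R : R[i]) = (k%:R)%:C by rewrite rmorph_nat.
  by rewrite modulus_real ger0_norm.
apply: (le_trans (lerD ih (lexx _))); rewrite -mulrDl.
apply: ler_wpM2r; first exact: sqr_ge0.
have -> : k.+1%:R ^+ 2 / 2 = k%:R ^+ 2 / 2 + k%:R + 1 / 2 :> R by rewrite -natr1; field.
lra.
Qed.

Lemma Im_powX (a : R[i]) k : modulus a = 1 ->
  `|Im (a ^+ k) - k%:R * Im a| <= k%:R ^+ 2 / 2 * modulus (a - 1) ^+ 2.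
Proof.
move=> a1; apply: le_trans (modulusX_taylor k a1); apply: le_trans (Im_le_modulus _).
have -> : Im (a ^+ k - 1 - k%:R * (a - 1)) = Im (a ^+ k) - k%:R * Im a; last by [].
have -> : (k%:R : R[i]) = (k%:R)%:C by rewrite rmorph_nat.
by case: (a ^+ k) => x y; case: a {a1} => u v /=; ring.
Qed.

Definition region k : set (plane R) := square (0, 40 * k%:R) k%:R.

(** The sign [s] is [1] on the right-hand square and [-1] on the left-hand one. The linear term
    [k Im a] has size at least [39 / 1890]; the height [40 k] gives [|a - 1| <= 3 / (20 k)], so the
    quadratic error is at most [9 / 800], and the difference exceeds [1 / 120]. *)
Lemma phase_rotation k z w (s : R) : (0 < k)%N -> region k z -> s ^+ 2 = 1 ->
  1 <= s * w.1 <= 2 -> 0 <= w.2 <= 1 ->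
  let a := (uconj (toC z))^* * uconj (toC z - toC w) in
  1 / 120 <= - (s * Im (a ^+ k)) /\ 0 < en ((z : R * R) - w) <= 45 * k%:R.
Proof.
move=> k0 zG s2 /andP[w1 w1'] /andP[w2 w2'] a.
have k1 : (1 : R) <= k%:R by rewrite ler1n.
move: zG; rewrite /region /square /= !in_itv /= add0r => -[/andP[x0 xk] /andP[y0 yk]].
have ss : `|s| = 1.
  by apply/eqP; rewrite -(eqrXn2 (_ : 0 < 2)%N)// real_normK ?num_real// s2 expr1n.
have wl : `|w.1| <= 2.
  by rewrite -[`|w.1|]mul1r -ss -normrM ger0_norm//; lra.
have ew : en w <= 3 by apply: (le_trans (en_le w)); rewrite (ger0_norm w2); lra.
have zl : 40 * k%:R <= en z by apply: le_trans (le_en2 z); rewrite ger0_norm; lra.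
have zu : en z <= 42 * k%:R by apply: (le_trans (en_le z)); rewrite !ger0_norm; lra.
have zwl : 37 * k%:R <= en ((z : R * R) - w) by have := en_subl z w; lra.
have zwu : en ((z : R * R) - w) <= 45 * k%:R.
  by apply: (le_trans (enD z (- (w : R * R)))); rewrite enN; lra.
have ez0 : 0 < en z by lra.
have ezw0 : 0 < en ((z : R * R) - w) by lra.
split; last by rewrite ezw0.
have nz0 : toC z != 0 by apply/eqP => h; move: ez0; rewrite /en h Normc.normc0 ltxx.
have nzw0 : toC z - toC w != 0 by apply/eqP => h; move: ezw0; rewrite /en toCB h Normc.normc0 ltxx.
have a1 : modulus a = 1 by rewrite Normc.normcM modulusJ !modulus_uconj// mulr1.
have h1 := Im_powX k a1.
have tt : (uconj (toC z))^* * uconj (toC z) = 1.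
  rewrite mulrC -sqr_normc modulus_norm modulus_uconj//; exact: expr1n.
have d1 : modulus (a - 1) <= 3 / (20 * k%:R).
  have -> : a - 1 = (uconj (toC z))^* * (uconj (toC z - toC w) - uconj (toC z)) by rewrite mulrBr tt.
  rewrite Normc.normcM modulusJ modulus_uconj// mul1r.
  apply: (le_trans (uconj_sub ezw0 ez0)).
  have -> : modulus (toC z - toC w - toC z) = en w by rewrite addrAC subrr add0r normcN.
  rewrite -/(en z) ler_pdivrMr// mulrAC ler_pdivlMr; last by lra.
  have := en_ge0 w; nra.
have e1 : k%:R ^+ 2 / 2 * modulus (a - 1) ^+ 2 <= 9 / 800.
  have k2 : 0 <= k%:R ^+ 2 / 2 :> R by rewrite divr_ge0// sqr_ge0.
  apply: (@le_trans _ _ (k%:R ^+ 2 / 2 * (3 / (20 * k%:R)) ^+ 2)).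
    have q0 : 0 <= 3 / (20 * k%:R) :> R by apply: divr_ge0 => //; lra.
    have a0 := modulus_ge0 (a - 1).
    by apply: ler_wpM2l => //; apply: lerXn2r d1.
  by rewrite le_eqVlt; apply/orP; left; apply/eqP; field; rewrite gt_eqF//; lra.
(* The sine of the angle from [z - w] to [z] is a cross product. The term [z.2 * w.1], at least
   [40 k] in absolute value, dominates [z.1 * w.2], at most [k]. *)
have ImE : Im a * (en z * en ((z : R * R) - w)) = z.1 * w.2 - z.2 * w.1.
  have gen (p q : R[i]) (m n : R) : Im ((p^* * m%:C)^* * (q^* * n%:C)) = (Im p * Re q - Re p * Im q) * (m * n).
    by case: p => p1 p2; case: q => q1 q2; simpc => /=; ring.
  rewrite /a !uconjE gen -/(en z) en_toC -invfM mulfVK; last by rewrite mulf_neq0 ?gt_eqF.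
  by rewrite /=; ring.
have m1 : 39 * k%:R <= - (s * (z.1 * w.2 - z.2 * w.1)).
  have h2 : - k%:R <= - (s * z.1 * w.2).
    have : `|s * z.1 * w.2| <= k%:R.
      rewrite !normrM ss mul1r !ger0_norm//; apply: (@le_trans _ _ (k%:R * 1)); last by rewrite mulr1.
      exact: ler_pM.
    by move=> /ler_normlP[]; lra.
  have h3 : 40 * k%:R <= z.2 * (s * w.1).
    apply: (@le_trans _ _ (z.2 * 1)); first lra.
    by apply: ler_wpM2l => //; lra.
  have -> : - (s * (z.1 * w.2 - z.2 * w.1)) = - (s * z.1 * w.2) + z.2 * (s * w.1) by ring.
  lra.
have m2 : 39 / 1890 <= - (s * (k%:R * Im a)).
  have P : 0 < en z * en ((z : R * R) - w) by rewrite mulr_gt0.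
  have Q : en z * en ((z : R * R) - w) <= 1890 * k%:R ^+ 2.
    have -> : 1890 * k%:R ^+ 2 = (42 * k%:R) * (45 * k%:R) :> R by ring.
    by apply: ler_pM => //; exact: ltW.
  rewrite -(ler_pM2r P).
  have -> : - (s * (k%:R * Im a)) * (en z * en ((z : R * R) - w)) = k%:R * - (s * (z.1 * w.2 - z.2 * w.1)).
    by rewrite -ImE; ring.
  apply: (@le_trans _ _ (39 / 1890 * (1890 * k%:R ^+ 2))); first by apply: ler_wpM2l Q; lra.
  have -> : 39 / 1890 * (1890 * k%:R ^+ 2) = k%:R * (39 * k%:R) :> R by field.
  by apply: ler_wpM2l m1; exact: ler0n.
have : `|s * (Im (a ^+ k) - k%:R * Im a)| <= 9 / 800.
  by rewrite normrM ss mul1r; exact: le_trans h1 e1.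
move=> /ler_normlP[]; rewrite mulrBr; move: m2; move: (s * _) (s * _) => p q; lra.
Qed.

End lower_bound.

(** * Test functions for the lower bound *)

Section test_functions.
Context {R : realType}.
Implicit Types (z w : plane R).
Notation Ig f := ((area R).-integrable setT (EFin \o f)).
Notation Re := complex.Re.
Notation Im := complex.Im.

Definition Qr : set (plane R) := square (1, 0) 1.
Definition Ql : set (plane R) := square (-2, 0) 1.
(** One square containing both [Qr] and [Ql], so that [hR / 16] is a single atom. *)
Definition Qh : set (plane R) := square (-2, 0) 4.
Definition hR w : R := \1_Qr w - \1_Ql w.

Lemma square_indic (a : plane R) (l : R) : 0 < l ->
  bcs (\1_(square a l) : plane R -> R) /\ Int (\1_(square a l) : plane R -> R) = l ^+ 2.
Proof.
move=> l0; rewrite square_sq; split; first exact: bcs_indic_sq.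
by rewrite Int_indic_sq; [congr (_ ^+ 2); field|rewrite divr_ge0// ltW].
Qed.

Lemma bcs_hR : bcs hR.
Proof.
have [b1 _] := @square_indic (1, 0) 1 ltr01; have [b2 _] := @square_indic (-2, 0) 1 ltr01.
exact: (bcsB b1 b2).
Qed.

Lemma Int_hR : Int hR = 0.
Proof.
have [b1 E1] := @square_indic (1, 0) 1 ltr01; have [b2 E2] := @square_indic (-2, 0) 1 ltr01.
by rewrite /hR /Qr /Ql IntB; [rewrite [X in X - _]E1 [X in _ - X]E2 subrr|exact: bcs_Ig..].
Qed.

Lemma Qr_Ql w : Qr w -> ~ Ql w.
Proof. by rewrite /Qr /Ql /square /= !in_itv /= => -[/andP[h1 _] _] [/andP[_ h2] _]; lra. Qed.

Lemma hR_cases w : [\/ hR w = 1 /\ Qr w, hR w = -1 /\ Ql w | [/\ hR w = 0, ~ Qr w & ~ Ql w]].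
Proof.
rewrite /hR !indicE; have [r|r] := pselect (Qr w).
  by apply: Or31; rewrite mem_set// memNset ?subr0//; exact: Qr_Ql.
have [l|l] := pselect (Ql w).
  by apply: Or32; rewrite memNset// mem_set// sub0r.
by apply: Or33; rewrite memNset// memNset// subr0.
Qed.

Lemma hR_norm w : `|hR w| = \1_Qr w + \1_Ql w.
Proof.
rewrite /hR !indicE; have [r|r] := pselect (Qr w).
  by rewrite mem_set// memNset ?subr0 ?addr0 ?normr1//; exact: Qr_Ql.
by rewrite memNset// sub0r add0r normrN ger0_norm.
Qed.

Lemma hR_le w : `|hR w| <= 1.
Proof. by have [[-> _]|[-> _]|[-> _ _]] := hR_cases w; rewrite ?normrN ?normr1 ?normr0. Qed.

Lemma hR_support w : ~ Qh w -> hR w = 0.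
Proof.
move=> nw; have [[_ r]|[_ l]|[->//]] := hR_cases w; exfalso; apply: nw.
- move: r; rewrite /Qr /Qh /square /= !in_itv /= => -[/andP[? ?] /andP[? ?]].
  by split; apply/andP; split; lra.
- move: l; rewrite /Ql /Qh /square /= !in_itv /= => -[/andP[? ?] /andP[? ?]].
  by split; apply/andP; split; lra.
Qed.

Lemma atomic_hR : atomic_sum (fun w => (hR w)%:C).
Proof.
pose g w : R[i] := ((4 ^- 2 : R) * hR w)%:C.
exists 1%N, (fun=> (16 : R)%:C), (fun=> g); split; last first.
  apply/funext => w; rewrite big_ord1 /g -rmorphM /=; congr (_%:C).
  by rewrite mulrA (_ : 16 * 4 ^- 2 = 1 :> R) ?mul1r//; field.
move=> _; have bh := bcs_hR; have bg := bcsZ (4 ^- 2) bh.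
split; first by apply: cmeasurable_real; exact: bcs_measurable.
exists (-2, 0), 4; split => //; split.
  by move=> z nz; rewrite /g hR_support// mulr0.
have q0 : 0 <= 4 ^- 2 :> R by rewrite invr_ge0 sqr_ge0.
split.
  apply/Linfty_normP; apply: aeW => z; rewrite /g modulus_real normrM (ger0_norm q0).
  by apply: ler_piMr => //; exact: hR_le.
have E : (fun z => (4 ^- 2 * hR z) * \1_(Qh) z) = (fun z => 4 ^- 2 * hR z).
  apply/funext => z; rewrite indicE.
  have [zs|/hR_support ->] := pselect (Qh z); last by rewrite mulr0 mul0r.
  by rewrite mem_set// mulr1.
rewrite /cintegral -/Qh /Qh square_sq !Rintegral_sq -square_sq -/Qh /= E.
rewrite (IntZ _ (bcs_Ig bh)) Int_hR mulr0.
by under [X in Int X]eq_fun do rewrite mul0r; rewrite Int0.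
Qed.

Variable k : nat.
Hypothesis k0 : (0 < k)%N.

Let k1 : (1 : R) <= k%:R. Proof. by rewrite ler1n. Qed.
Let c := modulus (Oc k : R[i]).

Lemma modulus_Oc_gt0 : 0 < c.
Proof. by rewrite /c modulus_Oc divr_gt0 ?mulr_gt0 ?pi_gt0// ltr0n. Qed.

(** The power of the phase of [z] cancels that of [Omega k (z - w)] up to the small rotation
    [a ^+ k] of [phase_rotation]. The factor [i] makes the real part see [Im (a ^+ k)], which has
    opposite signs on the two squares, like [hR]. *)
Definition ftest z : R[i] := 'i%C * (Oc k)^* * (c^-1)%:C * (toC z * ((en z)^-1)%:C) ^+ k *
  (\1_(region k) z)%:C.

Lemma uconjJ z : toC z * ((en z)^-1)%:C = (uconj (toC z))^*.
Proof. by rewrite uconjE; case: z => x y; rewrite /toC /=; simpc. Qed.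

Lemma cmeasurable_ftest : cmeasurable ftest.
Proof.
have mi : measurable_fun setT (fun z : plane R => (en z)^-1).
  by apply: (measurableT_comp (@measurable_invr R)); exact: measurable_en.
apply: cmeasurable_mul; last first.
  by apply: cmeasurable_real; rewrite /region square_sq; exact: measurable_indic_sq.
apply: cmeasurable_mul; first exact: cmeasurable_cst.
apply: cmeasurableX; apply: cmeasurable_mul; last exact: cmeasurable_real.
by split; [exact: measurable_fst|exact: measurable_snd].
Qed.

Lemma ftest_le z : modulus (ftest z) <= 1.
Proof.
have c0 := modulus_Oc_gt0.
rewrite /ftest uconjJ !Normc.normcM modulus_i mul1r !modulusJ modulusX modulusJ !modulus_real.
rewrite (gtr0_norm (_ : 0 < c^-1)) ?invr_gt0// -/c divff ?gt_eqF// mul1r.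
rewrite (ger0_norm (indic_ge0 _ _)) -[leRHS]mulr1; apply: ler_pM => //.
- by apply: exprn_ge0; exact: modulus_ge0.
- by apply: exprn_ile1; [exact: modulus_ge0|exact: modulus_uconj_le].
Qed.

Lemma ftest_Linfty : in_Linfty ftest /\ (Linfty_norm ftest <= 1%:E)%E.
Proof.
have H : (Linfty_norm ftest <= 1%:E)%E by apply/Linfty_normP; apply: aeW; exact: ftest_le.
split; [split; [exact: cmeasurable_ftest|apply: le_lt_trans H _]|exact: H].
exact: ltry.
Qed.

(** The product of lower bounds for [|Oc k| = k / (2 pi)], for [|z - w|^-2] and for the phase; it is
    of order [1 / k]. *)
Let kap : R := k%:R / 8 / (45 * k%:R) ^+ 2 * (1 / 120).

Lemma ftest_Omega z w : region k z ->
  Re (ftest z * Omega k (toC z - toC w)) =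
  c / en ((z : R * R) - w) ^+ 2 * - Im (((uconj (toC z))^* * uconj (toC z - toC w)) ^+ k).
Proof.
move=> zG; have c0 := modulus_Oc_gt0.
have -> : ftest z * Omega k (toC z - toC w) = (c / en ((z : R * R) - w) ^+ 2)%:C *
    ('i%C * ((uconj (toC z))^* * uconj (toC z - toC w)) ^+ k).
  rewrite /ftest uconjJ OmegaJ indicE mem_set// mulr1 [in RHS]exprMn modulus_norm en_toC.
  have cc : (Oc k)^* * Oc k = (c%:C : R[i]) ^+ 2 by rewrite mulrC -sqr_normc.
  have -> : (c / en ((z : R * R) - w) ^+ 2)%:C = c%:C / (en ((z : R * R) - w))%:C ^+ 2 :> R[i].
    by rewrite fmorph_div rmorphXn.
  have -> : (c^-1)%:C = (c%:C)^-1 :> R[i] by rewrite fmorphV.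
  have key : (Oc k)^* * Oc k * (c%:C)^-1 = c%:C.
    by rewrite cc expr2 mulfK// fmorph_eq0 gt_eqF.
  by rewrite -[X in _ = X / _ * _]key; ring.
case: (_ ^+ k) => x y; rewrite complex_ReM /=; ring.
Qed.

Lemma ftest_Omega_hR z w : region k z ->
  kap * (\1_Qr w + \1_Ql w) <= Re (ftest z * Omega k (toC z - toC w)) * hR w.
Proof.
move=> zG; rewrite ftest_Omega//.
have main (s : R) : s ^+ 2 = 1 -> 1 <= s * w.1 <= 2 -> 0 <= w.2 <= 1 ->
    kap <= c / en ((z : R * R) - w) ^+ 2 *
      - (s * Im (((uconj (toC z))^* * uconj (toC z - toC w)) ^+ k)).
  move=> s2 sw w2; have [h1 /andP[e0 e1]] := phase_rotation k0 zG s2 sw w2.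
  have kp : 0 < k%:R :> R by lra.
  rewrite /kap; apply: ler_pM => //.
  apply: ler_pM.
  - exact: divr_ge0.
  - by rewrite invr_ge0 sqr_ge0.
  - rewrite /c modulus_Oc; apply: ler_wpM2l => //.
    rewrite lef_pV2 ?posrE ?mulr_gt0 ?pi_gt0//; have := @pihalf_lt2 R; lra.
  - rewrite lef_pV2 ?posrE ?exprn_gt0 ?mulr_gt0//.
    by apply: lerXn2r e1; rewrite nnegrE; [exact: ltW|rewrite mulr_ge0].
rewrite -hR_norm; have [[hw r]|[hw l]|[hw _ _]] := hR_cases w; rewrite hw.
- rewrite normr1 !mulr1 -[Im _]mul1r; move: r; rewrite /Qr /square /= !in_itv /= => -[w1 /andP[w2 w3]].
  by apply: main; rewrite ?expr1n ?mul1r//; lra.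
- rewrite normrN normr1 mulr1 mulrN1 -mulrN opprK.
  have := main (-1); rewrite !mulN1r opprK; apply; first by rewrite sqrrN expr1n.
  + by move: l; rewrite /Ql /square /= !in_itv /= => -[/andP[? ?] _]; lra.
  + by move: l; rewrite /Ql /square /= !in_itv /= => -[_ /andP[? ?]]; lra.
- by rewrite normr0 !mulr0.
Qed.

(** The region lies far above the support of [hR], so the principal values are ordinary integrals
    and the pointwise bound can be integrated over the two unit squares. *)
Lemma pv_ftest z : region k z ->
  2 * kap <= Re (ftest z) * pv (Kre k) hR z - Im (ftest z) * pv (Kim k) hR z.
Proof.
move=> zG.
have away w : en ((z : R * R) - w) <= 1 -> hR w = 0.
  move=> zw; have h1 := le_trans (le_en2 ((z : R * R) - w)) zw.
  have [[_ r]|[_ l]|[->//]] := hR_cases w; exfalso.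
  - move: r zG h1; rewrite /Qr /region /square /= !in_itv /= => -[_ /andP[? ?]] [_ /andP[? ?]] /ler_normlP[] => ? ?; have kk := k1; lra.
  - move: l zG h1; rewrite /Ql /region /square /= !in_itv /= => -[_ /andP[? ?]] [_ /andP[? ?]] /ler_normlP[] => ? ?; have kk := k1; lra.
have bR := bcs_away (czk_Kre k0) bcs_hR ltr01 away.
have bI := bcs_away (czk_Kim k0) bcs_hR ltr01 away.
rewrite (pv_away (czk_Kre k0) bcs_hR ltr01 away) (pv_away (czk_Kim k0) bcs_hR ltr01 away).
rewrite -!IntZ; [|exact: bcs_Ig..]; rewrite -IntB; [|by apply: bcs_Ig; exact: bcsZ..].
have [b1 E1] := @square_indic (1, 0) 1 ltr01; have [b2 E2] := @square_indic (-2, 0) 1 ltr01.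
have -> : 2 * kap = Int (fun w => kap * (\1_Qr w + \1_Ql w)).
  rewrite IntZ; last by apply: bcs_Ig; exact: (bcsD b1 b2).
  rewrite (IntD (bcs_Ig b1) (bcs_Ig b2)) [X in X + _]E1 [X in _ + X]E2 expr1n; ring.
apply: Int_le => [||w].
- by apply: bcs_Ig; apply: bcsZ; exact: (bcsD b1 b2).
- by apply: bcs_Ig; apply: bcsB; exact: bcsZ.
- apply: (le_trans (ftest_Omega_hR w zG)); rewrite complex_ReM.
  by rewrite le_eqVlt; apply/orP; left; apply/eqP; rewrite /Kre /Kim toCB; ring.
Qed.

(** The real part alone is at least [2 kap], of order [1 / k], on a region of area [k^2]: a total of
    order [k]. *)
Lemma ftest_pairing : 2 * kap * k%:R ^+ 2 <=
  modulus (cintegral setT (fun z => ftest z * Rk k (fun w => (hR w)%:C) z)).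
Proof.
have kp : 0 < k%:R :> R by rewrite ltr0n.
apply: le_trans (Re_le_modulus _); apply: le_trans (ler_norm _); rewrite /cintegral /=.
have bh : cbcs (fun w => (hR w)%:C) by split => /=; [exact: bcs_hR|exact: bcs_cst0].
have mh := cbcs_cmeasurable bh.
have RkE := Rk_ae k0 mh bh (aeW _ (fun w => erefl)).
have P0 K z : pv K (fun=> 0) z = 0.
  apply: pvE; apply: cvg_near_cst; apply: nearW => e.
  by rewrite /tr cvE; under eq_fun do rewrite mulr0; exact: Int0.
have [m1 m2] := cmeasurable_ftest.
have f1 z : `|Re (ftest z)| <= 1 := le_trans (Re_le_modulus _) (ftest_le z).
have f2 z : `|Im (ftest z)| <= 1 := le_trans (Im_le_modulus _) (ftest_le z).
have I1 := Ig_mul_bounded m1 f1 (Ig_pv (@kap_log R k) (czk_Kre k0) bcs_hR Int_hR).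
have I2 := Ig_mul_bounded m2 f2 (Ig_pv (@kap_log R k) (czk_Kim k0) bcs_hR Int_hR).
have I3 : Ig (fun z => Re (ftest z) * pv (Kre k) hR z - Im (ftest z) * pv (Kim k) hR z).
  by have := integrableB measurableT I1 I2.
have [bG EG] := @square_indic (0, 40 * k%:R) _ kp.
rewrite (@Rintegral_ae _ _ (fun z => Re (ftest z) * pv (Kre k) hR z - Im (ftest z) * pv (Kim k) hR z)).
- rewrite -EG -IntZ; last exact: bcs_Ig.
  apply: Int_le => [||z]; [by apply: bcs_Ig; exact: bcsZ|exact: I3|].
  have [zG|zG] := pselect (region k z).
    by rewrite indicE mem_set// mulr1; exact: pv_ftest.
  rewrite indicE memNset// mulr0.
  have -> : ftest z = 0 by rewrite /ftest indicE memNset// mulr0.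
  by rewrite /= !mul0r subrr.
- by have /integrableP[/measurable_EFinP] := I3.
- apply: filterS RkE => z ->; rewrite complex_ReM /=.
  by rewrite !P0 subr0 add0r.
Qed.

End test_functions.

(** * Pairing with BMO and the lower bound *)

Section operator_norm_lower.
Context {R : realType}.
Notation Ig f := ((area R).-integrable setT (EFin \o f)).
Notation Re := complex.Re.
Notation Im := complex.Im.

(** As [hR] has mean zero, [m] may be subtracted from [u]; moreover [hR] is bounded by [1] and
    supported in [Qh]. *)
Lemma BMO_pairing (u : plane R -> R) (m B : R) : (area R).-integrable (Qh) (EFin \o u) ->
  (\int[area R]_(z in Qh) (`|u z - m|)%:E <= B%:E)%E ->
  `|Rintegral (area R) setT (fun z => u z * hR z)| <= B.
Proof.
move=> Iu H; set Q := Qh in Iu H *.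
have mQ : measurable Q by rewrite /Q /Qh square_sq; exact: measurable_sq.
have l4 : 0 < 4 :> R by [].
have [bQ _] := @square_indic R (-2, 0) 4 l4; rewrite -/Qh -/Q in bQ.
have Iu' : Ig (fun z => u z * \1_Q z).
  move/(integrable_mkcond _ mQ): Iu; congr (integrable _ _ _); apply/funext => z.
  by rewrite /patch /= indicE; case: ifP => _; rewrite ?mulr1 ?mulr0.
have I1 : Ig (fun z => u z * \1_Q z - m * \1_Q z).
  by have := integrableB measurableT Iu' (IgZ m (bcs_Ig bQ)).
have I2 : Ig (fun z => `|u z - m| * \1_Q z).
  have := integrable_norm I1; congr (integrable _ _ _); apply/funext => z /=.
  by rewrite -mulrBl normrM (ger0_norm (indic_ge0 _ _)).
have E2 : Int (fun z => `|u z - m| * \1_Q z) <= B.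
  rewrite -lee_fin -EFin_Int//; apply: le_trans H; rewrite le_eqVlt; apply/orP; left; apply/eqP.
  rewrite [RHS]integral_mkcond; apply: eq_integral => z _.
  by rewrite /patch indicE; case: ifP => _; rewrite ?mulr1 ?mulr0.
have hQ z : hR z * \1_Q z = hR z.
  rewrite indicE; have [zs|/hR_support ->] := pselect (Q z); last by rewrite mul0r.
  by rewrite mem_set// mulr1.
have I3 : Ig (fun z => hR z * (u z * \1_Q z)) := Ig_mul_bounded (bcs_measurable bcs_hR) hR_le Iu'.
have -> : Rintegral (area R) setT (fun z => u z * hR z) = Int (fun z => hR z * (u z * \1_Q z) - m * hR z).
  rewrite (IntB I3 (IgZ m (bcs_Ig bcs_hR))) (IntZ _ (bcs_Ig bcs_hR)) Int_hR mulr0 subr0 unlock.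
  by congr Rintegral; apply/funext => z; rewrite -[in LHS]hQ; ring.
have I4 : Ig (fun z => hR z * (u z * \1_Q z) - m * hR z).
  by have := integrableB measurableT I3 (IgZ m (bcs_Ig bcs_hR)).
apply: (le_trans (Int_abs I4)); apply: le_trans E2; apply: Int_le => //; first exact: integrable_norm.
move=> z; have -> : hR z * (u z * \1_Q z) - m * hR z = hR z * ((u z - m) * \1_Q z).
  by rewrite -{2}(hQ z); ring.
rewrite normrM [`|_ * \1_Q z|]normrM (ger0_norm (indic_ge0 _ _)); apply: ler_piMl; last exact: hR_le.
by rewrite mulr_ge0// indic_ge0.
Qed.

(** The area [16] of [Qh], counted once for each of the real and imaginary parts. *)
Lemma BMO_pairing_complex (b : plane R -> R[i]) (M : R) : in_BMO b -> (BMO_norm b <= M%:E)%E ->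
  modulus (cintegral setT (fun z => b z * (hR z)%:C)) <= 32 * M.
Proof.
move=> [mb [bI _]] bM; have l4 : 0 < 4 :> R by [].
have [I1 I2] := bI (-2, 0) 4 l4; rewrite -/Qh in I1 I2; set Q := Qh in I1 I2.
have mQ : measurable Q by rewrite /Q /Qh square_sq; exact: measurable_sq.
set m := average (-2, 0) 4 b.
have mm : measurable_fun setT (fun z => modulus (b z - m)).
  have [b1 b2] := mb; apply: measurable_modulus; split; under eq_fun do rewrite raddfB /=.
  - by apply: measurable_funB => //; exact: measurable_cst.
  - by apply: measurable_funB => //; exact: measurable_cst.
have H : (\int[area R]_(z in Q) (modulus (b z - m))%:E <= (16 * M)%:E)%E.
  have : ((4 ^- 2)%:E * \int[area R]_(z in Q) (modulus (b z - m))%:E <= M%:E)%E.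
    by apply: le_trans bM; apply: ereal_sup_ubound; exists (-2, 0), 4.
  have -> : (16 : R) * M = M / 4 ^- 2 by rewrite invrK; ring.
  by rewrite EFinM lee_pdivlMr ?invr_gt0 ?exprn_gt0// muleC.
have part (p : R[i] -> R) : measurable_fun setT (fun z => p (b z)) ->
    (forall x y, p (x - y) = p x - p y) -> (forall x, `|p x| <= modulus x) ->
    (\int[area R]_(z in Q) (`|p (b z) - p m|)%:E <= (16 * M)%:E)%E.
  move=> mp pB pm; apply: le_trans H; apply: ge0_le_integral => //.
  - apply: (@measurable_funTS _ _ _ _ Q (fun z => (`|p (b z) - p m|)%:E)); apply/measurable_EFinP.
    by apply: measurableT_comp => //; apply: measurable_funB => //; exact: measurable_cst.
  - by apply: (@measurable_funTS _ _ _ _ Q (fun z => (modulus (b z - m))%:E)); exact/measurable_EFinP.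
  - by move=> z _; rewrite lee_fin -pB.
have [b1 b2] := mb.
have P1 := BMO_pairing I1 (part _ b1 (raddfB _) (@Re_le_modulus R)).
have P2 := BMO_pairing I2 (part _ b2 (raddfB _) (@Im_le_modulus R)).
apply: (le_trans (modulus_le_ReIm _)); rewrite /cintegral /=.
have -> : (fun z => Re (b z * (hR z)%:C)) = (fun z => Re (b z) * hR z).
  by apply/funext => z; rewrite complex_ReM /= mulr0 subr0.
have -> : (fun z => Im (b z * (hR z)%:C)) = (fun z => Im (b z) * hR z).
  by apply/funext => z; rewrite complex_ImM /= mulr0 add0r.
lra.
Qed.

Lemma opnorm_lower : exists2 c : R, 0 < c & forall k : nat, (0 < k)%N ->
  ((c * k%:R)%:E <= Rk_opnorm R k)%E.
Proof.
(* The quantity [2 kap k^2] of [ftest_pairing] divided by the [32 k] of the BMO side. *)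
pose c : R := (4 * 32 * 45 ^+ 2 * 120)^-1.
have c0 : 0 < c by rewrite invr_gt0 !mulr_gt0// exprn_gt0.
exists c => // k k0; have kp : 0 < k%:R :> R by rewrite ltr0n.
apply: le_ereal_inf_tmp => _ [M [M0 H] <-]; rewrite lee_fin.
have [fL f1] := @ftest_Linfty R k k0; have [b [[bB bP] bM]] := H _ fL.
have bM' : (BMO_norm b <= M%:E)%E.
  by apply: (le_trans bM); rewrite -[leRHS]mule1; apply: lee_wpmul2l => //; rewrite lee_fin.
have := BMO_pairing_complex bB bM'; rewrite (bP _ atomic_hR) Normc.normcM modulusX normcN Normc.normc1 expr1n mul1r.
move=> /(le_trans (ftest_pairing k0)) H2.
have E : 2 * (k%:R / 8 / (45 * k%:R) ^+ 2 * (1 / 120)) * k%:R ^+ 2 = 32 * (c * k%:R) :> R.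
  by rewrite /c; field; rewrite gt_eqF.
by rewrite E ler_pM2l// in H2.
Qed.

End operator_norm_lower.

Theorem theorem1p3 (R : realType) :
  exists c C : R, 0 < c /\ c <= C /\
    forall k : nat, (0 < k)%N ->
      ((c * k%:R)%:E <= Rk_opnorm R k)%E /\
      (Rk_opnorm R k <= (C * k%:R * ln (k.+1)%:R)%:E)%E.
Proof.
have [c c0 hc] := @opnorm_lower R; have [C C0 hC] := @opnorm_upper R.
exists c, (Num.max c C); split => //; split; first by rewrite le_max lexx.
move=> k k0; split; first exact: hc.
apply: (le_trans (hC k k0)); rewrite lee_fin; apply: ler_wpM2r.
  by rewrite ln_ge0// ler1n.
by apply: ler_wpM2r => //; rewrite le_max lexx orbT.
Qed.
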